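(* Let $\mathcal{D}\subset\mathbb{R}^N$ be open, bounded, connected, let $F:\partial\mathcal{D}\to\mathbb{R}$ be continuous, and for $\epsilon\in(0,1)$ let $u^\epsilon(x)=\mathbb{E}[F\circ X^{\epsilon,x}]$, $x\in\mathcal{D}$. Let $J\subset(0,1)$ be a sequence decreasing to $0$, and assume that $\{u^\epsilon\}_{\epsilon\in J}$ converges locally uniformly in $\mathcal{D}$, as $\epsilon\to0$, $\epsilon\in J$, to some $u\in C(\mathcal{D})$. Then $u$ is harmonic in $\mathcal{D}$.
   Context: Probability space: $\Omega_1=B_1(0)\subset\mathbb{R}^N$ with Borel $\sigma$-algebra and normalised Lebesgue measure; $(\Omega,\mathcal{F},\mathbb{P})$ is the countable product $\Omega=(\Omega_1)^{\mathbb{N}}$, $\omega=\{w_i\}_{i\ge1}$. The $\epsilon$-ball walk started at $x\in\mathcal{D}$: $X_0^{\epsilon,x}\equiv x$, $X_n^{\epsilon,x}=X_{n-1}^{\epsilon,x}+\big(\epsilon\wedge\operatorname{dist}(X_{n-1}^{\epsilon,x},\partial\mathcal{D})\big)w_n$ for $n\ge1$; it converges $\mathbb{P}$-a.s. to a random variable $X^{\epsilon,x}:\Omega\to\partial\mathcal{D}$. *)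

(* Defs.v *)
From HB Require Import structures.
From mathcomp Require Import all_boot all_order all_algebra.
From mathcomp Require Import all_classical all_reals all_analysis.
Set Implicit Arguments.
Unset Strict Implicit.
Unset Printing Implicit Defensive.
Import Order.TTheory GRing.Theory Num.Theory.
Import numFieldNormedType.Exports.
Local Open Scope classical_set_scope.
Local Open Scope ring_scope.

Section Defs.
Variables (R : realType) (N : nat).
Local Notation V := 'rV[R]_N.

(* Euclidean norm on R^N (the library's norm on 'rV is the sup norm). *)
Definition enorm (v : V) : R := Num.sqrt (\sum_(i < N) v ord0 i ^+ 2).

Definition unit_ball : set V := [set v | enorm v < 1].

Definition bdry (D : set V) : set V := closure D `\` interior D.

Definition dist_bdry (D : set V) (x : V) : R :=
  inf [set enorm (x - y) | y in bdry D].

(* Iterated Lebesgue integral over R^n (Tonelli), coordinates listed in s. *)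
Fixpoint iter_int (n : nat) (f : seq R -> \bar R) : \bar R :=
  match n with
  | 0 => f [::]
  | n'.+1 => (\int[@lebesgue_measure R]_t iter_int n' (fun s => f (t :: s)))%E
  end.

Definition volN (A : set V) : \bar R :=
  iter_int N (fun s => (\1_A (\row_(i < N) nth 0 s i) : R)%:E).

Definition evec (i : 'I_N) : V := delta_mx 0 i.

Definition harmonic_in (D : set V) (u : V -> R) : Prop :=
  forall x, D x ->
    [/\ {for x, continuous u},
        (forall i, derivable u x (evec i)),
        (forall i j, derivable ('D_(evec i) u) x (evec j)),
        (forall i j, {for x, continuous ('D_(evec j) ('D_(evec i) u))}) &
        \sum_(i < N) 'D_(evec i) ('D_(evec i) u) x = 0].

Section Prob.
Context {d : measure_display} {T : measurableType d} (P : probability T R).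

(* Borel measurability of a random vector (open sets generate the Borel sets). *)
Definition rvec_measurable (X : T -> V) : Prop :=
  forall A : set V, open A -> measurable (X @^-1` A).

(* X is uniformly distributed on B_1(0): its law is normalised Lebesgue
   measure on the ball (checked on open sets, a generating pi-system). *)
Definition uniform_on_ball (X : T -> V) : Prop :=
  forall A : set V, open A ->
    (P (X @^-1` A) * volN unit_ball = volN (A `&` unit_ball))%E.

(* Mutual independence of the family w (checked on open sets, a generating
   pi-system): product rule over every finite set of distinct indices. *)
Definition mutually_independent (w : nat -> T -> V) : Prop :=
  forall (I : seq nat) (A : nat -> set V), uniq I -> (forall i, open (A i)) ->
    P (\bigcap_(i in [set j | j \in I]) (w i @^-1` A i)) =
    (\prod_(i <- I) P (w i @^-1` A i))%E.

(* w_1, w_2, ... i.i.d. uniform on B_1(0); w n stands for w_{n+1}. *)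
Definition iid_uniform_ball (w : nat -> T -> V) : Prop :=
  [/\ forall n, rvec_measurable (w n),
      forall n, uniform_on_ball (w n) &
      mutually_independent w].

Fixpoint ball_walk (D : set V) (w : nat -> T -> V) (eps : R) (x : V)
    (n : nat) (om : T) : V :=
  match n with
  | 0 => x
  | n'.+1 => let y := ball_walk D w eps x n' om in
             y + (Order.min eps (dist_bdry D y)) *: w n' om
  end.

Definition ball_walk_lim D w eps x (om : T) : V :=
  limn (fun n => ball_walk D w eps x n om).

Definition u_eps D (F : V -> R) w eps (x : V) : R :=
  fine (\int[P]_om (F (ball_walk_lim D w eps x om))%:E)%E.

End Prob.
End Defs.

(* Main.v *)
Require Import Defs.
From HB Require Import structures.
From mathcomp Require Import all_boot all_order all_algebra.
From mathcomp Require Import all_classical all_reals all_analysis.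
From mathcomp Require Import ring lra measurable_realfun.
Import Order.TTheory GRing.Theory Num.Theory.
Import numFieldNormedType.Exports.
Local Open Scope classical_set_scope.
Local Open Scope ring_scope.
Set Implicit Arguments.
Unset Strict Implicit.
Unset Printing Implicit Defensive.

(* Let U(x) be the expectation of F at the limit of the walk from x. Conditioning
   on the first step gives U(y) = E[U(y + eps w)] whenever eps <= dist(y, bdry D).
   Test this against the radial profile (sigma - |y - z|^2)_+^(k+2), move the
   translation from U onto the profile, and expand to second order in eps: in the
   limit, u is orthogonal to the Laplacians of these profiles. For the profile of
   exponent 4 this makes the average of u with weight (sigma - |y - z|^2)_+^3
   independent of sigma, hence equal to u(z) by continuity. The weight is C^2 in z,
   so this representation of u may be differentiated twice under the integral, and
   for the profile of exponent 3 the orthogonality says that the Laplacian of u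
   vanishes.

   F is controlled on bdry D only; almost every path leads to bdry D (or has no
   limit, in which case the limit is a junk point), and U is built from F cut off
   outside these points, which makes it measurable. *)

(** * Euclidean norm and Borel sets of row vectors *)

Section Euclidean.
Context {R : realType} {N : nat}.
Local Notation V := 'rV[R]_N.
Implicit Types (v w x y : V) (A : set V).

(** The obstacle is how little the laws at hand offer: from the iterated integral [volN], only
    translation invariance and comparison with cubes are extracted. Averages over balls are
    therefore expectations under the law of one increment, carried over by an affine map, and the
    isotropy of its second moments is obtained by differentiating the translation invariance of
    weighted integrals; rotations do not enter. The profiles are powers of a positive part, not
    smooth mollifiers: their Taylor remainders are elementary inequalities, and writing |y - z|^2 as
    sigma minus (sigma - |y - z|^2) keeps their Laplacians, on the support, within the same family
    of powers. This is what produces a first-order relation in sigma. Most passages to the limit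
    take the form of a bound [C * t] on a fixed number, for all small t. The sample space has no
    shift of increments, so the walk is transported to the space of sequences, where conditioning on
    the first step becomes Fubini. *)

Definition dot v w : R := \sum_(i < N) v ord0 i * w ord0 i.

Lemma dotC v w : dot v w = dot w v.
Proof. by apply: eq_bigr => i _; rewrite mulrC. Qed.

Lemma dotDl v w x : dot (v + w) x = dot v x + dot w x.
Proof. by rewrite -big_split; apply: eq_bigr => i _; rewrite mxE mulrDl. Qed.

Lemma dotZl a v w : dot (a *: v) w = a * dot v w.
Proof. by rewrite mulr_sumr; apply: eq_bigr => i _; rewrite mxE mulrA. Qed.

Lemma dotNl v w : dot (- v) w = - dot v w.
Proof. by rewrite -scaleN1r dotZl mulN1r. Qed.

Lemma dotDr v w x : dot x (v + w) = dot x v + dot x w.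
Proof. by rewrite dotC dotDl !(dotC x). Qed.

Lemma dotZr a v w : dot w (a *: v) = a * dot w v.
Proof. by rewrite dotC dotZl (dotC w). Qed.

Lemma dotNr v w : dot w (- v) = - dot w v.
Proof. by rewrite dotC dotNl (dotC w). Qed.

Lemma dot_ge0 v : 0 <= dot v v.
Proof. by apply: sumr_ge0 => i _; rewrite -expr2 sqr_ge0. Qed.

Lemma enormE v : enorm v = Num.sqrt (dot v v).
Proof. by congr Num.sqrt; apply: eq_bigr => i _; rewrite expr2. Qed.

Lemma enorm_ge0 v : 0 <= enorm v.
Proof. exact: sqrtr_ge0. Qed.

Lemma enorm_sqr v : enorm v ^+ 2 = dot v v.
Proof. by rewrite enormE sqr_sqrtr// dot_ge0. Qed.

Lemma enorm0 : enorm (0 : V) = 0.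
Proof. by rewrite enormE /dot big1 ?sqrtr0// => i _; rewrite mxE mul0r. Qed.

Lemma enormZ a v : enorm (a *: v) = `|a| * enorm v.
Proof.
by rewrite !enormE dotZl dotZr mulrA -expr2 sqrtrM ?sqr_ge0// sqrtr_sqr.
Qed.

Lemma enormN v : enorm (- v) = enorm v.
Proof. by rewrite -scaleN1r enormZ normrN1 mul1r. Qed.

Lemma enormB v w : enorm (v - w) = enorm (w - v).
Proof. by rewrite -enormN opprB. Qed.

(* The discriminant of [t |-> |v - t w|^2 >= 0] is nonpositive. *)
Lemma dot_sqr_le v w : dot v w ^+ 2 <= dot v v * dot w w.
Proof.
have [w0|wn0] := eqVneq (dot w w) 0.
  have w0i i : w ord0 i = 0.
    move: w0 => /eqP; rewrite psumr_eq0; last first.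
      by move=> j _; rewrite -expr2 sqr_ge0.
    by move=> /allP /(_ i); rewrite mem_index_enum mulf_eq0 orbb => /(_ isT)/eqP.
  rewrite w0 mulr0 /dot big1 ?expr0n// => i _.
  by rewrite w0i mulr0.
have wp : 0 < dot w w by rewrite lt_neqAle eq_sym wn0 dot_ge0.
have := dot_ge0 (dot w w *: v - dot v w *: w).
rewrite !(dotDl, dotDr, dotNl, dotNr, dotZl, dotZr) (dotC w v) => h.
have : 0 <= dot w w * (dot v v * dot w w - dot v w ^+ 2) by move: h; nra.
by rewrite pmulr_rge0// subr_ge0.
Qed.

Lemma dot_le v w : `|dot v w| <= enorm v * enorm w.
Proof.
rewrite -(@ler_pXn2r _ 2)// ?nnegrE ?mulr_ge0 ?enorm_ge0//.
by rewrite exprMn !enorm_sqr real_normK ?num_real// dot_sqr_le.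
Qed.

Lemma enormD v w : enorm (v + w) <= enorm v + enorm w.
Proof.
rewrite -(@ler_pXn2r _ 2)// ?nnegrE ?addr_ge0 ?enorm_ge0//.
rewrite sqrrD !enorm_sqr dotDl !dotDr (dotC w v).
have := le_trans (ler_norm _) (dot_le v w); lra.
Qed.

Lemma enorm_triangle x y v : enorm (x - y) <= enorm (x - v) + enorm (v - y).
Proof. by rewrite (le_trans _ (enormD _ _))// addrA subrK. Qed.

Lemma coord_le v i : `|v ord0 i| <= enorm v.
Proof.
rewrite -(@ler_pXn2r _ 2)// ?nnegrE ?enorm_ge0//.
rewrite enorm_sqr real_normK ?num_real// /dot (bigD1 i)//= -expr2 lerDl.
by apply: sumr_ge0 => j _; rewrite -expr2 sqr_ge0.
Qed.

Lemma coord_le_norm v i : `|v ord0 i| <= `|v|.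
Proof.
rewrite [leRHS]/Num.norm /= mx_normrE; apply/bigmax_geP; right => /=.
by exists (ord0, i).
Qed.

Lemma norm_le_enorm v : `|v| <= enorm v.
Proof.
rewrite [leLHS]/Num.norm /= mx_normrE; apply/bigmax_leP; split=> [|[i j] _ /=].
  exact: enorm_ge0.
by rewrite ord1 coord_le.
Qed.

Lemma enorm_le_norm v : enorm v <= N%:R * `|v|.
Proof.
rewrite -(@ler_pXn2r _ 2)// ?nnegrE ?mulr_ge0 ?enorm_ge0//.
rewrite enorm_sqr /dot exprMn.
apply: (@le_trans _ _ (\sum_(i < N) `|v| ^+ 2)).
  apply: ler_sum => i _; rewrite -expr2 -real_normK ?num_real//.
  by rewrite lerXn2r ?nnegrE// coord_le_norm.
rewrite sumr_const card_ord -[leLHS]mulr_natl ler_wpM2r ?sqr_ge0//.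
by case: N => [|n]; rewrite ?expr0n// expr2 ler_peMr// ler1n.
Qed.

(** This is the passage from Euclidean estimates to the topology of row vectors, which is that of
    the sup norm. *)
Lemma lipschitz_continuous (W : normedModType R) (f : V -> W) (C : R) :
  (forall x y, `|f x - f y| <= C * enorm (x - y)) -> continuous f.
Proof.
move=> fC x; apply/(@cvgrPdist_lt _ _ _ (f @ nbhs x)) => e e0.
(* [|C|] because [C] has no sign, and [+ 1] to keep [K] positive when the product vanishes. *)
pose K := `|C| * N%:R + 1.
have K0 : 0 < K by rewrite ltr_pwDr// mulr_ge0.
apply/nbhs_ballP; exists (e / K); first exact: divr_gt0.
move=> y; rewrite -ball_normE /ball_ /= ltr_pdivlMr// => xy.
apply: le_lt_trans (fC _ _) _; apply: le_lt_trans xy.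
apply: (@le_trans _ _ (`|C| * (N%:R * `|x - y|))).
  by rewrite (le_trans (ler_wpM2r (enorm_ge0 _) (ler_norm _)))// ler_wpM2l// enorm_le_norm.
by rewrite mulrA mulrC ler_wpM2l// /K lerDl.
Qed.

Lemma enormB_le x y : `|enorm x - enorm y| <= enorm (x - y).
Proof.
rewrite ler_norml; apply/andP; split.
  by have := enorm_triangle y 0 x; rewrite !subr0 (enormB y); lra.
by have := enorm_triangle x 0 y; rewrite !subr0; lra.
Qed.

Lemma continuous_enorm : continuous (@enorm R N).
Proof. by apply: (@lipschitz_continuous _ _ 1) => x y; rewrite mul1r enormB_le. Qed.

Lemma continuous_enormB x : continuous (fun y => enorm (y - x)).
Proof.
apply: (@lipschitz_continuous _ _ 1) => y z; rewrite mul1r.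
by rewrite (le_trans (enormB_le _ _))// opprB addrA subrK.
Qed.

Lemma open_eball x r : open [set y | enorm (y - x) < r].
Proof.
rewrite (_ : mkset _ = (fun y => enorm (y - x)) @^-1` [set t | t < r]).
  by apply: open_comp; [move=> y _; exact: continuous_enormB | exact: open_lt].
by [].
Qed.

Lemma closed_eball x r : closed [set y | enorm (y - x) <= r].
Proof.
rewrite (_ : mkset _ = (fun y => enorm (y - x)) @^-1` [set t | t <= r]).
  apply: preimage_closed; last exact: closed_le.
  by move=> y _; exact: continuous_enormB.
by [].
Qed.

Lemma compact_eball x r : compact [set y | enorm (y - x) <= r].
Proof.
apply: bounded_closed_compact; last exact: closed_eball.
exists (r + enorm x); split; first exact: num_real.
move=> M rM y /= yr; apply: le_trans (ltW rM).
apply: le_trans (norm_le_enorm _) _.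
by have := enorm_triangle y 0 x; rewrite !subr0; lra.
Qed.

Lemma nbhs_eball x A : nbhs x A <->
  exists2 r, 0 < r & [set y | enorm (y - x) < r] `<=` A.
Proof.
split=> [/nbhs_ballP[r /= r0 rA]|[r r0 rA]].
  exists r => // y /= yr; apply: rA.
  rewrite -ball_normE /ball_ /= distrC; exact: le_lt_trans (norm_le_enorm _) yr.
apply: filterS rA _; apply: open_nbhs_nbhs; split; first exact: open_eball.
by rewrite /= subrr enorm0.
Qed.

End Euclidean.

Notation borelV R N := (g_sigma_algebraType (@open 'rV[R]_N)).

Section Borel.
Context {R : realType} {N : nat}.
Local Notation V := 'rV[R]_N.
Local Notation bV := (borelV R N).
Implicit Types (v w x y : V) (A : set V).

Lemma open_measurableV A : open A -> measurable (A : set bV).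
Proof. by move=> oA; exact: sub_sigma_algebra. Qed.

Lemma closed_measurableV A : closed A -> measurable (A : set bV).
Proof.
by move=> cA; rewrite -[A]setCK; apply: measurableC; apply: open_measurableV; exact: closed_openC.
Qed.

Lemma open_setI_closed : setI_closed (@open V).
Proof. by move=> A B oA oB; exact: openI. Qed.

Lemma continuous_measurableV (f : V -> R) :
  continuous f -> measurable_fun setT (f : bV -> R).
Proof.
move=> cf; apply: (measurability _ (RGenOpens.measurableE R)).
move=> _ [_ [a [b ->]] <-]; rewrite setTI; apply: open_measurableV.
by apply: open_comp; [move=> x _; exact: cf|exact: interval_open].
Qed.

Lemma continuous_coord (i : 'I_N) : continuous (fun v : V => v ord0 i).
Proof.
suff h : forall x y : V, `|x ord0 i - y ord0 i| <= 1 * enorm (x - y).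
  exact: (lipschitz_continuous h).
by move=> x y; rewrite mul1r; have := coord_le (x - y) i; rewrite !mxE.
Qed.

Lemma measurable_coord (i : 'I_N) :
  measurable_fun setT (fun v : bV => (v : V) ord0 i : R).
Proof. exact: (continuous_measurableV (@continuous_coord i)). Qed.

(** Every open set is a countable union of sup-norm boxes with rational centres, and the preimage of
    a box is a finite intersection of conditions on single coordinates. *)
Lemma measurable_rV d (T : measurableType d) (X : T -> V) :
  (forall i, measurable_fun setT (fun t => X t ord0 i)) ->
  measurable_fun setT (X : T -> bV).
Proof.
move=> mX; apply: (@measurability _ _ T bV setT X (@open V) erefl).
move=> _ [A oA <-]; rewrite setTI.
pose box (p : 'rV[rat]_N * nat) : set V :=
  [set v | forall i, `|v ord0 i - ratr (p.1 ord0 i)| < p.2.+1%:R^-1].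
(* Boxes not contained in [A] are replaced by the empty set, so that the union runs over a whole
   countable type. *)
pose F p := if `[< box p `<=` A >] then box p else set0.
have -> : A = \bigcup_p F p.
  apply/seteqP; split=> [x Ax|x [p _]]; last first.
    by rewrite /F; case: asboolP => // pA; exact: pA.
  have /nbhs_ballP[r /= r0 rA] : nbhs x A by exact: open_nbhs_nbhs.
  (* Both [x] and [y] will lie within the radius of the rational centre, hence within twice the
     radius of each other. *)
  have [k kr] : exists k, 2 * k.+1%:R^-1 < r.
    have h0 : 0 < r / 2 by rewrite divr_gt0.
    exists (Num.truncn (r / 2)^-1).
    rewrite mulrC -ltr_pdivlMr// -[ltRHS]invrK ltf_pV2 ?posrE ?invr_gt0//.
    by rewrite truncnS_gt.
  have qP i : exists q : rat, `|x ord0 i - ratr q| < k.+1%:R^-1.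
    have : x ord0 i - k.+1%:R^-1 < x ord0 i + k.+1%:R^-1.
      by rewrite ltrBlDr -addrA ltrDl addr_gt0// invr_gt0.
    move=> /rat_in_itvoo[q]; rewrite in_itv/= => /andP[q1 q2].
    exists q; move: q1 q2; rewrite ltr_norml; move: (k.+1%:R^-1) (ratr q) => c z q1 q2.
    by apply/andP; split; lra.
  have [q qx] := choice qP.
  exists (\row_i q i, k) => //; rewrite /F asboolT.
    by move=> i /=; rewrite mxE.
  move=> y /= yb; apply: rA; split => // i j; rewrite ord1.
  have := yb j; have := qx j; rewrite /ball /= mxE => h1 h2.
  have -> : x ord0 j - y ord0 j = (x ord0 j - ratr (q j)) - (y ord0 j - ratr (q j)) by lra.
  rewrite (le_lt_trans (ler_normB _ _))//; move: h1 h2 kr.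
  by move: (k.+1%:R^-1) `|_| `|_| => c a b *; lra.
rewrite preimage_bigcup; apply: countable_bigcupT_measurable => [|p].
  exact: countableP.
rewrite /F; case: asboolP => _; last by rewrite preimage_set0.
rewrite (_ : X @^-1` _ = \bigcap_(i in [set: 'I_N])
   ((fun t => X t ord0 i) @^-1` (ball (ratr (p.1 ord0 i) : R) p.2.+1%:R^-1))).
  apply: fin_bigcap_measurable => // i _.
  by rewrite -[X in measurable X]setTI; apply: mX => //; exact: measurable_ball.
apply/seteqP; split=> [t h i _|t h i]; rewrite /ball /=.
  by rewrite distrC; exact: h.
by have := h i Logic.I; rewrite /ball /= distrC.
Qed.

Lemma measurable_coordX d (T : measurableType d) (X : T -> V) i :
  measurable_fun setT (X : T -> bV) -> measurable_fun setT (fun t => X t ord0 i).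
Proof. by move=> mX; exact: (measurableT_comp (measurable_coord i) mX). Qed.

Lemma measurable_addV d (T : measurableType d) (X Y : T -> V) :
  measurable_fun setT (X : T -> bV) -> measurable_fun setT (Y : T -> bV) ->
  measurable_fun setT ((fun t => X t + Y t) : T -> bV).
Proof.
move=> mX mY; apply: measurable_rV => i.
under eq_fun do rewrite mxE.
by apply: measurable_funD; exact: measurable_coordX.
Qed.

Lemma measurable_scaleV d (T : measurableType d) (a : T -> R) (X : T -> V) :
  measurable_fun setT a -> measurable_fun setT (X : T -> bV) ->
  measurable_fun setT ((fun t => a t *: X t) : T -> bV).
Proof.
move=> ma mX; apply: measurable_rV => i.
under eq_fun do rewrite mxE.
by apply: measurable_funM => //; exact: measurable_coordX.
Qed.

End Borel.

(** * Iterated integrals and volumes of balls *)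

(* Neither the iterated integrals behind [volN] nor the integrand of [u_eps] is
   known to be measurable, so these lemmas assume nothing on the integrands. *)
Section ArbitraryIntegrands.
Local Open Scope ereal_scope.
Context d (T : measurableType d) {R : realType} (mu : {measure set T -> \bar R}).
Import HBNNSimple.

Lemma ge0_le_integralT (f g : T -> \bar R) : (forall x, 0 <= f x) ->
  (forall x, f x <= g x) -> \int[mu]_x f x <= \int[mu]_x g x.
Proof.
move=> f0 fg; rewrite !ge0_integralTE//; last first.
  by move=> x; exact: le_trans (f0 x) (fg x).
apply: ereal_sup_le => _ [h /= hf <-]; exists h => // x.
exact: le_trans (hf x) (fg x).
Qed.

(** The integral of a nonnegative function is a supremum over the simple functions below it; as
    [phi] and [psi] are both measurable, composition permutes these simple functions and preserves
    their integrals. *)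
Lemma integral_transport (phi psi : T -> T) (g : T -> \bar R) :
  measurable_fun setT phi -> measurable_fun setT psi ->
  cancel phi psi -> cancel psi phi ->
  (forall A, measurable A -> mu (phi @^-1` A) = mu A) ->
  \int[mu]_x g (phi x) = \int[mu]_x g x.
Proof.
move=> mphi mpsi phiK psiK muphi.
have comp_nn (p : T -> T) : measurable_fun setT p -> forall h : {nnsfun T >-> R},
    exists k : {nnsfun T >-> R}, forall x, k x = h (p x).
  move=> mp h.
  have mk : measurable_fun setT (h \o p) by exact: measurableT_comp.
  have fk : finite_set (range (h \o p)).
    apply: (@sub_finite_set _ _ (range h)); last exact: fimfunP.
    by move=> _ [x _ <-]; exists (p x).
  have nk : forall x, (0 <= (h \o p) x)%R by move=> x /=.
  pose k : {nnsfun T >-> R} := HB.pack (h \o p)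
    (isMeasurableFun.Build _ _ _ _ _ mk) (FiniteImage.Build _ _ _ fk)
    (isNonNegFun.Build _ _ _ nk).
  by exists k.
have key f : (forall x, 0 <= f x) ->
    \int[mu]_x f (phi x) = \int[mu]_x f x.
  move=> f0; rewrite !ge0_integralTE//; congr ereal_sup.
  have sint (h k : {nnsfun T >-> R}) : (forall x, k x = h (phi x)) ->
      sintegral mu k = sintegral mu h.
    move=> kh; rewrite !sintegralET; apply: eq_fsbigr => r _; congr (_ * _).
    rewrite -[RHS]muphi//; congr (mu _).
    by apply/seteqP; split=> x /=; rewrite kh.
  apply/seteqP; split=> _ [h /= hf <-].
    have [k kh] := comp_nn _ mpsi h; exists k.
      by move=> x; rewrite kh -[in leRHS](psiK x) hf.
    by apply/esym/sint => x; rewrite kh phiK.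
  have [k kh] := comp_nn _ mphi h; exists k; last exact: sint.
  by move=> x; rewrite kh hf.
rewrite [LHS]integralE [RHS]integralE; congr (_ - _).
  rewrite -(key (g ^\+)).
    by apply: eq_integral => x _; rewrite !funeposE.
  by [].
rewrite -(key (g ^\-)).
  by apply: eq_integral => x _; rewrite !funenegE.
by [].
Qed.

(** A simple function below one integrand, set to 0 on [Z], is a simple function below the other one
    with the same integral. *)
Lemma eq_integral_off_null (Z : set T) (f g : T -> \bar R) : measurable Z ->
  mu Z = 0 -> (forall x, ~ Z x -> f x = g x) ->
  \int[mu]_x f x = \int[mu]_x g x.
Proof.
move=> mZ Z0.
have key f1 g1 : (forall x, 0 <= f1 x) -> (forall x, 0 <= g1 x) ->
    (forall x, ~ Z x -> f1 x = g1 x) -> \int[mu]_x f1 x <= \int[mu]_x g1 x.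
  move=> f0 g0 fg; rewrite !ge0_integralTE//; apply: ge_ereal_sup => _ [h hf <-].
  apply: ereal_sup_ubound; exists (proj_nnsfun h (measurableC mZ)).
    move=> x; rewrite -mrestrict patchE; case: ifPn => [|_]; last exact: g0.
    by rewrite inE => nZx; rewrite -fg.
  rewrite -mrestrict -integral_nnsfun; last exact: measurableC.
  have -> : sintegral mu h = \int[mu]_x (h x)%:E by rewrite integral_nnsfun// patch_setT.
  rewrite [RHS](ge0_negligible_integral mZ)//= ?setTD//.
    exact/measurable_EFinP.
  by move=> x _; rewrite lee_fin.
move=> fg; rewrite integralE [RHS]integralE; congr (_ - _); apply/eqP;
  rewrite eq_le; apply/andP; split; apply: key => // x nZ;
  rewrite ?funeposE ?funenegE fg//.
Qed.

End ArbitraryIntegrands.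

Section IteratedIntegral.
Local Open Scope ereal_scope.
Context {R : realType}.
Local Notation leb := (@lebesgue_measure R).

Lemma lebesgue_measure_shift (a : R) (A : set R) : measurable A ->
  leb ((fun t => t + a)%R @^-1` A) = leb A.
Proof.
have ms : measurable_fun setT (fun t : measurableTypeR R => t + a : measurableTypeR R)%R.
  by apply: measurable_funD => //; exact: measurable_cst.
move=> mA; rewrite -[LHS]/(pushforward leb (fun t : measurableTypeR R => t + a : measurableTypeR R)%R A).
apply/esym/lebesgue_measure_unique => //= _ [[x y]] _ <-.
rewrite /pushforward /= (_ : _ @^-1` _ = `](x - a)%R, (y - a)%R]%classic); last first.
  by apply/seteqP; split=> t /=; rewrite !in_itv/= ltrBlDr lerBrDr.
rewrite !lebesgue_measure_itv/= !lte_fin ltrD2r; case: ifP => // _.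
by rewrite -!EFinB; congr EFin; lra.
Qed.

Lemma integral_shift (a : R) (g : R -> \bar R) :
  \int[leb]_t g (t + a)%R = \int[leb]_t g t.
Proof.
apply: (@integral_transport _ _ _ _ (fun t : measurableTypeR R => t + a : measurableTypeR R)%R
  (fun t : measurableTypeR R => t - a : measurableTypeR R)%R).
- by apply: measurable_funD => //; exact: measurable_cst.
- by apply: measurable_funB => //; exact: measurable_cst.
- by move=> x; rewrite addrK.
- by move=> x; rewrite subrK.
- exact: lebesgue_measure_shift.
Qed.

Lemma eq_iter_int n (f g : seq R -> \bar R) :
  (forall s, size s = n -> f s = g s) -> iter_int n f = iter_int n g.
Proof.
elim: n f g => [|n IH] f g fg /=; first exact: fg.
by apply: eq_integral => t _; apply: IH => s sn; apply: fg; rewrite /= sn.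
Qed.

(** The translation vector is a function on all naturals, so that passing to its tail is composition
    with [succn], in step with the recursion of [iter_int]. *)
Fixpoint shift_seq (a : nat -> R) (s : seq R) : seq R :=
  if s is t :: s' then (t + a 0%N)%R :: shift_seq (a \o succn) s' else [::].

Lemma nth_shift_seq a s i : (i < size s)%N ->
  nth 0%R (shift_seq a s) i = (nth 0%R s i + a i)%R.
Proof. by elim: s i a => [|t s IH] [|i] a //= si; rewrite IH. Qed.

Lemma iter_int_shift n a (f : seq R -> \bar R) :
  iter_int n (f \o shift_seq a) = iter_int n f.
Proof.
elim: n a f => [|n IH] a f //=.
rewrite -[RHS](integral_shift (a 0%N)); apply: eq_integral => t _.
exact: (IH (a \o succn) (fun s => f ((t + a 0%N)%R :: s))).
Qed.

Lemma iter_int_ge0 n (f : seq R -> \bar R) :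
  (forall s, 0 <= f s) -> 0 <= iter_int n f.
Proof.
by elim: n f => [|n IH] f f0 //=; apply: integral_ge0 => t _; exact: IH.
Qed.

Lemma le_iter_int n (f g : seq R -> \bar R) : (forall s, 0 <= f s) ->
  (forall s, size s = n -> f s <= g s) -> iter_int n f <= iter_int n g.
Proof.
elim: n f g => [|n IH] f g f0 fg /=; first exact: fg.
apply: ge0_le_integralT => t; first exact: iter_int_ge0.
by apply: IH => // s sn; apply: fg; rewrite /= sn.
Qed.

(** Cubes are the sets whose volume is computed: one inside and one around the unit ball show that
    its volume is positive and finite. *)
Lemma iter_int_box n (c : R) : (0 <= c)%R ->
  iter_int n (fun s => (all (fun t => `|t| < c)%R s)%:R%:E) = ((c *+ 2) ^+ n)%:E.
Proof.
move=> c0; elim: n => [|n IH] //=.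
transitivity (\int[leb]_(t in ball (0 : R)%R c) ((c *+ 2) ^+ n)%:E).
  rewrite [RHS]integral_mkcond; apply: eq_integral => t _.
  rewrite patchE; case: ifPn; rewrite ?inE ?notin_setE /ball/= sub0r normrN => tb.
    by rewrite -IH; apply: eq_iter_int => s _; rewrite tb.
  transitivity (iter_int n (cst 0 : seq R -> \bar R)).
    by apply: eq_iter_int => s _ /=; move/negP/negbTE : tb => ->.
  by elim: n {IH} => [|n IH] //=; under eq_integral do rewrite IH; rewrite integral0.
rewrite integral_cst//; last exact: measurable_ball.
transitivity (((c *+ 2) ^+ n)%:E * (c *+ 2)%:E); last by rewrite -EFinM exprSr.
by congr (_ * _); exact: lebesgue_measure_ball.
Qed.

End IteratedIntegral.

Section Volume.
Context {R : realType} {N : nat}.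
Local Notation V := 'rV[R]_N.

Lemma volN_shift (A : set V) (v : V) : volN [set x | A (x + v)] = volN A.
Proof.
pose a (i : nat) : R := if insub i is Some j then v ord0 j else 0.
rewrite -[RHS](iter_int_shift N a); apply: eq_iter_int => s sN /=.
congr (EFin _); rewrite /indic; congr ((nat_of_bool _)%:R).
have -> : \row_(i < N) nth 0 (shift_seq a s) i = \row_(i < N) nth 0 s i + v.
  apply/rowP => i; rewrite !mxE nth_shift_seq ?sN//; congr (_ + _).
  by rewrite /a insubT //= => iN; congr (v _ _); apply/val_inj.
by apply/idP/idP; rewrite !inE.
Qed.

Lemma volN_ball_gt0 (r : R) : 0 < r -> (0 < volN [set v : V | (enorm v < r)%R])%E.
Proof.
move=> r0; pose c : R := r / N.+1%:R.
have c0 : 0 < c by rewrite divr_gt0.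
have h2 : (((c *+ 2) ^+ N)%:E <= volN [set v : V | (enorm v < r)%R])%E.
  rewrite -(iter_int_box N (ltW c0)); apply: le_iter_int => s.
    by rewrite lee_fin.
  move=> sN; rewrite lee_fin indicE ler_nat.
  have [/allP sc|_] := boolP (all (fun t => `|t| < c) s); last by [].
  rewrite lt0b inE /=; apply: le_lt_trans (enorm_le_norm _) _.
  apply: (@le_lt_trans _ _ (N%:R * c)); last first.
    by rewrite /c mulrA ltr_pdivrMr// mulrC ltr_pM2l// ltr_nat.
  rewrite ler_wpM2l// [leLHS]/Num.norm /= mx_normrE; apply/bigmax_leP; split=> [|[i j] _ /=].
    exact: ltW.
  by rewrite mxE; apply/ltW/sc/mem_nth; rewrite sN.
by apply: lt_le_trans h2; rewrite lte_fin exprn_gt0// pmulrn_lgt0.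
Qed.

Lemma volN_unit_ball : exists2 r : R, 0 < r & volN (@unit_ball R N) = r%:E.
Proof.
have h1 : (volN (@unit_ball R N) <= ((1 *+ 2) ^+ N)%:E)%E.
  rewrite -(iter_int_box N (@ler01 R)); apply: le_iter_int => s.
    by rewrite lee_fin.
  move=> sN; rewrite lee_fin indicE ler_nat.
  have [|_] := boolP (_ \in _); last by [].
  rewrite inE /unit_ball/= => sB; rewrite lt0b; apply/(all_nthP 0) => i; rewrite sN => iN.
  have := coord_le (\row_(i < N) nth 0 s i) (Ordinal iN).
  by rewrite mxE => /le_lt_trans; exact.
have h3 := volN_ball_gt0 (@ltr01 R).
have h4 : volN (@unit_ball R N) \is a fin_num.
  by rewrite ge0_fin_numE ?(ltW h3)// (le_lt_trans h1)// ltry.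
exists (fine (volN (@unit_ball R N))); last by rewrite fineK.
by apply: fine_gt0; rewrite h3 -ge0_fin_numE// ltW.
Qed.

End Volume.

(** * Expectations and the uniform law on the ball *)

Section BoundedMeasurable.
Context d {T : measurableType d} {R : realType}.
Implicit Types f g : T -> R.

Definition bmeas f :=
  measurable_fun setT f /\ exists M : R, forall x, `|f x| <= M.

Lemma bmeas_cst (c : R) : bmeas (fun=> c).
Proof. by split; [exact: measurable_cst|exists `|c|]. Qed.

Lemma bmeasD f g : bmeas f -> bmeas g -> bmeas (fun x => f x + g x).
Proof.
move=> [mf [M Mf]] [mg [M' Mg]]; split; first exact: measurable_funD.
by exists (M + M') => x; rewrite (le_trans (ler_normD _ _))// lerD.
Qed.

Lemma bmeasM f g : bmeas f -> bmeas g -> bmeas (fun x => f x * g x).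
Proof.
move=> [mf [M Mf]] [mg [M' Mg]]; split; first exact: measurable_funM.
by exists (M * M') => x; rewrite normrM ler_pM.
Qed.

Lemma bmeasZ (c : R) f : bmeas f -> bmeas (fun x => c * f x).
Proof. by apply: bmeasM; exact: bmeas_cst. Qed.

Lemma bmeasB f g : bmeas f -> bmeas g -> bmeas (fun x => f x - g x).
Proof.
move=> bf bg; have := bmeasD bf (bmeasZ (-1) bg).
by under eq_fun do rewrite mulN1r.
Qed.

Lemma bmeas_sum (I : Type) (r : seq I) (F : I -> T -> R) :
  (forall i, bmeas (F i)) -> bmeas (fun x => \sum_(i <- r) F i x).
Proof.
move=> bF; elim: r => [|i r IH].
  by under eq_fun do rewrite big_nil; exact: bmeas_cst.
by under eq_fun do rewrite big_cons; exact: bmeasD.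
Qed.

Lemma bmeas_indic (A : set T) : measurable A -> bmeas (\1_A : T -> R).
Proof.
move=> mA; split; first exact: measurable_indic.
by exists 1 => x; rewrite indicE; case: (x \in A); rewrite ?normr1 ?normr0.
Qed.

End BoundedMeasurable.

Lemma bmeas_comp d d' (T : measurableType d) (T' : measurableType d') (R : realType)
    (f : T -> R) (p : T' -> T) :
  bmeas f -> measurable_fun setT p ->
  bmeas (f \o p).
Proof.
move=> [mf [M Mf]] mp; split; first exact: measurableT_comp.
by exists M => x /=.
Qed.

Section Expectation.
Context d {T : measurableType d} {R : realType} (P : probability T R).
Implicit Types f g : T -> R.

Definition Ex f : R := \int[P]_x f x.

Lemma bmeas_integrable f : bmeas f -> P.-integrable setT (EFin \o f).
Proof.
move=> [mf [M Mf]]; apply: measurable_bounded_integrable => //.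
  exact: fin_num_fun_lty.
exists M; split; first exact: num_real.
by move=> x Mx y _; exact: le_trans (Mf y) (ltW Mx).
Qed.

Lemma EFin_Ex f : bmeas f -> (Ex f)%:E = (\int[P]_x (f x)%:E)%E.
Proof.
move=> bf; rewrite /Ex /Rintegral fineK//.
by apply: integrable_fin_num => //; exact: bmeas_integrable.
Qed.

Lemma eq_Ex f g : f =1 g -> Ex f = Ex g.
Proof. by move=> fg; apply: eq_Rintegral => x _. Qed.

Lemma ExD f g : bmeas f -> bmeas g -> Ex (fun x => f x + g x) = Ex f + Ex g.
Proof. by move=> *; rewrite /Ex RintegralD//; exact: bmeas_integrable. Qed.

Lemma ExB f g : bmeas f -> bmeas g -> Ex (fun x => f x - g x) = Ex f - Ex g.
Proof. by move=> *; rewrite /Ex RintegralB//; exact: bmeas_integrable. Qed.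

Lemma ExZ (c : R) f : bmeas f -> Ex (fun x => c * f x) = c * Ex f.
Proof. by move=> *; rewrite /Ex RintegralZl//; exact: bmeas_integrable. Qed.

Lemma Ex_cst (c : R) : Ex (fun=> c) = c.
Proof.
transitivity (c * fine (P [set: T])); first exact: Rintegral_cst.
by rewrite probability_setT mulr1.
Qed.

Lemma le_Ex f g : bmeas f -> bmeas g -> (forall x, f x <= g x) -> Ex f <= Ex g.
Proof. by move=> bf bg fg; apply: le_Rintegral => //; exact: bmeas_integrable. Qed.

Lemma norm_Ex_le f (M : R) : bmeas f -> (forall x, `|f x| <= M) -> `|Ex f| <= M.
Proof.
move=> bf fM; rewrite ler_norml -[in - M](Ex_cst M) -{2}(Ex_cst M).
rewrite -mulN1r -ExZ; last exact: bmeas_cst.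
by apply/andP; split; apply: le_Ex => //; try exact: bmeas_cst;
  move=> x; have := fM x; rewrite ler_norml => /andP[]; rewrite ?mulN1r.
Qed.

Lemma Ex_sum (I : Type) (r : seq I) (F : I -> T -> R) :
  (forall i, bmeas (F i)) ->
  Ex (fun x => \sum_(i <- r) F i x) = \sum_(i <- r) Ex (F i).
Proof.
move=> bF; elim: r => [|i r IH].
  by under eq_Ex do rewrite big_nil; rewrite Ex_cst big_nil.
under eq_Ex do rewrite big_cons.
by rewrite ExD ?big_cons ?IH//; exact: bmeas_sum.
Qed.

Lemma Ex_indic (A : set T) : measurable A -> Ex (\1_A) = fine (P A).
Proof. by move=> mA; rewrite /Ex /Rintegral integral_indic// setIT. Qed.

Lemma Ex_dominated (f_ : nat -> T -> R) f (M : R) :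
  (forall n, measurable_fun setT (f_ n)) -> measurable_fun setT f ->
  (forall n x, `|f_ n x| <= M) -> (forall x, f_ ^~ x @ \oo --> f x) ->
  (fun n => Ex (f_ n)) @ \oo --> Ex f.
Proof.
move=> mf_ mf f_M f_f.
have bf_ n : bmeas (f_ n) by split => //; exists M.
have bf : bmeas f.
  split => //; exists M => x.
  have h : (fun n => `|f_ n x|) @ \oo --> `|f x| by apply: cvg_norm; exact: f_f.
  by apply: (cvgr_to_le h); exact: nearW.
have iM : P.-integrable setT (EFin \o cst M).
  by apply: bmeas_integrable; exact: bmeas_cst.
have [||||_ _] := @dominated_convergence _ _ _ P setT measurableT
  (fun n => EFin \o f_ n) (EFin \o f) (EFin \o cst M) _ _ _ iM.
- by move=> n; exact/measurable_EFinP.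
- exact/measurable_EFinP.
- by apply: aeW => x _; apply/cvg_EFin; [exact: nearW|exact: f_f].
- by apply: aeW => x n _; rewrite lee_fin.
by rewrite -(EFin_Ex bf) => /fine_cvg.
Qed.

End Expectation.

Section Fubini.
Context d1 d2 {T1 : measurableType d1} {T2 : measurableType d2} {R : realType}.
Context (P1 : probability T1 R) (P2 : probability T2 R).
Variables (f : T1 * T2 -> R) (bf : bmeas f).

Let intf : (P1 \x P2)%E.-integrable setT (EFin \o f).
Proof.
have [mf [M Mf]] := bf; apply: measurable_bounded_integrable => //.
  rewrite -setXTT [ltLHS](product_measure1E P1 P2)// [X in (X * _)%E]probability_setT mul1e.
  by rewrite [X in (X < _)%E]probability_setT ltry.
exists M; split; first exact: num_real.
by move=> x Mx y _; exact: le_trans (Mf y) (ltW Mx).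
Qed.

Lemma bmeas_pair1 x : bmeas (fun y => f (x, y)).
Proof.
have [mf [M Mf]] := bf; split; last by exists M.
exact: measurable_fun_pair2.
Qed.

Lemma bmeas_pair2 y : bmeas (fun x => f (x, y)).
Proof.
have [mf [M Mf]] := bf; split; last by exists M.
exact: measurable_fun_pair1.
Qed.

Lemma bmeas_Ex1 : bmeas (fun x => Ex P2 (fun y => f (x, y))).
Proof.
split; last first.
  have [_ [M Mf]] := bf; exists M => x; apply: norm_Ex_le => //.
  exact: bmeas_pair1.
apply/measurable_EFinP.
rewrite (_ : _ \o _ = fubini_F P2 (EFin \o f)); first exact: measurable_fubini_F intf.
by apply/funext => x /=; rewrite EFin_Ex//; exact: bmeas_pair1.
Qed.

Lemma bmeas_Ex2 : bmeas (fun y => Ex P1 (fun x => f (x, y))).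
Proof.
split; last first.
  have [_ [M Mf]] := bf; exists M => x; apply: norm_Ex_le => //.
  exact: bmeas_pair2.
apply/measurable_EFinP.
rewrite (_ : _ \o _ = fubini_G P1 (EFin \o f)); first exact: measurable_fubini_G intf.
by apply/funext => y /=; rewrite EFin_Ex//; exact: bmeas_pair2.
Qed.

Lemma Ex_prod :
  (Ex P1 (fun x => Ex P2 (fun y => f (x, y))))%:E = (\int[P1 \x P2]_z (f z)%:E)%E.
Proof.
rewrite EFin_Ex; last exact: bmeas_Ex1.
rewrite -(integral12_prod_meas1 intf); apply: eq_integral => x _.
by rewrite EFin_Ex//; exact: bmeas_pair1.
Qed.

Lemma Ex_fubini :
  Ex P1 (fun x => Ex P2 (fun y => f (x, y))) =
  Ex P2 (fun y => Ex P1 (fun x => f (x, y))).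
Proof.
apply: EFin_inj; rewrite Ex_prod EFin_Ex; last exact: bmeas_Ex2.
rewrite -(integral21_prod_meas1 intf); apply: eq_integral => y _.
by rewrite EFin_Ex//; exact: bmeas_pair2.
Qed.

End Fubini.

Definition unif_law {R : realType} {N : nat} (mu : probability (borelV R N) R) :=
  forall A : set 'rV[R]_N, open A ->
    (mu A * volN (@unit_ball R N) = volN (A `&` @unit_ball R N))%E.

Section UniformLaw.
Context {R : realType} {N : nat} (mu : probability (borelV R N) R).
Hypothesis mu_unif : unif_law mu.
Local Notation V := 'rV[R]_N.
Local Notation bV := (borelV R N).

Lemma open_unit_ball : open (@unit_ball R N).
Proof.
have := @open_eball R N 0 1; congr open; apply/seteqP.
by split=> x; rewrite /unit_ball /= subr0.
Qed.

Lemma measurable_unit_ball : measurable (@unit_ball R N : set bV).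
Proof. exact: open_measurableV open_unit_ball. Qed.

Lemma unif_law_sub (A : set V) : open A -> A `<=` @unit_ball R N ->
  (mu A * volN (@unit_ball R N) = volN A)%E.
Proof. by move=> oA AB; rewrite mu_unif// (setIidl AB). Qed.

Lemma unif_law_eq (A B : set V) : open A -> open B ->
  A `<=` @unit_ball R N -> B `<=` @unit_ball R N -> volN A = volN B ->
  mu A = mu B.
Proof.
move=> oA oB AU BU AB; have := unif_law_sub oA AU.
rewrite AB -(unif_law_sub oB BU); have [r r0 ->] := @volN_unit_ball R N.
move=> h; have : (mu A * r%:E * (r^-1)%:E = mu B * r%:E * (r^-1)%:E)%E by rewrite h.
by rewrite -!muleA -!EFinM divff ?gt_eqF// !mule1.
Qed.

Lemma unif_law_ball : mu (@unit_ball R N) = 1%E.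
Proof.
have := unif_law_sub open_unit_ball (@subset_refl _ _).
have [r r0 ->] := @volN_unit_ball R N.
move=> h; have : (mu (@unit_ball R N) * r%:E * (r^-1)%:E = r%:E * (r^-1)%:E)%E by rewrite h.
by rewrite -!muleA -!EFinM divff ?gt_eqF// !mule1.
Qed.

Lemma open_preimage_add (A : set V) (t : V) : open A -> open [set y | A (y + t)].
Proof.
move=> oA; rewrite (_ : mkset _ = (fun y => y + t) @^-1` A)//.
apply: open_comp => // y _; apply: (@lipschitz_continuous _ _ _ _ 1) => a b.
by rewrite mul1r opprD addrACA subrr addr0 norm_le_enorm.
Qed.

Lemma measurable_add_cst (t : V) : measurable_fun setT ((fun y => y + t) : bV -> bV).
Proof.
apply: measurable_addV; first exact: measurable_id.
exact: (@measurable_cst _ _ bV bV setT t).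
Qed.

(** Invariance of [volN] gives the claim on open sets, which form a pi-system, and measure
    uniqueness extends it to Borel sets. Both measures are first restricted, to [C] (the points that
    the translation by [- t] keeps in the ball) and to its translate, so that every set compared
    lies in the unit ball. *)
Lemma unif_law_shift (A : set V) (t : V) : measurable (A : set bV) ->
  A `<=` @unit_ball R N -> [set y | A (y + t)] `<=` @unit_ball R N ->
  mu [set y | A (y + t)] = mu A.
Proof.
pose C := @unit_ball R N `&` [set y | @unit_ball R N (y - t)].
move=> mA AU AtU.
have oC : open C.
  by apply: openI; [exact: open_unit_ball|exact: open_preimage_add open_unit_ball].
pose C' := [set y | C (y + t)].
have oC' : open C' by exact: open_preimage_add.
have mC : measurable (C : set bV) by exact: open_measurableV.
have mC' : measurable (C' : set bV) by exact: open_measurableV.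
have CU : C `<=` @unit_ball R N by move=> y [].
have C'U : C' `<=` @unit_ball R N by move=> y [_] /=; rewrite addrK.
have AC : A `<=` C.
  move=> y Ay; split; first exact: AU.
  by rewrite /=; apply: AtU; rewrite /= subrK.
have key : mrestr mu mC A = pushforward (mrestr mu mC') ((fun y => y + t) : bV -> bV) A.
  apply: (@measure_unique _ R bV (@open V) (fun=> setT)) => //.
  - exact: open_setI_closed.
  - by move=> _; exact: openT.
  - by rewrite bigcup_const//; exists 0%N.
  - exact: measurable_add_cst.
  - move=> mt B oB; rewrite /pushforward /mrestr; apply: unif_law_eq.
    + exact: openI.
    + by apply: openI => //; exact: open_preimage_add.
    + by move=> y [_ /CU].
    + by move=> y [_ /C'U].
    + by rewrite -(volN_shift _ t).
  - by move=> _; apply: (le_lt_trans (probability_le1 _ _)); rewrite ?ltry//; exact: measurableI.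
move: key; rewrite /pushforward /mrestr (setIidl AC) => ->.
by congr (mu _); apply/seteqP; split=> [y Ay|y []//]; split => //; exact: AC.
Qed.

(** The support condition makes the translation legitimate: [mu] is invariant only as long as no
    mass leaves the unit ball. *)
Lemma Ex_shift (t : V) (h : V -> R) : bmeas (h : bV -> R) ->
  (forall y, h y != 0 -> enorm y < 1 /\ enorm (y - t) < 1) ->
  Ex mu (fun y : bV => h (y + t)) = Ex mu (h : bV -> R).
Proof.
pose C := @unit_ball R N `&` [set y | @unit_ball R N (y - t)].
move=> bh hC.
have oC : open C.
  by apply: openI; [exact: open_unit_ball|exact: open_preimage_add open_unit_ball].
have mC : measurable (C : set bV) by exact: open_measurableV.
have hout y : ~ C y -> h y = 0.
  by move=> nC; apply/eqP; apply: contra_notT nC => /hC [].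
have mt := measurable_add_cst t.
have bht : bmeas (fun y : bV => h (y + t)) by exact: (bmeas_comp bh mt).
apply: EFin_inj; rewrite !EFin_Ex//.
transitivity (\int[mu]_(y in [set y | C (y + t)%R]) (h (y + t)%R)%:E)%E.
  rewrite [RHS]integral_mkcond; apply: eq_integral => y _; rewrite patchE.
  by case: ifPn => //; rewrite notin_setE /= => /hout ->.
transitivity (\int[mu]_(y in C) (h y)%:E)%E; last first.
  rewrite [LHS]integral_mkcond; apply: eq_integral => y _; rewrite patchE.
  by case: ifPn => //; rewrite notin_setE /= => /hout ->.
rewrite -[LHS](@integral_pushforward _ _ _ _ R ((fun y => y + t) : bV -> bV) mt mu C (EFin \o h)) //.
- apply: eq_measure_integral => A mA AC; rewrite /pushforward; apply: unif_law_shift => //.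
    by move=> y /AC [].
  by move=> y /= /AC [_ /=]; rewrite addrK.
- by apply/measurable_EFinP; case: bh.
- apply: (integrableS measurableT) => //; last exact: (bmeas_integrable _ bht).
  by rewrite -[X in measurable X]setTI; exact: mt.
Qed.

Lemma unif_law_small_ball (r : R) : 0 < r ->
  (0 < mu [set v : V | (enorm v < r)%R])%E.
Proof.
move=> r0; pose r' := Num.min r 1.
have r'0 : 0 < r' by rewrite lt_min r0 ltr01.
have oB (e : R) : open [set v : V | enorm v < e].
  have := @open_eball R N 0 e; congr open; apply/seteqP.
  by split=> x; rewrite /= subr0.
apply: (@lt_le_trans _ _ (mu [set v : V | enorm v < r'])); last first.
  apply: le_measure; rewrite ?inE; [exact: open_measurableV|exact: open_measurableV|].
  by move=> v /=; rewrite lt_min => /andP[].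
rewrite lt0e measure_ge0 andbT; apply/eqP => m0.
have := unif_law_sub (oB r'); rewrite m0 mul0e => h.
have := @volN_ball_gt0 R N r' r'0; rewrite -h ?ltxx// => v /=.
by rewrite /unit_ball /= lt_min => /andP[].
Qed.

End UniformLaw.

(** * Radial profiles and second moments *)

Section PositivePartPowers.
Context {R : realType}.
Implicit Types (s h K : R) (k : nat).

(** [pp k.+1] is of class C^k and its derivative is [k.+1] times [pp k] wherever it exists. At
    exponent 0 this is the constant 1 and not an indicator, so vanishing on negative arguments
    starts at exponent 1. *)
Definition pp k s : R := Num.max s 0 ^+ k.

Lemma pp_ge0 k s : 0 <= pp k s.
Proof. by rewrite exprn_ge0// le_max lexx orbT. Qed.

Lemma pp_pos k s : 0 <= s -> pp k s = s ^+ k.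
Proof. by move=> s0; rewrite /pp max_l. Qed.

Lemma pp_neg k s : s <= 0 -> pp k.+1 s = 0.
Proof. by move=> s0; rewrite /pp max_r// expr0n. Qed.

Lemma pp_le k s K : 0 <= K -> s <= K -> pp k s <= K ^+ k.
Proof.
by move=> K0 sK; rewrite lerXn2r ?nnegrE// ?le_max ?lexx ?orbT// ge_max sK.
Qed.

Lemma ppS k s : s * pp k.+1 s = pp k.+2 s.
Proof.
have [s0|s0] := leP 0 s; first by rewrite !pp_pos// [RHS]exprS.
by rewrite !pp_neg ?mulr0// ltW.
Qed.

Lemma pp_norm k s K : 0 <= K -> s <= K -> `|pp k s| <= K ^+ k.
Proof. by move=> K0 sK; rewrite ger0_norm ?pp_ge0// pp_le. Qed.

Lemma pp1_lipschitz s h : `|pp 1 (s + h) - pp 1 s| <= `|h|.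
Proof.
have [s0|/ltW s0] := leP 0 s; have [s1|/ltW s1] := leP 0 (s + h);
  rewrite ?(pp_pos _ s0) ?(pp_neg _ s0) ?(pp_pos _ s1) ?(pp_neg _ s1) ?expr1.
- by rewrite addrAC subrr add0r.
- by rewrite sub0r normrN ger0_norm// ler_normr; apply/orP; right; lra.
- by rewrite subr0 ger0_norm// ler_normr; apply/orP; left; lra.
- by rewrite subr0 normr0.
Qed.

Lemma pp_taylor1_2 s h :
  `|pp 2 (s + h) - pp 2 s - 2 * h * pp 1 s| <= h ^+ 2.
Proof.
have [s0|/ltW s0] := leP 0 s; have [s1|/ltW s1] := leP 0 (s + h);
  rewrite ?(pp_pos _ s0) ?(pp_neg _ s0) ?(pp_pos _ s1) ?(pp_neg _ s1);
  rewrite ler_norml; apply/andP; split; nra.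
Qed.

(** The second derivative of the cube grows linearly, so the quadratic remainder carries an upper
    bound of the positive parts, [Num.max K 0]. *)
Lemma pp_taylor1_3 s h K : s <= K -> s + h <= K ->
  `|pp 3 (s + h) - pp 3 s - 3 * h * pp 2 s| <= 3 * Num.max K 0 * h ^+ 2.
Proof.
move=> sK shK.
have [K0 KK] : 0 <= Num.max K 0 /\ K <= Num.max K 0 by rewrite !le_max !lexx orbT.
move: (Num.max K 0) K0 KK => K' K0 KK.
have {}sK : s <= K' by apply: le_trans KK.
have {}shK : s + h <= K' by apply: le_trans KK.
have h2 : 0 <= h ^+ 2 by exact: sqr_ge0.
have [s0|/ltW s0] := leP 0 s; have [s1|/ltW s1] := leP 0 (s + h);
  rewrite ?(pp_pos _ s0) ?(pp_neg _ s0) ?(pp_pos _ s1) ?(pp_neg _ s1).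
- have -> : (s + h) ^+ 3 - s ^+ 3 - 3 * h * s ^+ 2 = h ^+ 2 * (s + s + (s + h)) by ring.
  by rewrite ger0_norm; [|apply: mulr_ge0; lra]; rewrite mulrC ler_wpM2r//; lra.
- have hs : s * s <= h ^+ 2 by nra.
  have : s ^+ 2 * K' <= h ^+ 2 * K' by rewrite ler_wpM2r// expr2.
  have -> : 0 - s ^+ 3 - 3 * h * s ^+ 2 = s * (s * (- s - 3 * h)) by ring.
  rewrite ger0_norm; last by do 2 (apply: mulr_ge0; first by []); lra.
  have e1 : s * (- s - 3 * h) <= 3 * h ^+ 2 by nra.
  have e2 : s * (s * (- s - 3 * h)) <= s * (3 * h ^+ 2) by rewrite ler_wpM2l.
  have e3 : s * (3 * h ^+ 2) <= K' * (3 * h ^+ 2) by rewrite ler_wpM2r// mulr_ge0.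
  lra.
- rewrite mulr0 !subr0 ger0_norm ?exprn_ge0//.
  have e1 : (s + h) ^+ 2 <= h ^+ 2 by nra.
  have e2 : (s + h) * (s + h) ^+ 2 <= K' * h ^+ 2.
    by rewrite ler_pM// sqr_ge0.
  have : 0 <= K' * h ^+ 2 by exact: mulr_ge0.
  have -> : (s + h) ^+ 3 = (s + h) * (s + h) ^+ 2 by rewrite exprS.
  lra.
- by rewrite mulr0 !subr0 normr0; have := mulr_ge0 K0 h2; lra.
Qed.

Lemma pp_taylor2_3 s h :
  `|pp 3 (s + h) - pp 3 s - 3 * h * pp 2 s - 3 * h ^+ 2 * pp 1 s| <= `|h| ^+ 3.
Proof.
have n3 : forall x : R, `|x| ^+ 3 = `|x ^+ 3| by move=> x; rewrite normrX.
have [s0|/ltW s0] := leP 0 s; have [s1|/ltW s1] := leP 0 (s + h);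
  rewrite ?(pp_pos _ s0) ?(pp_neg _ s0) ?(pp_pos _ s1) ?(pp_neg _ s1).
- have -> : (s + h) ^+ 3 - s ^+ 3 - 3 * h * s ^+ 2 - 3 * h ^+ 2 * s ^+ 1 = h ^+ 3 by ring.
  by rewrite n3.
- have h0 : h <= 0 by lra.
  rewrite (ler0_norm h0).
  have -> : 0 - s ^+ 3 - 3 * h * s ^+ 2 - 3 * h ^+ 2 * s ^+ 1 = h ^+ 3 + (- s - h) ^+ 3 by ring.
  have e1 : 0 <= (- s - h) ^+ 3 by apply: exprn_ge0; lra.
  have e2 : (- s - h) ^+ 3 <= (- h) ^+ 3 by rewrite lerXn2r ?nnegrE //; lra.
  have e3 : h ^+ 3 = - (- h) ^+ 3 by ring.
  by rewrite ler_norml; apply/andP; split; lra.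
- have h0 : 0 <= h by lra.
  rewrite !mulr0 !subr0 (ger0_norm h0) ger0_norm ?exprn_ge0//.
  by rewrite lerXn2r ?nnegrE //; lra.
- by rewrite !mulr0 !subr0 normr0 exprn_ge0.
Qed.

Lemma pp_taylor2_4 s h K : s <= K -> s + h <= K ->
  `|pp 4 (s + h) - pp 4 s - 4 * h * pp 3 s - 6 * h ^+ 2 * pp 2 s|
    <= 11 * Num.max K 0 * `|h| ^+ 3.
Proof.
move=> sK shK.
have [K0 KK] : 0 <= Num.max K 0 /\ K <= Num.max K 0 by rewrite !le_max !lexx orbT.
move: (Num.max K 0) K0 KK => K' K0 KK.
have {}sK : s <= K' by apply: le_trans KK.
have {}shK : s + h <= K' by apply: le_trans KK.
have h3 : 0 <= `|h| ^+ 3 by exact: exprn_ge0.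
have [s0|/ltW s0] := leP 0 s; have [s1|/ltW s1] := leP 0 (s + h);
  rewrite ?(pp_pos _ s0) ?(pp_neg _ s0) ?(pp_pos _ s1) ?(pp_neg _ s1).
- have -> : (s + h) ^+ 4 - s ^+ 4 - 4 * h * s ^+ 3 - 6 * h ^+ 2 * s ^+ 2 = h ^+ 3 * (s + s + s + (s + h)) by ring.
  rewrite normrM normrX mulrC ler_wpM2r// ger0_norm; lra.
- have h0 : h <= 0 by lra.
  rewrite (ler0_norm h0).
  have -> : 0 - s ^+ 4 - 4 * h * s ^+ 3 - 6 * h ^+ 2 * s ^+ 2
    = s * (s * (- s ^+ 2 - 4 * h * s - 6 * h ^+ 2)) by ring.
  have e0 : 0 <= h ^+ 2 by exact: sqr_ge0.
  (* Here 0 <= s <= - h, so the three terms are at most 1, 4 and 6 times [h ^+ 2]: the origin of the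
     11. *)
  have e1 : `|- s ^+ 2 - 4 * h * s - 6 * h ^+ 2| <= 11 * h ^+ 2.
    by rewrite ler_norml; apply/andP; split; nra.
  rewrite normrM normrM (ger0_norm s0).
  have e2 : s * `|- s ^+ 2 - 4 * h * s - 6 * h ^+ 2| <= (- h) * (11 * h ^+ 2).
    by apply: ler_pM => //; lra.
  have e3 : s * (s * `|- s ^+ 2 - 4 * h * s - 6 * h ^+ 2|) <= K' * ((- h) * (11 * h ^+ 2)).
    by apply: ler_pM => //; rewrite mulr_ge0.
  by apply: le_trans e3 _; rewrite le_eqVlt; apply/orP; left; apply/eqP; ring.
- have h0 : 0 <= h by lra.
  rewrite !mulr0 !subr0 (ger0_norm h0) ger0_norm ?exprn_ge0//.
  have e1 : (s + h) ^+ 3 <= h ^+ 3 by rewrite lerXn2r ?nnegrE //; lra.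
  have e2 : (s + h) * (s + h) ^+ 3 <= K' * h ^+ 3.
    by rewrite ler_pM// exprn_ge0.
  have : 0 <= K' * h ^+ 3 by rewrite mulr_ge0// exprn_ge0.
  have -> : (s + h) ^+ 4 = (s + h) * (s + h) ^+ 3 by rewrite exprS.
  lra.
- by rewrite !mulr0 !subr0 normr0; have := mulr_ge0 K0 h3; lra.
Qed.

End PositivePartPowers.

Ltac nng := do ?[by []|exact: enorm_ge0|exact: dot_ge0|exact: pp_ge0|exact: ler0n
  |apply: exprn_ge0|apply: addr_ge0|apply: mulr_ge0|exact: sqr_ge0].

Section RadialKernels.
Context {R : realType}.
Implicit Types (s h : R).

Lemma pp_taylor1 k (sigma : R) : (k = 1 \/ k = 2)%N -> exists2 C : R, 0 <= C &
  forall s h, s <= sigma -> s + h <= sigma ->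
  `|pp k.+1 (s + h) - pp k.+1 s - k.+1%:R * h * pp k s| <= C * h ^+ 2.
Proof.
move=> [->|->].
  by exists 1 => // s h _ _; rewrite mul1r pp_taylor1_2.
exists (3 * Num.max sigma 0); first by rewrite mulr_ge0// le_max lexx orbT.
by move=> s h; exact: pp_taylor1_3.
Qed.

(** The two cases are the exponents 3 and 4 of the test profiles; the coefficient of
    [h ^+ 2 * pp k s] is half that of the second derivative. *)
Lemma pp_taylor2 k (sigma : R) : (k = 1 \/ k = 2)%N -> exists2 C : R, 0 <= C &
  forall s h, s <= sigma -> s + h <= sigma ->
  `|pp k.+2 (s + h) - pp k.+2 s - k.+2%:R * h * pp k.+1 s
    - (k.+2 * k.+1)%:R / 2 * h ^+ 2 * pp k s| <= C * `|h| ^+ 3.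
Proof.
move=> [->|->].
  exists 1 => // s h _ _; rewrite mul1r.
  by rewrite (_ : (3 * 2)%:R / 2 = 3 :> R) ?pp_taylor2_3// natrM mulfK.
exists (11 * Num.max sigma 0); first by rewrite mulr_ge0// le_max lexx orbT.
move=> s h sl hl; rewrite (_ : (4 * 3)%:R / 2 = 6 :> R); first exact: pp_taylor2_4.
by rewrite natrM; lra.
Qed.

Context {N : nat}.
Local Notation V := 'rV[R]_N.
Implicit Types (a w v y z : V).

Lemma dot_add_sqr a w : dot (a + w) (a + w) = dot a a + (2 * dot a w + dot w w).
Proof. by rewrite dotDl !dotDr (dotC w a); ring. Qed.

Lemma sub_dot_le (sigma : R) a : sigma - dot a a <= sigma.
Proof. by rewrite gerBl dot_ge0. Qed.

Lemma sub_dot_add (sigma : R) a w : sigma - dot (a + w) (a + w) =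
  sigma - dot a a + - (2 * dot a w + dot w w).
Proof. by rewrite dot_add_sqr; ring. Qed.

Lemma norm_increment (B : R) a w : enorm a <= B -> enorm w <= 1 ->
  `|- (2 * dot a w + dot w w)| <= (2 * B + 1) * enorm w.
Proof.
move=> aB w1; rewrite normrN; apply: le_trans (ler_normD _ _) _.
rewrite [leRHS]mulrDl mul1r; apply: lerD.
  rewrite normrM ger0_norm// -mulrA ler_wpM2l// (le_trans (dot_le _ _))//.
  by rewrite ler_wpM2r// enorm_ge0.
by rewrite ger0_norm ?dot_ge0// -enorm_sqr expr2 ler_piMr// enorm_ge0.
Qed.

(** Chain rule: [sigma - dot a a] changes by [- (2 * dot a w + dot w w)] when [a] moves by [w], and
    the part coming from [dot w w] is of second order and joins the remainder. *)
Lemma ker_taylor1 k (sigma B : R) : (k = 1 \/ k = 2)%N -> 0 <= sigma -> 0 <= B ->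
  exists2 C : R, 0 <= C & forall a w, enorm a <= B -> enorm w <= 1 ->
  `|pp k.+1 (sigma - dot (a + w) (a + w)) - pp k.+1 (sigma - dot a a)
    + 2 * k.+1%:R * dot a w * pp k (sigma - dot a a)| <= C * enorm w ^+ 2.
Proof.
move=> k12 s0 B0; have [C C0 hC] := pp_taylor1 sigma k12.
exists (C * (2 * B + 1) ^+ 2 + k.+1%:R * sigma ^+ k).
  by nng.
move=> a w aB w1; rewrite sub_dot_add.
set t := - (2 * dot a w + dot w w); set s := sigma - dot a a.
have -> : pp k.+1 (s + t) - pp k.+1 s + 2 * k.+1%:R * dot a w * pp k s =
   (pp k.+1 (s + t) - pp k.+1 s - k.+1%:R * t * pp k s) - k.+1%:R * pp k s * dot w w.
  by rewrite /t; ring.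
apply: le_trans (ler_normB _ _) _; rewrite [leRHS]mulrDl; apply: lerD.
  apply: le_trans (hC _ _ (sub_dot_le _ _) _) _.
    by rewrite /s /t -sub_dot_add sub_dot_le.
  rewrite -mulrA ler_wpM2l// -exprMn -real_normK ?num_real//.
  by rewrite lerXn2r ?nnegrE// ?norm_increment//; nng.
rewrite -enorm_sqr normrM [`|enorm w ^+ 2|]ger0_norm ?sqr_ge0// ler_wpM2r ?sqr_ge0//.
by rewrite normrM ger0_norm// ler_wpM2l// pp_norm// sub_dot_le.
Qed.

(** Of the squared increment only [4 * dot a w ^+ 2] counts to second order; the mixed term and the
    square of [dot w w] are of orders 3 and 4 and go to the remainder. *)
Lemma ker_taylor2 k (sigma B : R) : (k = 1 \/ k = 2)%N -> 0 <= sigma -> 0 <= B ->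
  exists2 C : R, 0 <= C & forall a w, enorm a <= B -> enorm w <= 1 ->
  `|pp k.+2 (sigma - dot (a + w) (a + w)) - pp k.+2 (sigma - dot a a)
    + k.+2%:R * (2 * dot a w + dot w w) * pp k.+1 (sigma - dot a a)
    - 2 * (k.+2 * k.+1)%:R * dot a w ^+ 2 * pp k (sigma - dot a a)|
  <= C * enorm w ^+ 3.
Proof.
move=> k12 s0 B0; have [C C0 hC] := pp_taylor2 sigma k12.
pose K : R := (k.+2 * k.+1)%:R / 2.
have K0 : 0 <= K by rewrite divr_ge0.
exists (C * (2 * B + 1) ^+ 3 + K * sigma ^+ k * (4 * B + 1)).
  by nng.
move=> a w aB w1; rewrite sub_dot_add.
set t := - (2 * dot a w + dot w w); set s := sigma - dot a a.
have -> : pp k.+2 (s + t) - pp k.+2 s + k.+2%:R * (2 * dot a w + dot w w) * pp k.+1 s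
    - 2 * (k.+2 * k.+1)%:R * dot a w ^+ 2 * pp k s =
   (pp k.+2 (s + t) - pp k.+2 s - k.+2%:R * t * pp k.+1 s - K * t ^+ 2 * pp k s)
    + K * pp k s * (4 * (dot a w * dot w w) + dot w w ^+ 2).
  by rewrite /t /K; field.
apply: le_trans (ler_normD _ _) _; rewrite [leRHS]mulrDl; apply: lerD.
  apply: le_trans (hC _ _ (sub_dot_le _ _) _) _.
    by rewrite /s /t -sub_dot_add sub_dot_le.
  rewrite -mulrA ler_wpM2l// -exprMn.
  by rewrite lerXn2r ?nnegrE// ?norm_increment//; nng.
have w0 := enorm_ge0 w.
rewrite normrM -mulrA; apply: ler_pM => //.
  by rewrite normrM ger0_norm// ler_wpM2l// pp_norm// sub_dot_le.
apply: le_trans (ler_normD _ _) _; rewrite [leRHS]mulrDl; apply: lerD.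
  rewrite normrM ger0_norm// -mulrA ler_wpM2l// normrM exprS mulrA.
  apply: ler_pM => //; last by rewrite -enorm_sqr ger0_norm ?sqr_ge0.
  by rewrite (le_trans (dot_le _ _))// ler_wpM2r.
rewrite mul1r -enorm_sqr -exprM ger0_norm ?exprn_ge0//.
by rewrite (_ : (2 * 2)%N = 4%N)// [leLHS]exprS ler_piMl// exprn_ge0.
Qed.

Lemma continuous_dotB z : continuous (fun y => dot (y - z) (y - z)).
Proof.
have -> : (fun y => dot (y - z) (y - z)) = (fun y => enorm (y - z) ^+ 2).
  by apply/funext => y; rewrite enorm_sqr.
move=> y; apply: (@continuous_comp _ _ _ (fun y => enorm (y - z)) (fun t : R => t ^+ 2)).
  exact: continuous_enormB.
exact: exprn_continuous.
Qed.

Lemma continuous_pp_dot k (sigma : R) z :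
  continuous (fun y => pp k (sigma - dot (y - z) (y - z))).
Proof.
move=> y; rewrite /pp; apply: (@continuous_comp _ _ _
  (fun y => Num.max (sigma - dot (y - z) (y - z)) 0) (fun t : R => t ^+ k)).
  apply: continuous_max; last exact: cst_continuous.
  apply: continuousB; first exact: cst_continuous.
  exact: continuous_dotB.
exact: exprn_continuous.
Qed.

Lemma measurable_pp_dot k (sigma : R) z d (T : measurableType d) (X : T -> V) :
  measurable_fun setT (X : T -> borelV R N) ->
  measurable_fun setT (fun t => pp k (sigma - dot (X t - z) (X t - z))).
Proof.
move=> mX; have mk := continuous_measurableV (@continuous_pp_dot k sigma z).
exact: (measurableT_comp mk mX).
Qed.

End RadialKernels.

Section Moments.
Context {R : realType} {N : nat} (mu : probability (borelV R N) R).
Hypothesis mu_unif : unif_law mu.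
Local Notation V := 'rV[R]_N.
Local Notation bV := (borelV R N).
Implicit Types (v : V) (i j : 'I_N).

(* [mu] charges only the unit ball, so integrands may be composed with [clip] at
   no cost; this makes the coordinates and all Taylor remainders bounded. *)
Definition clip v : V := if enorm v < 1 then v else 0.

Lemma clip_lt1 v : enorm (clip v) < 1.
Proof. by rewrite /clip; case: ifP => //; rewrite enorm0. Qed.

Lemma measurable_clip : measurable_fun setT (clip : bV -> bV).
Proof.
apply: measurable_fun_ifT.
- apply: measurable_fun_ltr; last exact: measurable_cst.
  exact: continuous_measurableV (@continuous_enorm R N).
- exact: measurable_id.
- exact: (@measurable_cst _ _ bV bV setT 0).
Qed.

Lemma Ex_clip (f : V -> R) :
  Ex mu (fun v => f (clip v)) = Ex mu (f : bV -> R).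
Proof.
rewrite /Ex /Rintegral; congr fine.
have mB := measurable_unit_ball (R := R) (N := N).
have B0 : mu (~` @unit_ball R N) = 0%E.
  by rewrite probability_setC// (unif_law_ball mu_unif) subee.
apply: (@eq_integral_off_null _ bV R mu (~` @unit_ball R N)).
- exact: measurableC.
- exact: B0.
- by move=> v /contrapT; rewrite /clip /unit_ball /= => ->.
Qed.

Lemma bmeas_clip (f : V -> R) (M : R) : measurable_fun setT (f : bV -> R) ->
  (forall v, enorm v < 1 -> `|f v| <= M) -> bmeas (fun v : bV => f (clip v)).
Proof.
move=> mf fM; split; first exact: (measurableT_comp mf measurable_clip).
by exists M => v; apply: fM; exact: clip_lt1.
Qed.

Lemma bmeas_clip_coord i : bmeas (fun v : bV => clip v ord0 i).
Proof.
apply: (@bmeas_clip (fun v => v ord0 i) 1); first exact: measurable_coord.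
by move=> v v1; rewrite (le_trans (coord_le _ _))// ltW.
Qed.

Lemma enorm_evec j : enorm (evec R j) = 1.
Proof.
rewrite enormE /dot (bigD1 j)//= !mxE !eqxx mulr1 big1 ?addr0 ?sqrtr1// => i ij.
by rewrite !mxE (negbTE ij) andbF mulr0.
Qed.

Lemma dot_evec v j : dot v (evec R j) = v ord0 j.
Proof.
rewrite /dot (bigD1 j)//= !mxE !eqxx mulr1 big1 ?addr0// => i ij.
by rewrite !mxE (negbTE ij) andbF mulr0.
Qed.

(** This is how small parameters are removed below: a fixed number that is bounded by a multiple of
    every small step vanishes. *)
Lemma le_linear_eq0 (x C r : R) : 0 < r ->
  (forall t, 0 < t < r -> `|x| <= C * t) -> x = 0.
Proof.
move=> r0 h; apply/eqP; rewrite -normr_le0; apply/ler_addgt0Pr => e e0; rewrite add0r.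
pose K := `|C| + 1; have K0 : 0 < K by rewrite ltr_pwDr.
pose t := Num.min (r / 2) (e / K).
have t0 : 0 < t by rewrite lt_min !divr_gt0.
apply: (le_trans (h t _)).
  by rewrite t0 gt_min; apply/orP; left; lra.
apply: (@le_trans _ _ (K * t)).
  by rewrite ler_wpM2r ?(ltW t0)// /K (le_trans (ler_norm C))// lerDl.
by rewrite mulrC -ler_pdivlMr// ge_min lexx orbT.
Qed.

(* The integral of a derivative of a function supported inside the ball
   vanishes: differentiate the translation invariance. *)
Lemma Ex_divergence (psi dpsi : V -> R) (e : V) (rho C : R) : rho < 1 ->
  bmeas (psi : bV -> R) -> bmeas (dpsi : bV -> R) -> enorm e = 1 ->
  (forall v, psi v != 0 -> enorm v <= rho) ->
  (forall v t, enorm v < 1 -> `|t| <= 1 ->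
    `|psi (v + t *: e) - psi v - t * dpsi v| <= C * t ^+ 2) ->
  Ex mu (dpsi : bV -> R) = 0.
Proof.
move=> rho1 bpsi bdpsi e1 supp hC.
apply: (@le_linear_eq0 _ C (Num.min 1 (1 - rho))).
  by rewrite lt_min ltr01 subr_gt0.
move=> t /andP[t0]; rewrite lt_min => /andP[t1 tr].
have btpsi : bmeas (fun v : bV => psi (v + t *: e)).
  exact: (bmeas_comp bpsi (measurable_add_cst _)).
have te : enorm (t *: e) = t by rewrite enormZ e1 mulr1 gtr0_norm.
have shift : Ex mu (fun v : bV => psi (v + t *: e)) = Ex mu (psi : bV -> R).
  apply: Ex_shift => // y /supp yr; split; first exact: le_lt_trans yr _.
  apply: (le_lt_trans (enormD _ _)); rewrite enormN te.
  by apply: (@le_lt_trans _ _ (rho + t)); [rewrite lerD2r|lra].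
have bd : bmeas (fun v : bV => psi (v + t *: e) - psi v - t * dpsi v).
  by apply: bmeasB; [exact: bmeasB|exact: bmeasZ].
have : `|Ex mu (fun v : bV => psi (v + t *: e) - psi v - t * dpsi v)| <= C * t ^+ 2.
  rewrite -Ex_clip; apply: norm_Ex_le.
    exact: (bmeas_comp bd measurable_clip).
  by move=> v; apply: hC; [exact: clip_lt1|rewrite gtr0_norm// ltW].
rewrite ExB; [|exact: bmeasB|exact: bmeasZ].
rewrite ExB// ExZ// shift subrr sub0r normrN normrM gtr0_norm// expr2 mulrA.
by rewrite [leRHS]mulrC ler_pM2l.
Qed.

Section FixedLevel.
Variables (sigma : R).
Hypotheses (s0 : 0 < sigma) (s1 : sigma < 1).
Let q v := sigma - dot v v.

Let qle v : q v <= 1.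
Proof. by rewrite (le_trans (sub_dot_le _ _))// ltW. Qed.

Let q_supp k v : pp k.+1 (q v) != 0 -> enorm v <= Num.sqrt sigma.
Proof.
have [q0|q0] := leP (q v) 0; first by rewrite pp_neg ?eqxx.
by move=> _; rewrite enormE ler_sqrt ?ltW// -subr_gt0.
Qed.

Let rho1 : Num.sqrt sigma < 1.
Proof. by rewrite -sqrtr1 ltr_sqrt. Qed.

Let mq k : measurable_fun setT (fun v : bV => pp k (q v)).
Proof.
have := @measurable_pp_dot R N k sigma 0 _ bV id (@measurable_id _ bV setT).
by under eq_fun do rewrite subr0.
Qed.

Let bq k : bmeas (fun v : bV => pp k (q v)).
Proof.
split; first exact: mq.
by exists 1 => v; have := pp_norm k (@ler01 R) (qle v); rewrite expr1n.
Qed.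

Let bqi k i : bmeas (fun v : bV => v ord0 i * pp k.+1 (q v)).
Proof.
split; first by apply: measurable_funM; [exact: measurable_coord|exact: mq].
exists 1 => v; have [->|/q_supp h] := eqVneq (pp k.+1 (q v)) 0.
  by rewrite mulr0 normr0.
rewrite normrM mulr_ile1//; first by rewrite (le_trans (coord_le _ _))// (le_trans h)// ltW.
by have := pp_norm k.+1 (@ler01 R) (qle v); rewrite expr1n.
Qed.

Let bqij k i j : bmeas (fun v : bV => v ord0 i * v ord0 j * pp k.+1 (q v)).
Proof.
split.
  by apply: measurable_funM; [apply: measurable_funM; exact: measurable_coord|exact: mq].
exists 1 => v; have [->|/q_supp h] := eqVneq (pp k.+1 (q v)) 0.
  by rewrite mulr0 normr0.
have vi l : `|v ord0 l| <= 1 by rewrite (le_trans (coord_le _ _))// (le_trans h)// ltW.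
rewrite normrM mulr_ile1//; first by rewrite normrM mulr_ile1.
by have := pp_norm k.+1 (@ler01 R) (qle v); rewrite expr1n.
Qed.

Let taylor j : exists2 C : R, 0 <= C & forall v t, enorm v < 1 -> `|t| <= 1 ->
  `|pp 2 (q (v + t *: evec R j)) - pp 2 (q v) + 4 * t * v ord0 j * pp 1 (q v)|
    <= C * t ^+ 2.
Proof.
have [C C0 hC] := @ker_taylor1 R N 1 sigma 1 (or_introl erefl) (ltW s0) (@ler01 R).
exists C => // v t v1 t1.
have te : enorm (t *: evec R j) = `|t| by rewrite enormZ enorm_evec mulr1.
have := hC v (t *: evec R j) (ltW v1); rewrite te => /(_ t1).
rewrite real_normK ?num_real// dotZr dot_evec.
by rewrite (_ : 2 * 2%:R * (t * v ord0 j) = 4 * t * v ord0 j)//; ring.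
Qed.

(** The j-th partial derivative of [pp 2 (q v)] is [- 4 * (v ord0 j * pp 1 (q v))], and its integral
    vanishes. *)
Lemma Ex_coord_pp j : Ex mu (fun v : bV => v ord0 j * pp 1 (q v)) = 0.
Proof.
have [C C0 hC] := taylor j.
suff : Ex mu (fun v : bV => - 4 * (v ord0 j * pp 1 (q v))) = 0.
  by rewrite ExZ// => /eqP; rewrite mulf_eq0 => /orP[|/eqP//]; rewrite oppr_eq0 pnatr_eq0.
apply: (@Ex_divergence (fun v => pp 2 (q v)) _ (evec R j) (Num.sqrt sigma) C) => //.
- exact: bmeasZ.
- exact: enorm_evec.
- by move=> v; exact: q_supp.
- move=> v t v1 t1; have := hC v t v1 t1.
  by rewrite (_ : 4 * t * v ord0 j * _ = - (t * (- 4 * (v ord0 j * pp 1 (q v)))))//; ring.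
Qed.

(** The j-th partial derivative of [v ord0 i * pp 2 (q v)] integrates to zero; the product rule
    gives the diagonal term. This is where isotropy comes from. *)
Lemma Ex_coord2_pp i j : Ex mu (fun v : bV => v ord0 i * v ord0 j * pp 1 (q v)) =
  (i == j)%:R / 4 * Ex mu (fun v : bV => pp 2 (q v)).
Proof.
have [C C0 hC] := taylor j.
suff : Ex mu (fun v : bV => (i == j)%:R * pp 2 (q v) - 4 * (v ord0 i * v ord0 j * pp 1 (q v))) = 0.
  rewrite ExB; [|exact: bmeasZ|exact: bmeasZ].
  by rewrite ExZ// ExZ//; lra.
apply: (@Ex_divergence (fun v => v ord0 i * pp 2 (q v)) _ (evec R j) (Num.sqrt sigma) (C + C + 4)) => //.
- by apply: bmeasB; exact: bmeasZ.
- exact: enorm_evec.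
- by move=> v; rewrite mulf_eq0 negb_or => /andP[_]; exact: q_supp.
- move=> v t v1 t1; have := hC v t v1 t1.
  set A := pp 2 (q (v + _)); set B := pp 2 (q v); set D := pp 1 (q v) => hA.
  rewrite !mxE eqxx /=.
  (* A remainder times [v ord0 i], a remainder times [t], and the product of the two first-order
     increments: the sources of [C + C + 4]. *)
  have -> : (v ord0 i + t * (i == j)%:R) * A - v ord0 i * B -
     t * ((i == j)%:R * B - 4 * (v ord0 i * v ord0 j * D)) =
    v ord0 i * (A - B + 4 * t * v ord0 j * D) +
    (i == j)%:R * (t * (A - B + 4 * t * v ord0 j * D)) - (i == j)%:R * (4 * (v ord0 j * D) * t ^+ 2) by ring.
  have vl l : `|v ord0 l| <= 1 by rewrite (le_trans (coord_le _ _))// ltW.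
  have d1 : `|(i == j)%:R : R| <= 1 by case: (i == j); rewrite ?normr1 ?normr0.
  have D1 : `|D| <= 1 by have := pp_norm 1 (@ler01 R) (qle v); rewrite expr1n.
  rewrite [leRHS]mulrDl [X in _ <= X + _]mulrDl.
  apply: le_trans (ler_normB _ _) _; apply: lerD.
    apply: le_trans (ler_normD _ _) _; apply: lerD.
      by apply: le_trans hA; rewrite normrM ler_piMl.
    apply: le_trans hA; rewrite normrM normrM [leLHS]mulrA ler_piMl//.
    by rewrite mulr_ile1.
  have e1 : `|v ord0 j * D| <= 1 by rewrite normrM mulr_ile1.
  rewrite normrM -[leRHS]mul1r; apply: ler_pM => //.
  rewrite normrM (ger0_norm (sqr_ge0 t)) ler_wpM2r ?sqr_ge0//.
  rewrite normrM ger0_norm//; lra.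
Qed.

End FixedLevel.

End Moments.

Section ClipMoments.
Context {R : realType} {N : nat} (mu : probability (borelV R N) R).
Hypothesis mu_unif : unif_law mu.
Local Notation V := 'rV[R]_N.
Local Notation bV := (borelV R N).
Implicit Types (v : V) (i j : 'I_N).

(** The offset 3 puts both levels [1 - eta n] and [1 - 2 * eta n] strictly between 0 and 1 from
    [n = 0] on, where the weighted moments are available. *)
Let eta n : R := n.+3%:R^-1.

Let eta0 n : 0 < eta n.
Proof. by rewrite invr_gt0. Qed.

Let eta2 n : 2 * eta n < 1.
Proof. by rewrite ltr_pdivrMr// mul1r ltr_nat. Qed.

(* [(pp 1 (1 - eta - t) - pp 1 (1 - 2 eta - t)) / eta] tends to the indicator of
   [t < 1]: this recovers the moments of [mu] from the weighted ones. *)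
Let omega n v : R :=
  (pp 1 (1 - eta n - dot v v) - pp 1 (1 - 2 * eta n - dot v v)) / eta n.

Let momega n : measurable_fun setT (omega n : bV -> R).
Proof.
have mq (s : R) : measurable_fun setT (fun v : bV => pp 1 (s - dot (v : V) v)).
  have := @measurable_pp_dot R N 1 s 0 _ bV id (@measurable_id _ bV setT).
  by under eq_fun do rewrite subr0.
by apply: measurable_funM; [exact: measurable_funB|exact: measurable_cst].
Qed.

Let omega_le1 n v : `|omega n v| <= 1.
Proof.
rewrite normrM [`|(eta n)^-1|]ger0_norm ?invr_ge0 ?(ltW (eta0 n))// ler_pdivrMr// mul1r.
have := pp1_lipschitz (1 - 2 * eta n - dot v v) (eta n).
rewrite [`|eta n|]gtr0_norm//; apply: le_trans; rewrite le_eqVlt; apply/orP; left.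
by apply/eqP; congr (`|pp 1 _ - _|); ring.
Qed.

Let omega_cvg v : enorm v < 1 -> omega ^~ v @ \oo --> (1 : R).
Proof.
move=> v1; have v0 : 0 < 1 - dot v v.
  by rewrite subr_gt0 -enorm_sqr expr_lt1// enorm_ge0.
apply: cvg_near_cst.
have near_small : \forall n \near \oo, 2 * eta n < 1 - dot v v.
  exists (Num.truncn (2 / (1 - dot v v))).+1 => // n /= hn.
  rewrite ltr_pdivrMr// mulrC -ltr_pdivrMr//.
  apply: (lt_le_trans (truncnS_gt _)); rewrite ler_nat.
  exact: (leq_trans hn (leq_trans (leqnSn _) (leq_trans (leqnSn _) (leqnSn _)))).
apply: filterS near_small => n hn; apply/eqP.
have e0 := eta0 n; rewrite /omega !pp_pos ?expr1; [|lra|lra].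
apply/eqP/(mulIf (lt0r_neq0 e0)).
by rewrite divfK ?gt_eqF// mul1r; ring.
Qed.

Let Ex_omega_cvg (f : V -> R) : measurable_fun setT (f : bV -> R) ->
  (forall v, enorm v < 1 -> `|f v| <= 1) ->
  (fun n => Ex mu (fun v : bV => f (clip v) * omega n (clip v))) @ \oo -->
  Ex mu (fun v : bV => f (clip v)).
Proof.
move=> mf f1; apply: (@Ex_dominated _ _ _ _ _ _ 1).
- move=> n; have mg : measurable_fun setT (fun v : bV => f v * omega n v).
    exact: measurable_funM.
  exact: (measurableT_comp mg (@measurable_clip R N)).
- exact: (measurableT_comp mf (@measurable_clip R N)).
- by move=> n v; rewrite normrM mulr_ile1// f1// clip_lt1.
- move=> v; rewrite -[X in _ --> X]mulr1; apply: cvgM; first exact: cvg_cst.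
  by apply: omega_cvg; exact: clip_lt1.
Qed.

Let pp1_mul_bmeas (f : V -> R) (s : R) : s <= 1 -> measurable_fun setT (f : bV -> R) ->
  (forall v, enorm v < 1 -> `|f v| <= 1) ->
  bmeas (fun v : bV => f (clip v) * pp 1 (s - dot (clip v) (clip v))).
Proof.
move=> s1 mf f1; apply: (@bmeas_clip R N (fun v => f v * pp 1 (s - dot v v)) 1).
  apply: measurable_funM => //.
  have := @measurable_pp_dot R N 1 s 0 _ bV id (@measurable_id _ bV setT).
  by under eq_fun do rewrite subr0.
move=> v v1; rewrite normrM mulr_ile1 ?f1//.
by have := pp_norm 1 (@ler01 R) (le_trans (sub_dot_le s v) s1); rewrite expr1n.
Qed.

Let Ex_omega (f : V -> R) n : measurable_fun setT (f : bV -> R) ->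
  (forall v, enorm v < 1 -> `|f v| <= 1) ->
  Ex mu (fun v : bV => f (clip v) * omega n (clip v)) =
  (Ex mu (fun v : bV => f v * pp 1 (1 - eta n - dot v v)) -
   Ex mu (fun v : bV => f v * pp 1 (1 - 2 * eta n - dot v v))) / eta n.
Proof.
move=> mf f1; have e0 := eta0 n.
rewrite -(Ex_clip mu_unif (fun v => f v * pp 1 (1 - eta n - dot v v))).
rewrite -(Ex_clip mu_unif (fun v => f v * pp 1 (1 - 2 * eta n - dot v v))).
rewrite -ExB; [|apply: pp1_mul_bmeas => //; lra|apply: pp1_mul_bmeas => //; lra].
rewrite mulrC -ExZ; last by apply: bmeasB; apply: pp1_mul_bmeas => //; lra.
by apply: eq_Ex => v; rewrite /omega; ring.
Qed.

Let coord_le1 i v : enorm v < 1 -> `|v ord0 i| <= 1.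
Proof. by move=> v1; rewrite (le_trans (coord_le _ _))// ltW. Qed.

Let coord2_le1 i j v : enorm v < 1 -> `|v ord0 i * v ord0 j| <= 1.
Proof. by move=> v1; rewrite normrM mulr_ile1// coord_le1. Qed.

Let eta_lt1 n : [/\ 0 < 1 - eta n, 1 - eta n < 1, 0 < 1 - 2 * eta n & 1 - 2 * eta n < 1].
Proof. by have e0 := eta0 n; have e2 := eta2 n; split; lra. Qed.

Lemma Ex_clip_coord i : Ex mu (fun v : bV => clip v ord0 i) = 0.
Proof.
have := Ex_omega_cvg (measurable_coord i) (coord_le1 i).
rewrite (_ : (fun n : nat => _) = cst 0); first by move/cvg_lim => <- //; rewrite lim_cst.
apply/funext => n; have [h1 h2 h3 h4] := eta_lt1 n.
rewrite (Ex_omega _ (measurable_coord i) (coord_le1 i)).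
by rewrite !Ex_coord_pp// subrr mul0r.
Qed.

(** The weighted second moments are a multiple of the identity matrix, so their limit is one too.
    Positivity of [a] matters because the expansion of the mean will be divided by it. *)
Lemma Ex_clip_coord2 : (0 < N)%N -> exists2 a : R, 0 < a & forall i j,
  Ex mu (fun v : bV => clip v ord0 i * clip v ord0 j) = (i == j)%:R * a.
Proof.
move=> N0; pose i0 := Ordinal N0.
pose b n := (Ex mu (fun v : bV => pp 2 (1 - eta n - dot (v : V) v)) -
   Ex mu (fun v : bV => pp 2 (1 - 2 * eta n - dot (v : V) v))) / eta n / 4.
have mc2 i j : measurable_fun setT (fun v : bV => (v : V) ord0 i * (v : V) ord0 j : R).
  by apply: measurable_funM; exact: measurable_coord.
have cvgb i j : (fun n => (i == j)%:R * b n) @ \oo -->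
    Ex mu (fun v : bV => clip v ord0 i * clip v ord0 j).
  have := Ex_omega_cvg (mc2 i j) (coord2_le1 i j).
  rewrite (_ : (fun n : nat => _) = (fun n => (i == j)%:R * b n))//.
  apply/funext => n; have [h1 h2 h3 h4] := eta_lt1 n.
  rewrite (Ex_omega _ (mc2 i j) (coord2_le1 i j)).
  by rewrite !Ex_coord2_pp// /b; ring.
exists (Ex mu (fun v : bV => clip v ord0 i0 * clip v ord0 i0)); last first.
  move=> i j; have [->|ij] := eqVneq i j.
    have := cvgb j j; have := cvgb i0 i0; rewrite !eqxx => h1 h2.
    by rewrite mul1r; exact: (cvg_unique _ h2 h1).
  have := cvgb i j; rewrite (negbTE ij) mul0r.
  rewrite (_ : (fun n : nat => _) = cst 0); last by apply/funext => n; rewrite mul0r.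
  by move=> /cvg_lim <- //; rewrite lim_cst.
have bcc : bmeas (fun v : bV => clip v ord0 i0 * clip v ord0 i0).
  by apply: bmeasM; exact: bmeas_clip_coord.
(* Positivity comes from comparison with the weighted moment at a single level, any one strictly
   between 0 and 1. *)
pose s : R := 1 / 2.
have sP : 0 < s < 1 by rewrite /s; apply/andP; split; lra.
have [/andP[s0 s1]] := sP.
have bs := pp1_mul_bmeas (ltW s1) (mc2 i0 i0) (coord2_le1 i0 i0).
have h1 : Ex mu (fun v : bV => clip v ord0 i0 * clip v ord0 i0 * pp 1 (s - dot (clip v) (clip v)))
    <= Ex mu (fun v : bV => clip v ord0 i0 * clip v ord0 i0).
  apply: le_Ex => // v; rewrite ler_piMr//; first by rewrite -expr2 sqr_ge0.
  by have := pp_le 1 (@ler01 R) (le_trans (sub_dot_le s (clip v)) (ltW s1)); rewrite expr1n.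
apply: lt_le_trans h1.
rewrite (Ex_clip mu_unif (fun v => v ord0 i0 * v ord0 i0 * pp 1 (s - dot v v))).
rewrite Ex_coord2_pp// eqxx; apply: mulr_gt0; first by rewrite divr_gt0.
pose A : set V := [set v | enorm v < s].
have mA : measurable (A : set bV).
  apply: open_measurableV; have := @open_eball R N 0 s; congr open; apply/seteqP.
  by split=> x; rewrite /= subr0.
have A0 : 0 < fine (mu A).
  apply: fine_gt0; rewrite (unif_law_small_ball mu_unif s0) /=.
  by apply: (le_lt_trans (probability_le1 _ mA)); rewrite ltry.
(* On the ball of radius 1/2 one has [dot v v < 1 / 4], so that [s - dot v v] exceeds 1/4 and its
   square 1/16. *)
apply: (@lt_le_trans _ _ ((1 / 16) * fine (mu A))); first by rewrite mulr_gt0//.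
rewrite -Ex_indic// -ExZ; last exact: bmeas_indic.
apply: le_Ex; first by apply: bmeasZ; exact: bmeas_indic.
  split.
    have := @measurable_pp_dot R N 2 s 0 _ bV id (@measurable_id _ bV setT).
    by under eq_fun do rewrite subr0.
  by exists 1 => v; have := pp_norm 2 (@ler01 R) (le_trans (sub_dot_le s v) (ltW s1)); rewrite expr1n.
move=> v; rewrite indicE; case: (boolP (v \in _)); last by rewrite mulr0 pp_ge0.
rewrite inE /A /= => vs; rewrite mulr1.
have : dot v v < 1 / 4.
  rewrite -enorm_sqr; have := enorm_ge0 v; move: vs; rewrite /s; nra.
by move=> vv; rewrite pp_pos /s; [nra|lra].
Qed.

End ClipMoments.

(** * Limits of functions with the mean value property *)

Section WeakHarmonicity.
Context {R : realType} {N : nat} (mu : probability (borelV R N) R).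
Hypothesis mu_unif : unif_law mu.
Local Notation V := 'rV[R]_N.
Local Notation bV := (borelV R N).
Implicit Types (v y z : V).
Variables (x0 : V) (L : R).
Hypothesis L0 : 0 < L.

Definition ball_pt v : V := x0 + L *: clip v.

(* [clip v] is uniform on the unit ball, so this is the average of [h] over the
   ball of centre [x0] and radius [L]. *)
Definition Iball (h : V -> R) : R := Ex mu (fun v : bV => h (ball_pt v)).

Lemma ball_pt_lt v : enorm (ball_pt v - x0) < L.
Proof.
by rewrite /ball_pt addrAC subrr add0r enormZ gtr0_norm// gtr_pMr// clip_lt1.
Qed.

Lemma measurable_ball_pt : measurable_fun setT (ball_pt : bV -> bV).
Proof.
apply: measurable_addV; first exact: (@measurable_cst _ _ bV bV setT x0).
by apply: measurable_scaleV; [exact: measurable_cst|exact: measurable_clip].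
Qed.

Lemma bmeas_ball_pt (h : V -> R) (M : R) : measurable_fun setT (h : bV -> R) ->
  (forall y, enorm (y - x0) < L -> `|h y| <= M) -> bmeas (fun v : bV => h (ball_pt v)).
Proof.
move=> mh hM; split; first exact: (measurableT_comp mh measurable_ball_pt).
by exists M => v; apply: hM; exact: ball_pt_lt.
Qed.

Lemma Iball_shift (t : V) (h : V -> R) : bmeas (h : bV -> R) ->
  (forall y, h y != 0 -> enorm (y - x0) < L /\ enorm (y - t - x0) < L) ->
  Iball (fun y => h (y + t)) = Iball h.
Proof.
move=> bh supp; rewrite /Iball /ball_pt.
rewrite (Ex_clip mu_unif (fun v => h (x0 + L *: v + t))).
rewrite (Ex_clip mu_unif (fun v => h (x0 + L *: v))).
pose g v := h (x0 + L *: v).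
have mp : measurable_fun setT ((fun v => x0 + L *: v) : bV -> bV).
  apply: measurable_addV; first exact: (@measurable_cst _ _ bV bV setT x0).
  by apply: measurable_scaleV; [exact: measurable_cst|exact: measurable_id].
have bg : bmeas (g : bV -> R) by exact: (bmeas_comp bh mp).
rewrite -[RHS](Ex_shift mu_unif (t := L^-1 *: t) bg).
  apply: eq_Ex => v; rewrite /g scalerDr scalerA divff ?gt_eqF// scale1r.
  by rewrite addrA.
have e1 v : x0 + L *: v - x0 = L *: v by rewrite addrAC subrr add0r.
have e2 v : x0 + L *: v - t - x0 = L *: (v - L^-1 *: t).
  rewrite scalerBr scalerA divff ?gt_eqF// scale1r.
  by rewrite -[x0 + L *: v - t]addrA addrAC subrr add0r.
by move=> v /supp; rewrite e1 e2 !enormZ gtr0_norm// !gtr_pMr.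
Qed.

Section TestFunctions.
Variables (k : nat) (sigma : R) (z : V).
Hypotheses (k12 : (k = 1 \/ k = 2)%N) (s0 : 0 < sigma).

Definition test y : R := pp k.+2 (sigma - dot (y - z) (y - z)).

(* [test_lap] is the Laplacian of [test], up to the factor [2 k.+2]. *)
Definition test_lap y : R :=
  - N%:R * pp k.+1 (sigma - dot (y - z) (y - z)) +
  2 * k.+1%:R * dot (y - z) (y - z) * pp k (sigma - dot (y - z) (y - z)).

Let s0' := ltW s0.

Let mpp j : measurable_fun setT (fun y : bV => pp j (sigma - dot ((y : V) - z) (y - z))).
Proof. exact: (@measurable_pp_dot R N j sigma z _ bV _ (@measurable_id _ bV setT)). Qed.

Lemma bmeas_test : bmeas (test : bV -> R).
Proof.
split; first exact: mpp.
by exists (sigma ^+ k.+2) => y; rewrite pp_norm// sub_dot_le.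
Qed.

Lemma test_supp y : test y != 0 -> enorm (y - z) <= Num.sqrt sigma.
Proof.
rewrite /test; have [q0|q0] := leP (sigma - dot (y - z) (y - z)) 0.
  by rewrite pp_neg ?eqxx.
by move=> _; rewrite enormE ler_sqrt// -subr_ge0 ltW.
Qed.

Lemma bmeas_test_lap : bmeas (fun v : bV => test_lap (ball_pt v)).
Proof.
pose B := L + enorm (x0 - z).
apply: (@bmeas_ball_pt _ (N%:R * sigma ^+ k.+1 + 2 * k.+1%:R * B ^+ 2 * sigma ^+ k)).
  apply: measurable_funD; apply: measurable_funM; try exact: mpp.
    exact: measurable_cst.
  apply: measurable_funM; first exact: measurable_cst.
  exact: continuous_measurableV (@continuous_dotB R N z).
move=> y yL; apply: le_trans (ler_normD _ _) _; apply: lerD.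
  by rewrite normrM normrN normr_nat ler_wpM2l// pp_norm// sub_dot_le.
rewrite normrM; apply: ler_pM => //; last by rewrite pp_norm// sub_dot_le.
rewrite ger0_norm; last by nng.
apply: ler_wpM2l; first by nng.
rewrite -enorm_sqr lerXn2r ?nnegrE ?enorm_ge0//; first by rewrite addr_ge0 ?enorm_ge0// ltW.
by rewrite (le_trans (enorm_triangle _ _ x0))// lerD2r ltW.
Qed.

Let bclip2 i j : bmeas (fun v : bV => clip (v : V) ord0 i * clip (v : V) ord0 j).
Proof. by apply: bmeasM; exact: bmeas_clip_coord. Qed.

Lemma Ex_dot_clip (b : V) : Ex mu (fun v : bV => dot b (clip v)) = 0.
Proof.
rewrite /dot Ex_sum; last by move=> i; apply: bmeasZ; exact: bmeas_clip_coord.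
rewrite big1// => i _; rewrite ExZ; last exact: bmeas_clip_coord.
by rewrite Ex_clip_coord// mulr0.
Qed.

Variable (a : R).
Hypothesis a_def : forall i j : 'I_N,
  Ex mu (fun v : bV => clip (v : V) ord0 i * clip (v : V) ord0 j) = (i == j)%:R * a.

Lemma Ex_clip_sqr : Ex mu (fun v : bV => dot (clip v) (clip v)) = N%:R * a.
Proof.
rewrite /dot Ex_sum; last by move=> i; exact: bclip2.
rewrite (eq_bigr (fun=> a)); last by move=> i _; rewrite a_def eqxx mul1r.
by rewrite sumr_const card_ord mulr_natl.
Qed.

Lemma Ex_dot_clip_sqr (b : V) : Ex mu (fun v : bV => dot b (clip v) ^+ 2) = a * dot b b.
Proof.
transitivity (Ex mu (fun v : bV => \sum_(i < N) \sum_(j < N)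
    b ord0 i * b ord0 j * (clip (v : V) ord0 i * clip (v : V) ord0 j))).
  apply: eq_Ex => v; rewrite expr2 /dot mulr_suml; apply: eq_bigr => i _.
  by rewrite mulr_sumr; apply: eq_bigr => j _; ring.
rewrite Ex_sum; last by move=> i; apply: bmeas_sum => j; apply: bmeasZ; exact: bclip2.
rewrite /dot mulr_sumr; apply: eq_bigr => i _.
rewrite Ex_sum; last by move=> j; apply: bmeasZ; exact: bclip2.
rewrite (bigD1 i)//= ExZ; last exact: bclip2.
rewrite a_def eqxx mul1r big1 ?addr0; first by rewrite mulrC.
move=> j ji; rewrite ExZ; last exact: bclip2.
by rewrite a_def eq_sym (negbTE ji) mul0r mulr0.
Qed.

Lemma bmeas_dot_clip (b : V) : bmeas (fun v : bV => dot b (clip v)).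
Proof.
by apply: bmeas_sum => i; apply: bmeasZ; exact: bmeas_clip_coord.
Qed.

Lemma bmeas_clip_sqr : bmeas (fun v : bV => dot (clip v) (clip v)).
Proof. by apply: bmeas_sum => i; exact: bclip2. Qed.

Lemma measurable_add_clip (delta : R) :
  measurable_fun setT ((fun p => p.1 + delta *: clip p.2) : bV * bV -> bV).
Proof.
apply: measurable_addV; first exact: measurable_fst.
apply: measurable_scaleV; first exact: measurable_cst.
exact: (measurableT_comp (@measurable_clip R N) measurable_snd).
Qed.

(** The linear term averages to zero and the isotropic second moments turn the Hessian form into [a]
    times its trace. The constant is uniform over [y] within distance [B] of [z], as needed for
    integrating the estimate. *)
Lemma mean_expansion (B : R) : 0 <= B -> exists2 C : R, 0 <= C &
  forall y delta, enorm (y - z) <= B -> 0 <= delta <= 1 ->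
  `|Ex mu (fun v : bV => test (y + (- delta) *: clip v)) - test y
    - delta ^+ 2 * (a * k.+2%:R * test_lap y)| <= C * delta ^+ 3.
Proof.
move=> B0; have [C C0 hC] := @ker_taylor2 R N k sigma B k12 s0' B0.
exists C => // y delta yB /andP[d0 d1].
pose b := y - z; pose s := sigma - dot b b.
pose f v := test (y + (- delta) *: clip v) - test y
    + (k.+2%:R * pp k.+1 s * (- 2 * delta)) * dot b (clip v)
    + (k.+2%:R * pp k.+1 s * delta ^+ 2) * dot (clip v) (clip v)
    - (2 * (k.+2 * k.+1)%:R * pp k s * delta ^+ 2) * dot b (clip v) ^+ 2.
have bt : bmeas (fun v : bV => test (y + (- delta) *: clip v)).
  apply: (bmeas_comp bmeas_test (p := (fun v => y + (- delta) *: clip v) : bV -> bV)).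
  apply: measurable_addV; first exact: (@measurable_cst _ _ bV bV setT y).
  by apply: measurable_scaleV; [exact: measurable_cst|exact: measurable_clip].
have bdc2 : bmeas (fun v : bV => dot b (clip v) ^+ 2).
  by under eq_fun do rewrite expr2; apply: bmeasM; exact: bmeas_dot_clip.
have b1 : bmeas (fun v : bV => test (y + (- delta) *: clip v) - test y).
  by apply: bmeasB => //; exact: bmeas_cst.
have b2 c : bmeas (fun v : bV => c * dot b (clip v)) by apply: bmeasZ; exact: bmeas_dot_clip.
have b3 c : bmeas (fun v : bV => c * dot (clip v) (clip v)) by apply: bmeasZ; exact: bmeas_clip_sqr.
have b4 c : bmeas (fun v : bV => c * dot b (clip v) ^+ 2) by apply: bmeasZ.
have b12 c : bmeas (fun v : bV => test (y + (- delta) *: clip v) - test y + c * dot b (clip v)) by apply: bmeasD.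
have b123 c c' : bmeas (fun v : bV => test (y + (- delta) *: clip v) - test y + c * dot b (clip v) + c' * dot (clip v) (clip v)) by apply: bmeasD.
have -> : Ex mu (fun v : bV => test (y + (- delta) *: clip v)) - test y
    - delta ^+ 2 * (a * k.+2%:R * test_lap y) = Ex mu (f : bV -> R).
  rewrite ExB// ExD// ExD// ExB//; last exact: bmeas_cst.
  rewrite Ex_cst !ExZ//; [|exact: bmeas_clip_sqr|exact: bmeas_dot_clip].
  rewrite Ex_dot_clip Ex_clip_sqr Ex_dot_clip_sqr /test_lap -/b -/s natrM; ring.
apply: norm_Ex_le; first exact: bmeasB.
move=> v; have c1 := clip_lt1 v.
have dc : enorm ((- delta) *: clip v) <= delta.
  by rewrite enormZ normrN ger0_norm// ler_piMr// ltW.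
have := hC b ((- delta) *: clip v) yB (le_trans dc d1).
have : C * enorm (- delta *: clip v) ^+ 3 <= C * delta ^+ 3.
  by rewrite ler_wpM2l// lerXn2r ?nnegrE ?enorm_ge0.
move=> h1 h2; apply: le_trans h1; apply: le_trans h2; rewrite le_eqVlt; apply/orP; left.
apply/eqP; congr (`|_|); rewrite /f /test.
have -> : y + - delta *: clip v - z = b + - delta *: clip v by rewrite /b addrAC.
rewrite -/b -/s !(dotZr, dotZl); ring.
Qed.

(* Translating by [delta *: clip v'] under the integral moves the averaging
   operator from [U] onto the test function. *)
Lemma discrete_weak (U : V -> R) (delta : R) : bmeas (U : bV -> R) -> 0 <= delta ->
  (forall y, enorm (y - x0) < L -> U y = Ex mu (fun v : bV => U (y + delta *: clip v))) ->
  enorm (z - x0) + Num.sqrt sigma + delta < L ->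
  Iball (fun y => U y *
    (Ex mu (fun v : bV => test (y + (- delta) *: clip v)) - test y)) = 0.
Proof.
move=> bU d0 mvp room.
have bt := bmeas_test.
have supp y : test y != 0 -> enorm (y - x0) + delta < L.
  move=> /test_supp yz; apply: le_lt_trans room.
  by rewrite lerD2r (le_trans (enorm_triangle _ _ z))// addrC lerD2l.
have bpt : measurable_fun setT ((fun p => (ball_pt p.1, p.2)) : bV * bV -> bV * bV).
  apply: measurable_fun_pair; last exact: measurable_snd.
  exact: (measurableT_comp measurable_ball_pt measurable_fst).
have joint (g h : V -> R) (c c' : R) : bmeas (g : bV -> R) -> bmeas (h : bV -> R) ->
    bmeas (fun p : bV * bV => g (ball_pt p.1 + c *: clip p.2) * h (ball_pt p.1 + c' *: clip p.2)).
  move=> bg bh; apply: bmeasM.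
    exact: (bmeas_comp bg (measurableT_comp (@measurable_add_clip c) bpt)).
  exact: (bmeas_comp bh (measurableT_comp (@measurable_add_clip c') bpt)).
have J1 : bmeas (fun p : bV * bV => U (ball_pt p.1 + delta *: clip p.2) * test (ball_pt p.1)).
  have := joint U test delta 0 bU bt.
  by under eq_fun do rewrite scale0r addr0.
have J2 : bmeas (fun p : bV * bV => U (ball_pt p.1) * test (ball_pt p.1 + (- delta) *: clip p.2)).
  have := joint U test 0 (- delta) bU bt.
  by under eq_fun do rewrite scale0r addr0.
have bUp : bmeas (fun v : bV => U (ball_pt v)) by exact: (bmeas_comp bU measurable_ball_pt).
have btp : bmeas (fun v : bV => test (ball_pt v)) by exact: (bmeas_comp bt measurable_ball_pt).
have btc y : bmeas (fun v : bV => test (y + (- delta) *: clip v)).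
  apply: (bmeas_comp bt (p := (fun v => y + (- delta) *: clip v) : bV -> bV)).
  apply: measurable_addV; first exact: (@measurable_cst _ _ bV bV setT y).
  by apply: measurable_scaleV; [exact: measurable_cst|exact: measurable_clip].
have bUc y : bmeas (fun v : bV => U (y + delta *: clip v)).
  apply: (bmeas_comp bU (p := (fun v => y + delta *: clip v) : bV -> bV)).
  apply: measurable_addV; first exact: (@measurable_cst _ _ bV bV setT y).
  by apply: measurable_scaleV; [exact: measurable_cst|exact: measurable_clip].
have e1 : Ex mu (fun v : bV => U (ball_pt v) * test (ball_pt v)) =
    Ex mu (fun v : bV => Ex mu (fun v' : bV => U (ball_pt v) * test (ball_pt v + (- delta) *: clip v'))).
  transitivity (Ex mu (fun v : bV => Ex mu (fun v' : bV =>
      U (ball_pt v + delta *: clip v') * test (ball_pt v)))).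
    apply: eq_Ex => v; rewrite mvp ?ball_pt_lt// mulrC -ExZ//.
    by apply: eq_Ex => v'; rewrite mulrC.
  rewrite (Ex_fubini mu mu J1) [RHS](Ex_fubini mu mu J2) /=.
  apply: eq_Ex => v'.
  have := @Iball_shift (delta *: clip v')
    (fun y => U y * test (y + - delta *: clip v')).
  rewrite /Iball => <-.
  - by apply: eq_Ex => v; rewrite scaleNr addrK.
  - apply: bmeasM => //.
    apply: (bmeas_comp bt (p := (fun y => y + (- delta) *: clip v') : bV -> bV)).
    exact: measurable_add_cst.
  (* The margin [delta] in [room] is spent here: the support of the translated test function, and
     its own translate, stay in the ball of integration. *)
  - move=> y; rewrite mulf_eq0 negb_or => /andP[_ /supp]; rewrite scaleNr => h.
    have dc : enorm (delta *: clip v') <= delta.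
      by rewrite enormZ ger0_norm// ler_piMr// ltW// clip_lt1.
    split; last by apply: le_lt_trans h; rewrite lerDl.
    apply: le_lt_trans h; rewrite (le_trans (enorm_triangle _ _ (y - delta *: clip v')))//.
    by rewrite addrC lerD2l opprB addrC subrK.
have bE : bmeas (fun v : bV => Ex mu (fun v' : bV => U (ball_pt v) * test (ball_pt v + (- delta) *: clip v'))).
  exact: (bmeas_Ex1 mu mu J2).
have -> : Iball (fun y => U y * (Ex mu (fun v : bV => test (y + (- delta) *: clip v)) - test y)) =
    Ex mu (fun v : bV => Ex mu (fun v' : bV => U (ball_pt v) * test (ball_pt v + (- delta) *: clip v'))
      - U (ball_pt v) * test (ball_pt v)).
  by apply: eq_Ex => v; rewrite mulrBr ExZ.
by rewrite ExB//; [rewrite e1 subrr|exact: bmeasM].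
Qed.

End TestFunctions.

End WeakHarmonicity.

(** Cutting the interval from [s] to [t] into [n] equal steps bounds the total increment by
    [C * (t - s) ^+ 2] divided by [n]. It plays the part of the theorem on functions with zero
    derivative. *)
Lemma quadratic_increment_cst (R : realType) (r : R -> R) (a b C : R) :
  (forall s h, a <= s -> 0 <= h -> s + h <= b -> `|r (s + h) - r s| <= C * h ^+ 2) ->
  forall s t, a <= s -> s <= t -> t <= b -> r s = r t.
Proof.
move=> rC s t as_ st tb.
have step n : `|r t - r s| <= C * (t - s) ^+ 2 * n.+1%:R^-1.
  pose h := (t - s) / n.+1%:R.
  have h0 : 0 <= h by rewrite divr_ge0// subr_ge0.
  have hn : h *+ n.+1 = t - s by rewrite -mulr_natr divfK// pnatr_eq0.
  have part m : (m <= n.+1)%N -> `|r (s + h *+ m) - r s| <= (C * h ^+ 2) *+ m.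
    elim: m => [|m IH] mn; first by rewrite !mulr0n addr0 subrr normr0.
    have -> : r (s + h *+ m.+1) - r s =
      (r (s + h *+ m + h) - r (s + h *+ m)) + (r (s + h *+ m) - r s).
      by rewrite mulrSr addrA; ring.
    apply: le_trans (ler_normD _ _) _; rewrite mulrS; apply: lerD; last exact: IH (ltnW mn).
    apply: rC => //; first by rewrite (le_trans as_)// lerDl mulrn_wge0.
    rewrite -addrA -mulrSr; apply: le_trans tb.
    by rewrite -lerBrDl -hn -[leLHS]mulr_natr -[leRHS]mulr_natr ler_wpM2l// ler_nat.
  have := part _ (leqnn n.+1); rewrite hn (addrC s) subrK => /le_trans; apply.
  rewrite le_eqVlt; apply/orP; left; apply/eqP.
  rewrite /h -[LHS]mulr_natr; field.
  by rewrite nat1r pnatr_eq0.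
apply/eqP; rewrite eq_sym -subr_eq0; apply/eqP.
(* [C] has no sign; nonnegativity of this product is read off the subdivision into one step. *)
have K0 : 0 <= C * (t - s) ^+ 2 by have := step 0%N; rewrite invr1 mulr1; exact: le_trans.
apply: (@le_linear_eq0 _ _ (C * (t - s) ^+ 2) 1) => // e /andP[e0 _].
apply: le_trans (step (Num.truncn e^-1)) _; rewrite ler_wpM2l//.
by rewrite -[leRHS]invrK lef_pV2 ?posrE ?invr_gt0// ltW// truncnS_gt.
Qed.

Section Representation.
Context {R : realType} {N : nat} (mu : probability (borelV R N) R).
Hypothesis mu_unif : unif_law mu.
Hypothesis N0 : (0 < N)%N.
Local Notation V := 'rV[R]_N.
Local Notation bV := (borelV R N).
Implicit Types (v y z : V).
Variables (x0 : V) (L : R).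
Hypothesis L0 : 0 < L.
Local Notation pt := (ball_pt x0 L).
Local Notation Iball := (Iball mu x0 L).

(** The interface between probability and analysis. [u] is controlled on the ball alone, but [U] is
    evaluated at [y + delta *: clip v], possibly outside it, and is therefore bounded and measurable
    on the whole space. *)
Definition mean_value_limit (u : V -> R) :=
  bmeas (fun v : bV => u (pt v)) /\
  forall t, 0 < t -> exists U : V -> R, exists delta,
    [/\ bmeas (U : bV -> R), 0 < delta < t,
        forall y, enorm (y - x0) < L -> U y = Ex mu (fun v : bV => U (y + delta *: clip v)) &
        forall y, enorm (y - x0) < L -> `|U y - u y| < t].

(** Used for [c = 1]: the normalising integrals of the weights then obey the same relations as the
    integrals of [u]. *)
Lemma mean_value_limit_cst (c : R) : mean_value_limit (fun=> c).
Proof.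
split; first exact: bmeas_cst.
move=> t t0; exists (fun=> c), (t / 2); split.
- exact: bmeas_cst.
- by apply/andP; split; lra.
- by move=> y _; rewrite Ex_cst.
- by move=> y _; rewrite subrr normr0.
Qed.

(** In the discrete identity for [U] the mean increment of the test function is [delta ^+ 2] times a
    positive multiple of [test_lap], up to order 3. Division by [delta ^+ 2] leaves an error of
    order [delta], and replacing [U] by [u] costs a multiple of [t]. *)
Lemma weak_harmonic (u : V -> R) k sigma z : mean_value_limit u ->
  (k = 1 \/ k = 2)%N -> 0 < sigma -> enorm (z - x0) + Num.sqrt sigma < L ->
  Iball (fun y => u y * test_lap k sigma z y) = 0.
Proof.
move=> [bu approx] k12 s0 room.
have [a a0 a_def] := Ex_clip_coord2 mu_unif N0.
pose B := L + enorm (x0 - z).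
have B0 : 0 <= B by rewrite addr_ge0 ?enorm_ge0// ltW.
have ptB v : enorm (pt v - z) <= B.
  by rewrite (le_trans (enorm_triangle _ _ x0))// lerD2r ltW// ball_pt_lt.
have [C C0 hC] := mean_expansion mu_unif z k12 s0 a_def B0.
have bL := bmeas_test_lap x0 L0 k z s0.
have [_ [ML hML]] := bL; have [_ [Mu hMu]] := bu.
have Mu0 : 0 <= Mu by exact: le_trans (hMu 0).
have ak : 0 < a * k.+2%:R by rewrite mulr_gt0.
(* Below 1 the Taylor expansion applies and [U] is bounded by [Mu + 1]; below the second value a
   translation by [delta] stays in the ball. *)
pose r := Num.min 1 (L - (enorm (z - x0) + Num.sqrt sigma)).
apply: (@le_linear_eq0 _ _ (ML + (Mu + 1) * C / (a * k.+2%:R)) r).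
  by rewrite lt_min ltr01 subr_gt0.
move=> t /andP[t0]; rewrite lt_min => /andP[t1 tr].
have [U [delta [bU /andP[d0 dt] mvp Uu]]] := approx t t0.
have bUp : bmeas (fun v : bV => U (pt v)).
  exact: (bmeas_comp bU (measurable_ball_pt x0 L)).
have bt := bmeas_test k z s0.
have btp : bmeas (fun v : bV => test k sigma z (pt v)).
  exact: (bmeas_comp bt (measurable_ball_pt x0 L)).
have disc : Iball (fun y => U y *
    (Ex mu (fun v : bV => test k sigma z (y + (- delta) *: clip v)) - test k sigma z y)) = 0.
  by apply: (discrete_weak mu_unif L0 k s0 bU (ltW d0) mvp); lra.
pose K := a * k.+2%:R.
pose E y := Ex mu (fun v : bV => test k sigma z (y + (- delta) *: clip v)) - test k sigma z y.
have bE : bmeas (fun v : bV => E (pt v)).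
  apply: bmeasB => //.
  have bj : bmeas (fun p : bV * bV => test k sigma z (pt p.1 + (- delta) *: clip p.2)).
    have bpt : measurable_fun setT ((fun p => (pt p.1, p.2)) : bV * bV -> bV * bV).
      apply: measurable_fun_pair; last exact: measurable_snd.
      exact: (measurableT_comp (measurable_ball_pt x0 L) measurable_fst).
    exact: (bmeas_comp bt (measurableT_comp (@measurable_add_clip R N (- delta)) bpt)).
  exact: (bmeas_Ex1 mu mu bj).
have bUL : bmeas (fun v : bV => U (pt v) * test_lap k sigma z (pt v)) by exact: bmeasM.
have UM v : `|U (pt v)| <= Mu + 1.
  rewrite -[U _](subrK (u (pt v))) (le_trans (ler_normD _ _))// addrC lerD ?hMu//.
  by rewrite (le_trans (ltW (Uu _ _)) (ltW t1))// ball_pt_lt.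
have hU : `|Iball (fun y => U y * test_lap k sigma z y)| <= (Mu + 1) * C / K * t.
  have bd : bmeas (fun v : bV => U (pt v) * (E (pt v) - delta ^+ 2 * (K * test_lap k sigma z (pt v)))).
    by apply: bmeasM => //; apply: bmeasB => //; do 2 apply: bmeasZ.
  have e1 : `|Ex mu (fun v : bV => U (pt v) * (E (pt v) - delta ^+ 2 * (K * test_lap k sigma z (pt v))))|
      <= (Mu + 1) * (C * delta ^+ 3).
    apply: norm_Ex_le => // v; rewrite normrM ler_pM//.
    by apply: hC => //; rewrite (ltW d0)/=; lra.
  have e2 : Ex mu (fun v : bV => U (pt v) * (E (pt v) - delta ^+ 2 * (K * test_lap k sigma z (pt v))))
      = - (delta ^+ 2 * K) * Iball (fun y => U y * test_lap k sigma z y).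
    rewrite -ExZ// -[RHS]add0r -disc -ExD//; [|exact: bmeasM|exact: bmeasZ].
    by apply: eq_Ex => v; rewrite /E; ring.
  move: e1; rewrite e2; set I := Iball _.
  rewrite (_ : - (delta ^+ 2 * K) * I = - (delta ^+ 2 * (K * I))); last by ring.
  rewrite normrN normrM (gtr0_norm (_ : 0 < delta ^+ 2)) ?exprn_gt0//.
  rewrite [`|K * I|]normrM (gtr0_norm ak).
  rewrite (_ : (Mu + 1) * (C * delta ^+ 3) = delta ^+ 2 * ((Mu + 1) * C * delta)); last by ring.
  rewrite ler_pM2l ?exprn_gt0// => e1.
  have MC0 : 0 <= (Mu + 1) * C by nng.
  rewrite mulrAC ler_pdivlMr// mulrC (le_trans e1)// ler_wpM2l// ltW//.
have bduL : bmeas (fun v : bV => (u (pt v) - U (pt v)) * test_lap k sigma z (pt v)).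
  by apply: bmeasM => //; exact: bmeasB.
have split_u : Iball (fun y => u y * test_lap k sigma z y) =
    Ex mu (fun v : bV => (u (pt v) - U (pt v)) * test_lap k sigma z (pt v)) +
    Iball (fun y => U y * test_lap k sigma z y).
  by rewrite -ExD//; apply: eq_Ex => v; ring.
rewrite split_u [leRHS]mulrDl; apply: le_trans (ler_normD _ _) _; apply: lerD => //.
apply: norm_Ex_le => // v; rewrite mulrC normrM ler_pM//.
by rewrite distrC ltW// Uu// ball_pt_lt.
Qed.

End Representation.

(** * Weighted averages as functions of the level *)

Section LevelIntegrals.
Context {R : realType} {N : nat} (mu : probability (borelV R N) R).
Hypothesis mu_unif : unif_law mu.
Hypothesis N0 : (0 < N)%N.
Local Notation V := 'rV[R]_N.
Local Notation bV := (borelV R N).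
Implicit Types (v y z : V).
Variables (x0 : V) (L : R).
Hypothesis L0 : 0 < L.
Local Notation pt := (ball_pt x0 L).

(** The numerator of a weighted average over the ball of radius [Num.sqrt sigma] about [z]. The
    domain of integration is fixed and only the weight depends on [z], which is what makes
    differentiation in [z] possible. *)
Definition level (u : V -> R) j sigma z : R :=
  Iball mu x0 L (fun y => u y * pp j (sigma - dot (y - z) (y - z))).

Lemma bmeas_level (u : V -> R) j sigma z : bmeas (fun v : bV => u (pt v)) ->
  0 <= sigma ->
  bmeas (fun v : bV => u (pt v) * pp j (sigma - dot (pt v - z) (pt v - z))).
Proof.
move=> bu s0; apply: bmeasM => //; split.
  exact: (measurable_pp_dot j sigma z (measurable_ball_pt x0 L)).
by exists (sigma ^+ j) => v; rewrite pp_norm// sub_dot_le.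
Qed.

(* Test weak harmonicity against the profile of exponent 4, and use
   [|y|^2 = sigma - (sigma - |y|^2)]. *)
Lemma level_relation (u : V -> R) sigma z : mean_value_limit mu x0 L u ->
  0 < sigma -> enorm (z - x0) + Num.sqrt sigma < L ->
  (N%:R + 6) * level u 3 sigma z = 6 * sigma * level u 2 sigma z.
Proof.
move=> mvl s0 room; have [bu _] := mvl.
have := weak_harmonic mu_unif N0 L0 mvl (or_intror erefl) s0 room.
have b j := bmeas_level j z bu (ltW s0).
rewrite (_ : Iball _ _ _ _ = Ex mu (fun v : bV =>
   (- (N%:R + 6)) * (u (pt v) * pp 3 (sigma - dot (pt v - z) (pt v - z))) +
   (6 * sigma) * (u (pt v) * pp 2 (sigma - dot (pt v - z) (pt v - z))))).
  rewrite ExD//; [|exact: bmeasZ|exact: bmeasZ].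
  by rewrite ExZ// ExZ// /level /Iball; lra.
apply: eq_Ex => v; rewrite /test_lap -ppS; ring.
Qed.

Lemma level_taylor (u : V -> R) (b : R) z : bmeas (fun v : bV => u (pt v)) ->
  exists2 C : R, 0 <= C & forall s h, 0 <= s <= b -> 0 <= s + h <= b ->
  `|level u 3 (s + h) z - level u 3 s z - 3 * h * level u 2 s z| <= C * h ^+ 2.
Proof.
move=> bu; have [C C0 hC] := @pp_taylor1 R 2 b (or_intror erefl).
have [_ [M hM]] := bu.
have M0 : 0 <= M by exact: le_trans (hM 0).
exists (M * C); first exact: mulr_ge0.
move=> s h /andP[s0 sb] /andP[h0 hb].
have B j t := @bmeas_level u j t z bu.
rewrite (_ : _ - _ - _ = Ex mu (fun v : bV => u (pt v) *
    (pp 3 (s - dot (pt v - z) (pt v - z) + h) - pp 3 (s - dot (pt v - z) (pt v - z))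
    - 3 * h * pp 2 (s - dot (pt v - z) (pt v - z))))); last first.
  rewrite /level /Iball -ExZ; last exact: B.
  rewrite -ExB; [|exact: B|exact: B].
  rewrite -ExB; [|by apply: bmeasB; exact: B|by apply: bmeasZ; exact: B].
  by apply: eq_Ex => v; rewrite (addrAC s h); ring.
apply: norm_Ex_le.
  have := bmeasB (bmeasB (B 3%N _ h0) (B 3%N _ s0)) (bmeasZ (3 * h) (B 2%N _ s0)).
  by congr bmeas; apply/funext => v; rewrite (addrAC s h); ring.
move=> v; rewrite normrM -[leRHS]mulrA; apply: ler_pM => //.
apply: hC; first by rewrite (le_trans (sub_dot_le _ _)).
by rewrite addrAC (le_trans (sub_dot_le _ _)).
Qed.

(** Translating by [x0 - z] carries one weight to the other, and [room] keeps both supports in the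
    ball. The normaliser thus becomes a constant in the representation of [u]. *)
Lemma level_const_indep sigma z : 0 <= sigma -> enorm (z - x0) + Num.sqrt sigma < L ->
  level (fun=> 1) 3 sigma z = level (fun=> 1) 3 sigma x0.
Proof.
move=> s0 room.
pose h y : R := 1 * pp 3 (sigma - dot (y - x0) (y - x0)).
have bh : bmeas (h : bV -> R).
  apply: bmeasZ; split.
    exact: (@measurable_pp_dot R N 3 sigma x0 _ bV _ (@measurable_id _ bV setT)).
  by exists (sigma ^+ 3) => y; rewrite pp_norm// sub_dot_le.
rewrite /level -[RHS](@Iball_shift R N mu mu_unif x0 L L0 (x0 - z) h bh).
  by apply: eq_Ex => v; rewrite /h addrA addrAC addrK.
move=> y; rewrite /h mul1r => hy.
have yr : enorm (y - x0) <= Num.sqrt sigma.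
  move: hy; have [q0|q0] := leP (sigma - dot (y - x0) (y - x0)) 0.
    by rewrite pp_neg ?eqxx.
  by move=> _; rewrite enormE ler_sqrt// -subr_ge0 ltW.
split.
  by apply: le_lt_trans room; rewrite (le_trans yr)// lerDr enorm_ge0.
apply: le_lt_trans room; rewrite opprB addrA.
rewrite (_ : y + z - x0 - x0 = (y - x0) + (z - x0)); last by rewrite addrACA -!addrA.
by rewrite (le_trans (enormD _ _))// addrC lerD2l.
Qed.

Lemma level_const_le a b z : 0 <= a -> a <= b ->
  level (fun=> 1) 3 a z <= level (fun=> 1) 3 b z.
Proof.
move=> a0 ab; apply: le_Ex.
- by apply: (@bmeas_level (fun=> 1)) => //; exact: bmeas_cst.
- by apply: (@bmeas_level (fun=> 1)); [exact: bmeas_cst|exact: le_trans ab].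
- move=> v; rewrite !mul1r /pp; apply: lerXn2r; rewrite ?nnegrE.
  + by rewrite le_max lexx orbT.
  + by rewrite le_max lexx orbT.
  + by rewrite ge_max !le_max lerD2r ab lexx orbT.
Qed.

Lemma level_const_gt0 sigma z : 0 < sigma -> enorm (z - x0) + Num.sqrt sigma < L ->
  0 < level (fun=> 1) 3 sigma z.
Proof.
move=> s0 room; rewrite level_const_indep ?(ltW s0)//.
(* Scaled by [L], the ball of radius [r] lies in that of radius [Num.sqrt (sigma / 2)], where the
   weight is at least [(sigma / 2) ^+ 3]; [r <= 1] makes [clip] the identity on it. *)
pose r := Num.min 1 (Num.sqrt (sigma / 2) / L).
have r0 : 0 < r by rewrite lt_min ltr01 divr_gt0// sqrtr_gt0 divr_gt0.
pose A : set V := [set v | enorm v < r].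
have mA : measurable (A : set bV).
  apply: open_measurableV; have := @open_eball R N 0 r; congr open; apply/seteqP.
  by split=> x; rewrite /= subr0.
have A0 : 0 < fine (mu A).
  apply: fine_gt0; rewrite (unif_law_small_ball mu_unif r0) /=.
  by apply: (le_lt_trans (probability_le1 _ mA)); rewrite ltry.
apply: (@lt_le_trans _ _ ((sigma / 2) ^+ 3 * fine (mu A))).
  by rewrite mulr_gt0// exprn_gt0// divr_gt0.
rewrite -Ex_indic// -ExZ; last exact: bmeas_indic.
apply: le_Ex; first by apply: bmeasZ; exact: bmeas_indic.
  by apply: (@bmeas_level (fun=> 1)); [exact: bmeas_cst|exact: ltW].
move=> v; rewrite indicE mul1r; case: (boolP (v \in _)); last by rewrite mulr0 pp_ge0.
rewrite inE /A /= lt_min => /andP[v1 vr]; rewrite mulr1.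
have : dot (pt v - x0) (pt v - x0) < sigma / 2.
  rewrite -enorm_sqr /ball_pt addrAC subrr add0r /clip v1 enormZ gtr0_norm//.
  rewrite -[ltRHS]sqr_sqrtr ?divr_ge0 ?(ltW s0)// ltr_pXn2r ?nnegrE ?mulr_ge0 ?enorm_ge0 ?(ltW L0) ?sqrtr_ge0//.
  by rewrite mulrC -ltr_pdivlMr.
move=> vv; rewrite pp_pos; last by lra.
by rewrite lerXn2r ?nnegrE//; lra.
Qed.

(* By [level_relation], the [sigma]-derivative [3 level u 2] of [level u 3] is the
   same multiple of [level u 3] for [u] and for [1]: the ratio is constant. *)
Lemma level_ratio_cst (u : V -> R) a b z : mean_value_limit mu x0 L u ->
  0 < a -> a <= b -> enorm (z - x0) + Num.sqrt b < L ->
  level u 3 a z / level (fun=> 1) 3 a z = level u 3 b z / level (fun=> 1) 3 b z.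
Proof.
move=> mvl a0 ab room; have [bu _] := mvl.
have mvl1 := mean_value_limit_cst mu x0 L 1.
have b1 : bmeas (fun v : bV => 1 : R) by exact: bmeas_cst.
have [_ [M hM]] := bu; have M0 : 0 <= M by exact: le_trans (hM 0).
have [C C0 hC] := level_taylor b z bu.
have [C1 C10 hC1] := @level_taylor (fun=> 1) b z b1.
have b0 : 0 < b by exact: lt_le_trans ab.
have roomle s : s <= b -> enorm (z - x0) + Num.sqrt s < L.
  by move=> sb; apply: le_lt_trans room; rewrite lerD2l ler_wsqrtr.
have na : 0 < level (fun=> 1) 3 a z by apply: level_const_gt0 => //; exact: roomle.
set n3 := level (fun=> 1) 3; set m3 := level u 3.
(* [n3] is nondecreasing in the level: its value at [a] bounds the denominators from below, its
   value at [b] the numerator from above. *)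
pose K := (C * n3 b z + M * b ^+ 3 * C1) / n3 a z ^+ 2.
apply: (@quadratic_increment_cst R (fun s => m3 s z / n3 s z) a b K) => // s h as_ h0 shb.
have s0 : 0 < s by exact: lt_le_trans as_.
have sb : s <= b by apply: le_trans shb; rewrite lerDl.
have ns : n3 a z <= n3 s z by apply: level_const_le => //; exact: ltW.
have nsh : n3 a z <= n3 (s + h) z.
  by apply: level_const_le; [exact: ltW|rewrite (le_trans as_)// lerDl].
have nb : n3 s z <= n3 b z by apply: level_const_le => //; exact: ltW.
have ns0 := lt_le_trans na ns; have nsh0 := lt_le_trans na nsh.
have sI : 0 <= s <= b by rewrite (ltW s0).
have shI : 0 <= s + h <= b by rewrite shb addr_ge0// ltW.
have e1 := hC s h sI shI; have e2 := hC1 s h sI shI.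
have r1 := level_relation mvl s0 (roomle _ sb).
have r2 := level_relation mvl1 s0 (roomle _ sb).
have m3b : `|m3 s z| <= M * b ^+ 3.
  apply: norm_Ex_le; first by apply: bmeas_level => //; exact: ltW.
  move=> v; rewrite normrM ler_pM// pp_norm// ?(ltW b0)//.
  exact: le_trans (sub_dot_le _ _) sb.
(* The first-order part of the increment of the quotient is proportional to the difference of these
   two sides, so only a quadratic increment remains. *)
have cross : level u 2 s z * n3 s z = m3 s z * level (fun=> 1) 2 s z.
  have N6 : (N%:R + 6 : R) != 0 by rewrite gt_eqF// ltr_wpDl.
  apply: (mulfI N6); rewrite /m3 /n3 mulrCA r2 [RHS]mulrA r1; ring.
have -> : m3 (s + h) z / n3 (s + h) z - m3 s z / n3 s z =
   (n3 s z * (m3 (s + h) z - m3 s z - 3 * h * level u 2 s z)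
   - m3 s z * (n3 (s + h) z - n3 s z - 3 * h * level (fun=> 1) 2 s z)) / (n3 (s + h) z * n3 s z).
  apply: (@mulIf _ (n3 (s + h) z * n3 s z)); first by rewrite mulf_neq0 ?gt_eqF.
  rewrite divfK; last by rewrite mulf_neq0 ?gt_eqF.
  rewrite mulrBl mulrA divfK ?gt_eqF// [n3 (s + h) z * n3 s z]mulrC mulrA divfK ?gt_eqF//.
  have -> : n3 s z * (m3 (s + h) z - m3 s z - 3 * h * level u 2 s z) =
    n3 s z * (m3 (s + h) z - m3 s z) - 3 * h * (level u 2 s z * n3 s z) by ring.
  rewrite cross; ring.
rewrite normrM normfV (gtr0_norm (mulr_gt0 nsh0 ns0)) ler_pdivrMr ?mulr_gt0//.
have num : `|n3 s z * (m3 (s + h) z - m3 s z - 3 * h * level u 2 s z)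
   - m3 s z * (n3 (s + h) z - n3 s z - 3 * h * level (fun=> 1) 2 s z)|
   <= (C * n3 b z + M * b ^+ 3 * C1) * h ^+ 2.
  apply: le_trans (ler_normB _ _) _; rewrite [leRHS]mulrDl; apply: lerD.
    rewrite normrM (gtr0_norm ns0) (_ : C * n3 b z * h ^+ 2 = n3 b z * (C * h ^+ 2)); last by ring.
    by apply: ler_pM => //; exact: ltW.
  by rewrite normrM -[leRHS]mulrA; apply: ler_pM.
apply: le_trans num _.
set Q := C * _ + _; rewrite -/Q in K *.
have Q0 : 0 <= Q.
  apply: addr_ge0; apply: mulr_ge0 => //; first exact: le_trans (ltW ns0) nb.
  by apply: mulr_ge0 => //; apply: exprn_ge0; exact: ltW.
have -> : K * h ^+ 2 * (n3 (s + h) z * n3 s z) = Q * h ^+ 2 * ((n3 (s + h) z * n3 s z) / n3 a z ^+ 2).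
  by rewrite /K; ring.
rewrite ler_peMr ?mulr_ge0 ?sqr_ge0// ler_pdivlMr ?exprn_gt0// mul1r expr2.
by apply: ler_pM => //; exact: ltW.
Qed.

(** The normalised average at level [b] equals that at any smaller level, and at a small level the
    weight only sees values of [u] close to [u z]. *)
Lemma level_representation (u : V -> R) b z : mean_value_limit mu x0 L u ->
  {for z, continuous u} -> 0 < b -> enorm (z - x0) + Num.sqrt b < L ->
  u z = (level (fun=> 1) 3 b x0)^-1 * level u 3 b z.
Proof.
move=> mvl cu b0 room; have [bu _] := mvl.
rewrite -(level_const_indep (ltW b0) room) mulrC; apply/eqP; rewrite -subr_eq0; apply/eqP.
apply: (@le_linear_eq0 _ _ 1 1) => // e /andP[e0 _]; rewrite mul1r.
have /nbhs_eball[r r0 hr] : nbhs z [set y | `|u z - u y| < e].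
  exact: (cu _ (nbhsx_ballx (u z) e e0)).
(* At this level the weight is supported in the ball of radius [r] about [z], where [u] differs from
   [u z] by less than [e]. *)
pose a := Num.min b (r ^+ 2 / 2).
have a0 : 0 < a by rewrite lt_min b0 divr_gt0// exprn_gt0.
have ab : a <= b by rewrite ge_min lexx.
have rooma : enorm (z - x0) + Num.sqrt a < L.
  by apply: le_lt_trans room; rewrite lerD2l ler_wsqrtr.
rewrite -(level_ratio_cst mvl a0 ab room).
have n0 := level_const_gt0 a0 rooma.
have -> : u z - level u 3 a z / level (fun=> 1) 3 a z =
    (u z * level (fun=> 1) 3 a z - level u 3 a z) / level (fun=> 1) 3 a z.
  by rewrite mulrBl mulfK// gt_eqF.
rewrite normrM normfV (gtr0_norm n0) ler_pdivrMr//.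
have b1 : bmeas (fun v : bV => 1 * pp 3 (a - dot (pt v - z) (pt v - z))).
  by apply: (@bmeas_level (fun=> 1)) => //; [exact: bmeas_cst|exact: ltW].
have b2 := bmeas_level 3 z bu (ltW a0).
have -> : u z * level (fun=> 1) 3 a z - level u 3 a z =
    Ex mu (fun v : bV => (u z - u (pt v)) * pp 3 (a - dot (pt v - z) (pt v - z))).
  rewrite /level /Iball -ExZ// -ExB//; last exact: bmeasZ.
  by apply: eq_Ex => v; ring.
have bd : bmeas (fun v : bV => (u z - u (pt v)) * pp 3 (a - dot (pt v - z) (pt v - z))).
  have := bmeasB (bmeasZ (u z) b1) b2.
  by congr bmeas; apply/funext => v; ring.
have key v : `|(u z - u (pt v)) * pp 3 (a - dot (pt v - z) (pt v - z))|
    <= e * (1 * pp 3 (a - dot (pt v - z) (pt v - z))).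
  rewrite normrM mul1r (ger0_norm (pp_ge0 _ _)).
  have [q0|q0] := leP (a - dot (pt v - z) (pt v - z)) 0; first by rewrite pp_neg ?mulr0.
  rewrite ler_wpM2r ?pp_ge0// ltW//; apply: hr => /=.
  rewrite -(@ltr_pXn2r _ 2)// ?nnegrE ?enorm_ge0 ?(ltW r0)// enorm_sqr.
  have : a <= r ^+ 2 / 2 by rewrite ge_min lexx orbT.
  have : 0 < r ^+ 2 by exact: exprn_gt0.
  lra.
rewrite /level /Iball -ExZ// ler_norml -mulN1r -ExZ; last exact: bmeasZ.
by apply/andP; split; apply: le_Ex => //; do ?[exact: bmeasZ|do 2 apply: bmeasZ => //];
  move=> v; have := key v; rewrite ler_norml => /andP[]; rewrite ?mulN1r.
Qed.

End LevelIntegrals.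

(** * Differentiation of the representation under the integral *)

Section QuadraticDerivative.
Context {R : realType} {N : nat}.
Local Notation V := 'rV[R]_N.

Lemma derive_quadratic (f : V -> R) (a v : V) (df C : R) :
  (forall t, `|t| <= 1 -> `|f (a + t *: v) - f a - t * df| <= C * t ^+ 2) ->
  derivable f a v /\ 'D_v f a = df.
Proof.
move=> hC.
have cv : h^-1 *: ((f \o shift a) (h *: v) - f a) @[h --> (0 : R)^'] --> df.
  apply/cvgrPdist_lt => e e0.
  pose K := `|C| + 1; have K0 : 0 < K by rewrite ltr_pwDr.
  near=> h.
  have hn0 : h != 0 by near: h; exact: nbhs_dnbhs_neq.
  have h1 : `|h| <= 1.
    near: h; apply: dnbhs0_le; exact: ltr01.
  have hK : `|h| < e / K.
    near: h; apply: dnbhs0_lt; exact: divr_gt0.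
  have h0 : 0 < `|h| by rewrite normr_gt0.
  rewrite /= distrC -(ltr_pM2l h0) -normrM mulrBr /GRing.scale /= mulrA divff// mul1r (addrC _ a).
  apply: (le_lt_trans (hC h h1)).
  rewrite -(real_normK (num_real h)) expr2 mulrCA ltr_pM2l//.
  apply: (@le_lt_trans _ _ (K * `|h|)).
    by rewrite ler_wpM2r// /K (le_trans (ler_norm C))// lerDl.
  by rewrite mulrC -ltr_pdivlMr.
split; first by apply/cvg_ex; exists df.
exact: cvg_lim.
Unshelve. all: by end_near. Qed.

End QuadraticDerivative.

Section HarmonicRepresentation.
Context {R : realType} {N : nat} (mu : probability (borelV R N) R).
Hypothesis mu_unif : unif_law mu.
Hypothesis N0 : (0 < N)%N.
Local Notation V := 'rV[R]_N.
Local Notation bV := (borelV R N).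
Implicit Types (v y z : V) (i j : 'I_N).
Variables (x0 : V) (L : R).
Hypothesis L0 : 0 < L.
Local Notation pt := (ball_pt x0 L).
Variable u : V -> R.
Hypothesis bu : bmeas (fun v : bV => u (pt v)).

(** A remainder quadratic in [t], uniform over the points of integration, stays quadratic after
    multiplication by the bounded [u] and averaging. *)
Lemma derive_Iball (k k' : V -> V -> R) (c : R) z e (C : R) :
  (forall z', bmeas (fun v : bV => k (pt v) z')) ->
  bmeas (fun v : bV => k' (pt v) z) ->
  (forall v t, `|t| <= 1 ->
    `|k (pt v) (z + t *: e) - k (pt v) z - t * k' (pt v) z| <= C * t ^+ 2) ->
  derivable (fun z => c * Iball mu x0 L (fun y => u y * k y z)) z e /\
  'D_e (fun z => c * Iball mu x0 L (fun y => u y * k y z)) z =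
    c * Iball mu x0 L (fun y => u y * k' y z).
Proof.
move=> bk bk' hC; have [_ [M hM]] := bu.
have M0 : 0 <= M by exact: le_trans (hM 0).
apply: (@derive_quadratic _ _ _ _ _ _ (`|c| * (M * C))) => t t1.
have b0 z' : bmeas (fun v : bV => u (pt v) * k (pt v) z') by exact: bmeasM.
have b1 : bmeas (fun v : bV => u (pt v) * k' (pt v) z) by exact: bmeasM.
have -> : c * Iball mu x0 L (fun y => u y * k y (z + t *: e)) -
    c * Iball mu x0 L (fun y => u y * k y z) -
    t * (c * Iball mu x0 L (fun y => u y * k' y z)) =
  c * Ex mu (fun v : bV => u (pt v) * (k (pt v) (z + t *: e) - k (pt v) z - t * k' (pt v) z)).
  transitivity (c * (Iball mu x0 L (fun y => u y * k y (z + t *: e)) -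
    Iball mu x0 L (fun y => u y * k y z) -
    t * Iball mu x0 L (fun y => u y * k' y z))); first by ring.
  congr (c * _); rewrite /Iball -ExZ// -ExB// -ExB//; [|exact: bmeasB|exact: bmeasZ].
  by apply: eq_Ex => v; ring.
rewrite normrM -mulrA ler_wpM2l//; apply: norm_Ex_le.
  by apply: bmeasM => //; apply: bmeasB; [exact: bmeasB|exact: bmeasZ].
by move=> v; rewrite normrM -mulrA ler_pM// hC.
Qed.

Lemma continuous_Iball (k : V -> V -> R) (c : R) z (C : R) :
  (forall z', bmeas (fun v : bV => k (pt v) z')) ->
  (forall v z', enorm (z' - z) <= 1 -> `|k (pt v) z' - k (pt v) z| <= C * enorm (z' - z)) ->
  {for z, continuous (fun z => c * Iball mu x0 L (fun y => u y * k y z))}.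
Proof.
move=> bk hC; have [_ [M hM]] := bu.
have M0 : 0 <= M by exact: le_trans (hM 0).
have b0 z' : bmeas (fun v : bV => u (pt v) * k (pt v) z') by exact: bmeasM.
apply/(@cvgrPdist_lt _ _ _ (_ @ nbhs z)) => e e0.
pose K := `|c * (M * C)| + 1.
have K0 : 0 < K by rewrite ltr_pwDr.
apply/nbhs_eball; exists (Num.min 1 (e / K)); first by rewrite lt_min ltr01 divr_gt0.
move=> z'; rewrite /= lt_min => /andP[z1 zK].
rewrite distrC -mulrBr /Iball -ExB//.
apply: (@le_lt_trans _ _ (`|c| * (M * (C * enorm (z' - z))))).
  rewrite normrM ler_wpM2l//; apply: norm_Ex_le; first exact: bmeasB.
  move=> v; rewrite -mulrBr normrM; apply: ler_pM => //.
  by apply: hC; exact: ltW.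
apply: (@le_lt_trans _ _ (K * enorm (z' - z))).
  rewrite !mulrA ler_wpM2r ?enorm_ge0// /K -mulrA.
  rewrite (le_trans (ler_norm _))// !normrM normr_id lerDl//.
by rewrite mulrC -ltr_pdivlMr.
Qed.

End HarmonicRepresentation.

Section KernelDerivatives.
Context {R : realType} {N : nat}.
Local Notation V := 'rV[R]_N.
Local Notation bV := (borelV R N).
Implicit Types (v y z : V) (i j : 'I_N).
Variable b : R.
Hypothesis b0 : 0 < b.

(** Derivatives are taken in the centre [z], which explains the signs of [ker1] and [ker2]. Exponent
    3 is the least one in this family whose second derivatives are continuous. *)
Definition ker0 y z : R := pp 3 (b - dot (y - z) (y - z)).

Definition ker1 i y z : R := 6 * (y - z) ord0 i * pp 2 (b - dot (y - z) (y - z)).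

Definition ker2 i j y z : R :=
  24 * (y - z) ord0 i * (y - z) ord0 j * pp 1 (b - dot (y - z) (y - z)) -
  6 * (i == j)%:R * pp 2 (b - dot (y - z) (y - z)).

Let dot_incr (a : V) t i : dot a (- (t *: evec R i)) = - (t * a ord0 i).
Proof. by rewrite dotNr dotZr dot_evec. Qed.

Let enorm_incr t i : enorm (- (t *: evec R i)) = `|t|.
Proof. by rewrite enormN enormZ enorm_evec mulr1. Qed.

Let coord_incr (a : V) t i j :
  (a + - (t *: evec R j)) ord0 i = a ord0 i - t * (i == j)%:R.
Proof. by rewrite !mxE eqxx. Qed.

Let sub_incr y z t i : y - (z + t *: evec R i) = (y - z) + - (t *: evec R i).
Proof. by rewrite opprD addrA. Qed.

Lemma ker0_taylor (B : R) i : 0 <= B -> exists C : R, forall y z t,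
  enorm (y - z) <= B -> `|t| <= 1 ->
  `|ker0 y (z + t *: evec R i) - ker0 y z - t * ker1 i y z| <= C * t ^+ 2.
Proof.
move=> B0; have [C C0 hC] := @ker_taylor1 R N 2 b B (or_intror erefl) (ltW b0) B0.
exists C => y z t yB t1; have := hC (y - z) (- (t *: evec R i)) yB.
rewrite enorm_incr dot_incr => /(_ t1); rewrite real_normK ?num_real//.
rewrite /ker0 /ker1 sub_incr.
move: (pp 3 (b - dot (_ + _) _)) (pp 3 _) (pp 2 _) ((y - z) ord0 i) => p p0 p1 c.
by congr (_ <= _); congr (`|_|); ring.
Qed.

Lemma ker1_taylor (B : R) i j : 0 <= B -> exists C : R, forall y z t,
  enorm (y - z) <= B -> `|t| <= 1 ->
  `|ker1 i y (z + t *: evec R j) - ker1 i y z - t * ker2 i j y z| <= C * t ^+ 2.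
Proof.
move=> B0; have [C C0 hC] := @ker_taylor1 R N 1 b B (or_introl erefl) (ltW b0) B0.
exists (6 * B * C + 6 * (C + 4 * B * b)) => y z t yB t1.
have := hC (y - z) (- (t *: evec R j)) yB.
rewrite enorm_incr dot_incr => /(_ t1); rewrite real_normK ?num_real//.
rewrite /ker1 /ker2 sub_incr.
set w := - (t *: evec R j); set a := y - z.
set A := pp 2 (b - dot (a + w) (a + w)); set A0 := pp 2 (b - dot a a).
set A1 := pp 1 (b - dot a a).
rewrite (coord_incr a) => hA.
have {}hA : `|A - A0 - 4 * t * a ord0 j * A1| <= C * t ^+ 2.
  by move: hA; congr (_ <= _); congr (`|_|); ring.
pose d : R := (i == j)%:R.
have -> : 6 * (a ord0 i - t * (i == j)%:R) * A - 6 * a ord0 i * A0 -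
    t * (24 * a ord0 i * a ord0 j * A1 - 6 * (i == j)%:R * A0) =
  6 * a ord0 i * (A - A0 - 4 * t * a ord0 j * A1)
  - 6 * (d * (t * (A - A0 - 4 * t * a ord0 j * A1) + 4 * a ord0 j * A1 * t ^+ 2)).
  by rewrite /d; ring.
have al l : `|a ord0 l| <= B by rewrite (le_trans (coord_le _ _)).
have d1 : `|d| <= 1 by rewrite /d; case: (i == j); rewrite ?normr1 ?normr0.
have A1b : `|A1| <= b.
  by have := pp_norm 1 (ltW b0) (sub_dot_le b a); rewrite expr1.
apply: le_trans (ler_normB _ _) _; rewrite [leRHS]mulrDl; apply: lerD.
  rewrite normrM -[leRHS]mulrA; apply: ler_pM => //.
  by rewrite normrM ger0_norm// ler_wpM2l.
rewrite normrM ger0_norm// -[leRHS]mulrA ler_wpM2l//.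
rewrite normrM -[leRHS]mul1r; apply: ler_pM => //.
rewrite [leRHS]mulrDl; apply: le_trans (ler_normD _ _) _; apply: lerD.
  by rewrite normrM -[leRHS]mul1r; apply: ler_pM.
rewrite normrM (ger0_norm (sqr_ge0 t)) ler_wpM2r ?sqr_ge0//.
rewrite normrM; apply: ler_pM => //.
by rewrite normrM ger0_norm// ler_wpM2l.
Qed.

(** The positive part [pp 1] is 1-Lipschitz and [pp 2] has a first-order expansion; the rest is
    changing one factor of the products at a time on a bounded set. *)
Lemma ker2_lipschitz (B : R) i j : 0 <= B -> exists C : R, forall y z z',
  enorm (y - z) <= B -> enorm (z' - z) <= 1 ->
  `|ker2 i j y z' - ker2 i j y z| <= C * enorm (z' - z).
Proof.
move=> B0; have [C C0 hC] := @ker_taylor1 R N 1 b B (or_introl erefl) (ltW b0) B0.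
exists (24 * ((2 * B + 1) * b + (B * B) * (2 * B + 1)) + 6 * (C + 4 * B * b)).
move=> y z z' yB zz.
set w := z - z'; set a := y - z.
have wE : enorm (z' - z) = enorm w by rewrite /w enormB.
have w1 : enorm w <= 1 by rewrite -wE.
have aE : y - z' = a + w by rewrite /a /w addrA subrK.
rewrite wE /ker2 aE -/a.
have := hC a w yB w1.
have := pp1_lipschitz (b - dot a a) (- (2 * dot a w + dot w w)).
rewrite -sub_dot_add => /le_trans /(_ (norm_increment yB w1)).
set A := pp 2 (b - dot (a + w) (a + w)); set A0 := pp 2 (b - dot a a).
set D := pp 1 (b - dot (a + w) (a + w)); set D0 := pp 1 (b - dot a a).
move=> hD hA.
have aw l : (a + w) ord0 l = a ord0 l + w ord0 l by rewrite [LHS]mxE.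
rewrite !aw.
have al l : `|a ord0 l| <= B by rewrite (le_trans (coord_le _ _)).
have wl l : `|w ord0 l| <= enorm w by exact: coord_le.
have Db : `|D| <= b.
  by have := pp_norm 1 (ltW b0) (sub_dot_le b (a + w)); rewrite expr1.
have D0b : `|D0| <= b.
  by have := pp_norm 1 (ltW b0) (sub_dot_le b a); rewrite expr1.
have d1 : `|(i == j)%:R : R| <= 1 by case: (i == j); rewrite ?normr1 ?normr0.
have w0 := enorm_ge0 w.
have hA' : `|A - A0| <= (C + 4 * B * b) * enorm w.
  rewrite (_ : A - A0 = (A - A0 + 2 * 2%:R * dot a w * D0) - 4 * (dot a w * D0)); last by ring.
  apply: le_trans (ler_normB _ _) _; rewrite [leRHS]mulrDl; apply: lerD.
    apply: le_trans hA _; rewrite expr2 mulrA ler_piMr// mulr_ge0//.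
  rewrite normrM ger0_norm// -!mulrA ler_wpM2l// normrM [b * _]mulrC mulrA.
  apply: ler_pM => //; apply: le_trans (dot_le _ _) _.
  by rewrite ler_wpM2r.
have -> : 24 * (a ord0 i + w ord0 i) * (a ord0 j + w ord0 j) * D - 6 * (i == j)%:R * A -
    (24 * a ord0 i * a ord0 j * D0 - 6 * (i == j)%:R * A0) =
  24 * ((a ord0 i * w ord0 j + w ord0 i * a ord0 j + w ord0 i * w ord0 j) * D
     + a ord0 i * a ord0 j * (D - D0)) - 6 * ((i == j)%:R * (A - A0)) by ring.
apply: le_trans (ler_normB _ _) _; rewrite [leRHS]mulrDl; apply: lerD.
  rewrite normrM ger0_norm// -[leRHS]mulrA ler_wpM2l// [leRHS]mulrDl.
  apply: le_trans (ler_normD _ _) _; apply: lerD.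
    rewrite normrM [leRHS]mulrAC; apply: ler_pM => //.
    have -> : (2 * B + 1) * enorm w = B * enorm w + enorm w * B + enorm w by ring.
    apply: le_trans (ler_normD _ _) _; apply: lerD.
      apply: le_trans (ler_normD _ _) _; apply: lerD; rewrite normrM; exact: ler_pM.
    rewrite normrM -[leRHS]mulr1; apply: ler_pM => //.
    exact: le_trans (wl _) w1.
  rewrite normrM -[leRHS]mulrA; apply: ler_pM => //.
  by rewrite normrM; apply: ler_pM.
rewrite normrM ger0_norm// -[leRHS]mulrA ler_wpM2l//.
by rewrite normrM -[leRHS]mul1r; apply: ler_pM.
Qed.

End KernelDerivatives.

Section SmoothLimit.
Context {R : realType} {N : nat} (mu : probability (borelV R N) R).
Hypothesis mu_unif : unif_law mu.
Hypothesis N0 : (0 < N)%N.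
Local Notation V := 'rV[R]_N.
Local Notation bV := (borelV R N).
Implicit Types (v y z : V) (i j : 'I_N).
Variables (x0 : V) (L : R).
Hypothesis L0 : 0 < L.
Local Notation pt := (ball_pt x0 L).
Variable u : V -> R.
Hypothesis mvl : mean_value_limit mu x0 L u.
Hypothesis cu : forall z, enorm (z - x0) < L / 2 -> {for z, continuous u}.

Let bu : bmeas (fun v : bV => u (pt v)) := proj1 mvl.
(** Weights of radius [L / 4] centred in the ball of radius [L / 2] stay inside the ball of radius
    [L]. *)
Let b : R := (L / 4) ^+ 2.
Let c : R := (level mu x0 L (fun=> 1) 3 b x0)^-1.

Let b0 : 0 < b.
Proof. by rewrite exprn_gt0// divr_gt0. Qed.

Let sqrt_b : Num.sqrt b = L / 4.
Proof. by rewrite sqrtr_sqr gtr0_norm// divr_gt0. Qed.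

Let bpp k z : bmeas (fun v : bV => pp k (b - dot (pt v - z) (pt v - z))).
Proof.
split; first exact: (measurable_pp_dot k b z (measurable_ball_pt x0 L)).
by exists (b ^+ k) => v; rewrite pp_norm ?sub_dot_le// ltW.
Qed.

Let bcoord z i : bmeas (fun v : bV => (pt v - z) ord0 i).
Proof.
split.
  apply: (@measurable_coordX R N _ bV (fun v => pt v - z) i).
  apply: measurable_addV; first exact: measurable_ball_pt.
  exact: (@measurable_cst _ _ bV bV setT (- z)).
exists (L + enorm (x0 - z)) => v; rewrite (le_trans (coord_le _ _))//.
by rewrite (le_trans (enorm_triangle _ _ x0))// lerD2r ltW// ball_pt_lt.
Qed.

Let bker1 i z : bmeas (fun v : bV => ker1 b i (pt v) z).
Proof. by apply: bmeasM => //; apply: bmeasZ. Qed.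

Let bker2 i j z : bmeas (fun v : bV => ker2 b i j (pt v) z).
Proof.
apply: bmeasB; last exact: bmeasZ.
by do 2 apply: bmeasM => //; apply: bmeasZ.
Qed.

Let G0 z := c * Iball mu x0 L (fun y => u y * ker0 b y z).
Let G1 i z := c * Iball mu x0 L (fun y => u y * ker1 b i y z).
Let G2 i j z := c * Iball mu x0 L (fun y => u y * ker2 b i j y z).

Let u_G0 z : enorm (z - x0) < L / 2 -> u z = G0 z.
Proof.
move=> zL; rewrite /G0 /c; apply: (level_representation mu_unif N0 L0 mvl (cu zL) b0).
rewrite sqrt_b; move: zL L0; move: (enorm _) => p *; lra.
Qed.

Let ptB z v : enorm (z - x0) < L -> enorm (pt v - z) <= 2 * L.
Proof.
move=> zL; apply: le_trans (enorm_triangle _ _ x0) _.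
have := ball_pt_lt x0 L0 v; rewrite (enormB x0 z) => h.
by move: h zL; move: (enorm _) (enorm _) => p q *; lra.
Qed.

Let derive_G0 i z : enorm (z - x0) < L ->
  derivable G0 z (evec R i) /\ 'D_(evec R i) G0 z = G1 i z.
Proof.
move=> zL; have L2 : 0 <= 2 * L by rewrite mulr_ge0// ltW.
have [C hC] := @ker0_taylor R N b b0 (2 * L) i L2.
apply: (@derive_Iball R N mu x0 L u bu (ker0 b) (ker1 b i) c z (evec R i) C) => //.
  by move=> z'; exact: bpp.
by move=> v t t1; apply: hC => //; exact: ptB.
Qed.

Let derive_G1 i j z : enorm (z - x0) < L ->
  derivable (G1 i) z (evec R j) /\ 'D_(evec R j) (G1 i) z = G2 i j z.
Proof.
move=> zL; have L2 : 0 <= 2 * L by rewrite mulr_ge0// ltW.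
have [C hC] := @ker1_taylor R N b b0 (2 * L) i j L2.
apply: (@derive_Iball R N mu x0 L u bu (ker1 b i) (ker2 b i j) c z (evec R j) C) => //.
by move=> v t t1; apply: hC => //; exact: ptB.
Qed.

Let continuous_G2 i j z : enorm (z - x0) < L -> {for z, continuous (G2 i j)}.
Proof.
move=> zL; have L2 : 0 <= 2 * L by rewrite mulr_ge0// ltW.
have [C hC] := @ker2_lipschitz R N b b0 (2 * L) i j L2.
apply: (@continuous_Iball R N mu x0 L u bu (ker2 b i j) c z C) => //.
by move=> v z' z1; apply: hC => //; exact: ptB.
Qed.

Let half_lt z : enorm (z - x0) < L / 2 -> enorm (z - x0) < L.
Proof. by move=> zL; apply: (lt_trans zL); rewrite ltr_pdivrMr// ltr_pMr// ltr1n. Qed.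

Let near_half z (P : V -> Prop) : enorm (z - x0) < L / 2 ->
  (forall z', enorm (z' - x0) < L / 2 -> P z') -> \forall z' \near z, P z'.
Proof.
move=> zL hP; have := open_nbhs_nbhs (conj (@open_eball R N x0 (L / 2)) zL).
exact: filterS.
Qed.

(** Stated on the whole half ball and not only at [x0], since differentiating once more needs the
    formula near the point. *)
Let D1 i z : enorm (z - x0) < L / 2 -> 'D_(evec R i) u z = G1 i z.
Proof.
move=> zL; have [_ <-] := derive_G0 i (half_lt zL).
by apply: near_eq_derive; exact: near_half.
Qed.

Let D2 i j z : enorm (z - x0) < L / 2 ->
  'D_(evec R j) ('D_(evec R i) u) z = G2 i j z.
Proof.
move=> zL; have [_ <-] := derive_G1 i j (half_lt zL).
by apply: near_eq_derive; apply: near_half => // z' z'L; exact: D1.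
Qed.

Lemma mean_value_limit_harmonic :
  [/\ (forall i, derivable u x0 (evec R i)),
      (forall i j, derivable ('D_(evec R i) u) x0 (evec R j)),
      (forall i j, {for x0, continuous ('D_(evec R j) ('D_(evec R i) u))}) &
      \sum_(i < N) 'D_(evec R i) ('D_(evec R i) u) x0 = 0].
Proof.
have h0 : enorm (x0 - x0) < L / 2 by rewrite subrr enorm0 divr_gt0.
split.
- move=> i; have [h _] := derive_G0 i (half_lt h0).
  by apply: near_eq_derivable h; apply: near_half => // z zL; rewrite u_G0.
- move=> i j; have [h _] := derive_G1 i j (half_lt h0).
  by apply: near_eq_derivable h; apply: near_half => // z zL; rewrite D1.
- move=> i j; have : {for x0, continuous (G2 i j)} := @continuous_G2 i j x0 (half_lt h0).
  rewrite /prop_for /continuous_at -(D2 i j h0) => cG A /cG h.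
  have hn : \forall z \near x0, G2 i j z = 'D_(evec R j) ('D_(evec R i) u) z.
    by apply: near_half => // z zL; rewrite D2.
  by apply: (filterS2 _ _ hn h) => z /= <-.
rewrite (eq_bigr (fun i => G2 i i x0)); last by move=> i _; exact: D2.
have room : enorm (x0 - x0) + Num.sqrt b < L by rewrite subrr enorm0 sqrt_b add0r ltr_pdivrMr// ltr_pMr// ltr1n.
have wh := weak_harmonic mu_unif N0 L0 mvl (or_introl erefl) b0 room.
rewrite /G2 -mulr_sumr -Ex_sum; last by move=> i; exact: bmeasM.
rewrite (_ : Ex mu _ = 6 * Iball mu x0 L (fun y => u y * test_lap 1 b x0 y)).
  by rewrite wh !mulr0.
rewrite -ExZ; last by apply: bmeasM => //; exact: bmeas_test_lap.
apply: eq_Ex => v; rewrite -mulr_sumr.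
(* [ker0] depends on [y - z] only, so its Laplacians in [y] and in [z] agree; 6 is the factor
   [2 * k.+2] left out of [test_lap], for [k = 1]. *)
have -> : \sum_(i < N) ker2 b i i (pt v) x0 = 6 * test_lap 1 b x0 (pt v).
  rewrite /ker2 /test_lap; set p1 := pp 1 _; set p2 := pp 2 _.
  rewrite sumrB -mulr_suml.
  rewrite (eq_bigr (fun i => 24 * ((pt v - x0) ord0 i * (pt v - x0) ord0 i))); last by move=> i _; rewrite mulrA.
  rewrite -mulr_sumr -/(dot (pt v - x0) (pt v - x0)).
  rewrite (eq_bigr (fun=> 6 * p2)); last by move=> i _; rewrite eqxx mulr1.
  by rewrite sumr_const card_ord -[X in _ - X]mulr_natr; ring.
by ring.
Qed.

End SmoothLimit.

(** * The law of the walk *)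

Section SequenceSpace.
Context {R : realType} {N : nat}.
Local Notation V := 'rV[R]_N.
Local Notation bV := (borelV R N).

(** Constraining an initial segment of coordinates, not an arbitrary finite set, makes prepending a
    coordinate turn [n] into [n.+1]. *)
Definition cylinder (n : nat) (A : nat -> set V) : set (nat -> V) :=
  [set s | forall i, (i < n)%N -> A i (s i)].

Definition cylinders : set (set (nat -> V)) :=
  [set C | exists n, exists2 A, (forall i, open (A i)) & C = cylinder n A].

Definition seqV := g_sigma_algebraType cylinders.

Lemma cylinders_setI : setI_closed cylinders.
Proof.
move=> _ _ [n [A oA ->]] [m [B oB ->]]; exists (maxn n m).
exists (fun i => (if (i < n)%N then A i else setT) `&` (if (i < m)%N then B i else setT)).
  by move=> i; apply: openI; case: ifP => // _; exact: openT.
apply/seteqP; split=> [s [sA sB] i _|s sAB].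
  by split; case: ifP => // h; [exact: sA|exact: sB].
split=> i im; have := sAB i; rewrite leq_max im ?orbT.
  by move=> /(_ isT) [].
by move=> /(_ isT) [].
Qed.

Lemma cylindersT : cylinders setT.
Proof.
exists 0%N, (fun=> setT); first by move=> _; exact: openT.
by apply/seteqP; split.
Qed.

Lemma measurable_cylinder n A : (forall i, open (A i)) ->
  measurable (cylinder n A : set seqV).
Proof. by move=> oA; apply: sub_sigma_algebra; exists n, A. Qed.

Lemma measurable_eval n : measurable_fun setT ((fun s => s n) : seqV -> bV).
Proof.
apply: (@measurability _ _ seqV bV setT _ (@open V) erefl) => _ [A oA <-].
rewrite setTI (_ : _ @^-1` A = cylinder n.+1 (fun i => if i == n then A else setT)).
  by apply: measurable_cylinder => i; case: ifP => // _; exact: openT.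
apply/seteqP; split=> [s sA i _|s /(_ n (leqnn _))]; last by rewrite eqxx.
by case: eqP => // ->.
Qed.

Definition scons (v : V) (s : nat -> V) : nat -> V :=
  fun n => if n is k.+1 then s k else v.

Lemma measurable_scons :
  measurable_fun setT ((fun p => scons p.1 p.2) : bV * seqV -> seqV).
Proof.
apply: (@measurability _ _ (bV * seqV)%type seqV setT _ cylinders erefl).
move=> _ [_ [[|n] [A oA ->]] <-]; rewrite setTI.
  by rewrite (_ : _ @^-1` _ = setT)//; apply/seteqP; split.
rewrite (_ : _ @^-1` _ = A 0%N `*` cylinder n (A \o succn)).
  by apply: measurableX; [exact: open_measurableV (oA 0%N)|apply: measurable_cylinder => i; exact: oA].
apply/seteqP; split=> [[v s] h|[v s] [/= h1 h2] [|i]//].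
  by split=> [|i im]; [exact: (h 0%N)|exact: (h i.+1)].
exact: h2.
Qed.

End SequenceSpace.

Section SequenceLaw.
Context {R : realType} {N : nat} (mu : probability (borelV R N) R).
Context (m : probability (@seqV R N) R).
Local Notation V := 'rV[R]_N.
Local Notation bV := (borelV R N).

Hypothesis m_cyl : forall n (A : nat -> set V), (forall i, open (A i)) ->
  m (cylinder n A) = (\prod_(i < n) mu (A i))%E.

Let prod_setT : (mu \x m)%E (setT `*` setT) = 1%E.
Proof.
apply: etrans (product_measure1E _ _ measurableT measurableT) _.
transitivity (mu setT * m setT)%E => //.
by rewrite !probability_setT mule1.
Qed.

(** Prepending an independent increment preserves the law: on cylinders both sides are the same
    finite product, and cylinders form a generating pi-system. *)
Lemma seq_law_scons (C : set seqV) : measurable C ->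
  pushforward (mu \x m)%E ((fun p => scons p.1 p.2) : bV * seqV -> seqV) C = m C.
Proof.
move=> mC; apply: (@measure_unique _ R seqV cylinders (fun=> setT)) => //.
- exact: cylinders_setI.
- by move=> _; exact: cylindersT.
- by rewrite bigcup_const//; exists 0%N.
- exact: measurable_scons.
- move=> ms C0 [[|n] [A oA ->]]; rewrite /pushforward; apply: etrans _ (esym (m_cyl _ oA)).
    rewrite big_ord0 -[LHS]/((mu \x m)%E ((fun p : bV * seqV => scons p.1 p.2) @^-1` cylinder 0 A)).
    rewrite (_ : _ @^-1` _ = setT `*` setT); last by apply/seteqP; split.
    exact: prod_setT.
  rewrite -[LHS]/((mu \x m)%E ((fun p : bV * seqV => scons p.1 p.2) @^-1` cylinder n.+1 A)).
  rewrite (_ : _ @^-1` _ = A 0%N `*` cylinder n (A \o succn)); last first.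
    apply/seteqP; split=> [[v s] h|[v s] [/= h1 h2] [|i]//].
      by split=> [|i im]; [exact: (h 0%N)|exact: (h i.+1)].
    exact: h2.
  have oAS i : open ((A \o succn) i) by exact: oA.
  apply: etrans (product_measure1E _ _ (open_measurableV (oA 0%N)) (measurable_cylinder n oAS)) _.
  by rewrite big_ord_recl; congr (_ * _)%E; exact: m_cyl.
- move=> ms k; rewrite -[X in (X < _)%E]/((mu \x m)%E ((fun p : bV * seqV => scons p.1 p.2) @^-1` setT)).
  rewrite preimage_setT -setXTT.
  by apply: (@le_lt_trans _ _ 1%E); rewrite ?ltry// -prod_setT.
Qed.

(** Conditioning on the first increment, in the form of Fubini for [mu] times [m]. *)
Lemma Ex_scons (f : seqV -> R) : bmeas f ->
  Ex m f = Ex mu (fun v : bV => Ex m (fun s : seqV => f (scons v s))).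
Proof.
move=> bf; have bg : bmeas (fun p : bV * seqV => f (scons p.1 p.2)).
  exact: (bmeas_comp bf measurable_scons).
apply: EFin_inj; rewrite (Ex_prod mu m bg) EFin_Ex//.
transitivity (\int[pushforward (mu \x m)%E ((fun p => scons p.1 p.2) : bV * seqV -> seqV)]_s (f s)%:E)%E.
  apply: eq_measure_integral; first exact: measurable_scons.
  by move=> ms C mC _; exact: esym (seq_law_scons mC).
rewrite integral_pushforward//.
- exact: measurable_scons.
- by apply/measurable_EFinP; case: bf.
- rewrite preimage_setT; have [mg [M hM]] := bg.
  apply: measurable_bounded_integrable => //.
    by rewrite -setXTT; apply: (@le_lt_trans _ _ 1%E); rewrite ?ltry// -prod_setT.
  exists M; split; first exact: num_real.
  by move=> x Mx y _; exact: le_trans (hM y) (ltW Mx).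
Qed.

Lemma seq_law_eval n (A : set V) : open A -> m [set s | A (s n)] = mu A.
Proof.
move=> oA; rewrite (_ : mkset _ = cylinder n.+1 (fun i => if i == n then A else setT)).
  rewrite m_cyl; last by move=> i; case: ifP => // _; exact: openT.
  rewrite big_ord_recr /= eqxx big1 ?mul1e// => i _.
  by rewrite ltn_eqF// probability_setT.
apply/seteqP; split=> [s sA i _|s /(_ n (leqnn _))]; last by rewrite eqxx.
by case: eqP => // ->.
Qed.

End SequenceLaw.

Section IidLaws.
Context {R : realType} {N : nat} {d : measure_display} {T : measurableType d}.
Context (P : probability T R) (w : nat -> T -> 'rV[R]_N).
Local Notation V := 'rV[R]_N.
Local Notation bV := (borelV R N).

Lemma rvec_measurable_fun (X : T -> V) : rvec_measurable X ->
  measurable_fun setT (X : T -> bV).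
Proof.
move=> mX; apply: (@measurability _ _ T bV setT X (@open V) erefl) => _ [A oA <-].
by rewrite setTI; exact: mX.
Qed.

Definition path (om : T) : @seqV R N := fun n => w n om.

Lemma measurable_path : (forall n, rvec_measurable (w n)) ->
  measurable_fun setT path.
Proof.
move=> mw; apply: (@measurability _ _ T seqV setT path cylinders erefl).
move=> _ [_ [n [A oA ->]] <-]; rewrite setTI.
rewrite (_ : _ @^-1` _ = \bigcap_(i in `I_n) (w i @^-1` A i)).
  by apply: fin_bigcap_measurable => // i _; exact: mw.
by apply/seteqP; split=> [om h i /= im|om h i im]; exact: h.
Qed.

Hypothesis iid : iid_uniform_ball P w.

(** [T] is arbitrary and offers no way to drop the first increment; the law of the whole sequence of
    increments does. *)
Lemma iid_laws : exists (mu : probability bV R) (m : probability (@seqV R N) R),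
  [/\ unif_law mu,
      forall n (A : nat -> set V), (forall i, open (A i)) ->
        m (cylinder n A) = (\prod_(i < n) mu (A i))%E,
      forall C : set seqV, measurable C -> m C = P (path @^-1` C) &
      measurable_fun setT path].
Proof.
have [mw uw iw] := iid; have mp := measurable_path mw.
pose W0 : {mfun T >-> bV} := HB.pack (w 0%N : T -> bV)
  (isMeasurableFun.Build _ _ _ _ _ (rvec_measurable_fun (mw 0%N))).
pose W : {mfun T >-> @seqV R N} := HB.pack path (isMeasurableFun.Build _ _ _ _ _ mp).
exists (distribution P W0), (distribution P W); split => //.
  by move=> A oA; exact: uw.
move=> n A oA.
have e1 : path @^-1` cylinder n A = \bigcap_(i in [set j | j \in iota 0 n]) (w i @^-1` A i).
  apply/seteqP; split=> [om h i /=|om h i im].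
    by rewrite mem_iota /= add0n => im; exact: h.
  by apply: h => /=; rewrite mem_iota add0n.
rewrite -[LHS]/(P (path @^-1` cylinder n A)) e1 iw ?iota_uniq//.
rewrite -[iota 0 n](_ : index_iota 0 n = _); last by rewrite /index_iota subn0.
rewrite big_mkord; apply: eq_bigr => i _.
(* Every increment has the law of [w 0] on open sets: both satisfy the same identity with the volume
   of the unit ball, which is positive and finite and cancels. *)
have [r r0 vr] := @volN_unit_ball R N.
have := uw i _ (oA i); rewrite -(uw 0%N _ (oA i)) vr => h.
have : (P (w i @^-1` A i) * r%:E * (r^-1)%:E = P (w 0%N @^-1` A i) * r%:E * (r^-1)%:E)%E by rewrite h.
by rewrite -!muleA -!EFinM divff ?gt_eqF// !mule1.
Qed.

End IidLaws.

Section NullPaths.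
Context {R : realType} {N : nat} (mu : probability (borelV R N) R).
Context (m : probability (@seqV R N) R).
Local Notation V := 'rV[R]_N.
Local Notation bV := (borelV R N).
Hypothesis mu_unif : unif_law mu.
Hypothesis N0 : (0 < N)%N.
Hypothesis m_cyl : forall n (A : nat -> set V), (forall i, open (A i)) ->
  m (cylinder n A) = (\prod_(i < n) mu (A i))%E.

Let small : set V := [set v | enorm v < 1 / 4].

Let open_small : open small.
Proof.
have := @open_eball R N 0 (1 / 4); congr open; apply/seteqP.
by split=> x; rewrite /= subr0.
Qed.

(* Two disjoint translates of the ball of radius 1/4 fit inside the unit ball. *)
Lemma unif_law_small_le : (mu small <= (1 / 2)%:E)%E.
Proof.
pose e := evec R (Ordinal N0); pose t := (1 / 2) *: e.
have te : enorm t = 1 / 2 by rewrite enormZ enorm_evec mulr1 gtr0_norm.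
pose A := [set y | small (y + t)].
have oA : open A by exact: open_preimage_add.
have mS : measurable (small : set bV) by exact: open_measurableV.
have mA : measurable (A : set bV) by exact: open_measurableV.
have SB : small `<=` @unit_ball R N.
  by move=> v; rewrite /small /unit_ball /=; lra.
have AB : A `<=` @unit_ball R N.
  move=> v; rewrite /A /small /unit_ball /= => h.
  have := enormD (v + t) (- t); rewrite addrK enormN te.
  by move: h; move: (enorm _) (enorm _) => p q; lra.
have AE : mu A = mu small by exact: unif_law_shift.
have dis : small `&` A = set0.
  apply/seteqP; split => // v [h1 h2].
  have := enormD (v + t) (- v); rewrite addrAC subrr add0r enormN te.
  move: h1 h2; rewrite /A /small /=.
  by move: (enorm _) (enorm _) => p q; lra.
have : (mu (small `|` A) <= 1)%E by apply: probability_le1; exact: measurableU.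
rewrite (_ : mu (small `|` A) = mu small + mu A)%E; last exact: measureU.
rewrite AE.
have fS : mu small \is a fin_num by rewrite fin_num_measure.
by rewrite -(fineK fS) -EFinD !lee_fin; lra.
Qed.

(* A walk staying in [D] and converging to an interior point has steps of size
   bounded below, so its increments must eventually be small. *)
Definition bad_paths : set (@seqV R N) :=
  \bigcup_n [set s | ~ @unit_ball R N (s n)] `|`
  \bigcup_k [set s | forall n, (k <= n)%N -> small (s n)].

Let measurable_eval_set n (A : set V) : open A -> measurable ([set s | A (s n)] : set seqV).
Proof.
move=> oA; rewrite (_ : mkset _ = setT `&` ((fun s => s n) : seqV -> bV) @^-1` A).
  by apply: measurable_eval => //; exact: open_measurableV.
by rewrite setTI.
Qed.

Let measurable_off n : measurable ([set s | ~ @unit_ball R N (s n)] : set seqV).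
Proof.
rewrite (_ : mkset _ = ~` [set s | @unit_ball R N (s n)]) //.
by apply: measurableC; apply: measurable_eval_set; exact: open_unit_ball.
Qed.

Let measurable_tail k : measurable ([set s | forall n, (k <= n)%N -> small (s n)] : set seqV).
Proof.
rewrite (_ : mkset _ = \bigcap_(n in [set n | (k <= n)%N]) [set s : seqV | small (s n)]).
  by apply: bigcap_measurableType => n _; exact: measurable_eval_set.
by apply/seteqP; split=> s h n; exact: h.
Qed.

Lemma measurable_bad_paths : measurable bad_paths.
Proof. by apply: measurableU; apply: bigcup_measurable. Qed.

(** A countable union of null events: an increment leaves the open unit ball with probability 0, and
    [j] given increments are all small with probability at most [(1 / 2) ^+ j]. *)
Lemma bad_paths0 : m bad_paths = 0%E.
Proof.
have m1 n : m [set s | ~ @unit_ball R N (s n)] = 0%E.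
  rewrite (_ : mkset _ = ~` [set s : seqV | @unit_ball R N (s n)]) //.
  rewrite probability_setC; last by apply: measurable_eval_set; exact: open_unit_ball.
  rewrite (seq_law_eval m_cyl n open_unit_ball) (unif_law_ball mu_unif).
  by rewrite subee.
have m2 k : m [set s | forall n, (k <= n)%N -> small (s n)] = 0%E.
  set E := mkset _.
  have Ej j : (m E <= ((1 / 2) ^+ j)%:E)%E.
    pose A i := if (i < k)%N then setT else small.
    have oA i : open (A i) by rewrite /A; case: ifP => // _; exact: openT.
    apply: (@le_trans _ _ (m (cylinder (k + j) A))).
      apply: le_measure; rewrite ?inE; [exact: measurable_tail|exact: measurable_cylinder|].
      by move=> s sE i ikj; rewrite /A; case: ltnP => // ki; exact: sE.
    rewrite m_cyl// big_split_ord /=.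
    rewrite big1 ?mul1e; last by move=> i _; rewrite /A /= ltn_ord probability_setT.
    rewrite (eq_bigr (fun=> mu small)); last by move=> i _; rewrite /A /= ltnNge leq_addr.
    elim: j => [|j IH]; first by rewrite big_ord0 expr0.
    rewrite big_ord_recl exprS EFinM; apply: lee_pmul => //.
    - by apply: prode_ge0 => i _.
    - exact: unif_law_small_le.
  apply/eqP; rewrite eq_le measure_ge0 andbT; apply/lee_addgt0Pr => e e0.
  rewrite add0e.
  have [j _ /(_ j (leqnn j)) /= je] := @near_infty_natSinv_expn_lt R (PosNum e0).
  by apply: le_trans (Ej j) _; rewrite lee_fin ltW// expr_div_n expr1n.
have nb : m.-negligible bad_paths.
  apply: negligibleU; apply: negligible_bigcup => k.
    by apply/negligibleP; [exact: measurable_off|exact: m1].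
  by apply/negligibleP; [exact: measurable_tail|exact: m2].
exact: measure_negligible measurable_bad_paths nb.
Qed.

End NullPaths.

(** * Distance to the boundary *)

Section Boundary.
Context {R : realType} {N : nat}.
Local Notation V := 'rV[R]_N.
Implicit Types (x y z : V).
Variable D : set V.

Let dists x := [set enorm (x - y) | y in bdry D].

Let dists_lb x : has_lbound (dists x).
Proof. by exists 0 => _ [y _ <-]; exact: enorm_ge0. Qed.

Lemma dist_bdry_le x y : bdry D y -> dist_bdry D x <= enorm (x - y).
Proof. by move=> by_; apply: ge_inf; [exact: dists_lb|exists y]. Qed.

Lemma dist_bdry_ge x r : bdry D !=set0 ->
  (forall y, bdry D y -> r <= enorm (x - y)) -> r <= dist_bdry D x.
Proof.
move=> [b bD] h; apply: lb_le_inf; first by exists (enorm (x - b)), b.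
by move=> _ [y yD <-]; exact: h.
Qed.

(** The infimum of the empty set is 0 by convention; thanks to this value the Lipschitz bound holds
    for every set [D]. *)
Lemma dist_bdry_empty x : bdry D = set0 -> dist_bdry D x = 0.
Proof. by move=> b0; rewrite /dist_bdry b0 image_set0 inf0. Qed.

Lemma dist_bdry_lipschitz x y : `|dist_bdry D x - dist_bdry D y| <= enorm (x - y).
Proof.
have [b0|/set0P bn0] := eqVneq (bdry D) set0.
  by rewrite !dist_bdry_empty// subrr normr0 enorm_ge0.
have half a b : dist_bdry D a - dist_bdry D b <= enorm (a - b).
  rewrite lerBlDr -lerBlDl; apply: dist_bdry_ge => // z zD.
  rewrite lerBlDl; apply: le_trans (dist_bdry_le a zD) _.
  exact: enorm_triangle.
by rewrite ler_norml; have := half x y; have := half y x; rewrite (enormB y x); lra.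
Qed.

Lemma continuous_dist_bdry : continuous (dist_bdry D).
Proof.
apply: (@lipschitz_continuous _ _ _ _ 1) => x y; rewrite mul1r.
exact: dist_bdry_lipschitz.
Qed.

Hypothesis oD : open D.

Lemma closed_bdry : closed (bdry D).
Proof.
rewrite /bdry setDE; apply: closedI; first exact: closed_closure.
exact/open_closedC/open_interior.
Qed.

(* [D] is clopen relatively to the segment. *)
Lemma segment_avoiding_bdry y z : D y ->
  (forall t, 0 <= t <= 1 -> ~ bdry D (y + t *: (z - y))) -> D z.
Proof.
move=> Dy avoid.
pose g (t : R) : V := y + t *: (z - y).
have cg : continuous g.
  move=> t; apply: cvgD; first exact: cvg_cst.
  by apply: cvgZr_tmp; exact: cvg_id.
have cA : connected (g @` `[0, 1]%classic).
  apply: connected_continuous_connected; first exact: segment_connected.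
  exact: continuous_subspaceT.
have in_D t : t \in `[0, 1] -> closure D (g t) -> D (g t).
  rewrite in_itv /= => /avoid nb cl; apply: contrapT => nD; apply: nb; split => //.
  by move/interior_subset.
have : (g @` `[0, 1]%classic) `&` D = g @` `[0, 1]%classic.
  apply: cA.
  - exists y; split => //; exists 0; last by rewrite /g scale0r addr0.
    by rewrite /= in_itv /= lexx ler01.
  - by exists D.
  - exists (closure D); first exact: closed_closure.
    apply/seteqP; split=> [a [aA aD]|a [aA aD]]; split => //; first exact: subset_closure.
    by case: aA aD => t t01 <-; exact: in_D.
move=> /seteqP[_ /(_ z)]; case => //; exists 1; last by rewrite /g scale1r addrC subrK.
by rewrite /= in_itv /= lexx ler01.
Qed.

(** The segment from [y] to [z] is too short to reach the boundary. This keeps the walk in [D]. *)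
Lemma ball_dist_bdry_sub y z : D y -> enorm (z - y) < dist_bdry D y -> D z.
Proof.
move=> Dy zy; apply: (segment_avoiding_bdry Dy) => t /andP[t0 t1] bt.
have := dist_bdry_le y bt; rewrite opprD addrA subrr add0r enormN enormZ ger0_norm//.
apply/negP; rewrite -ltNge; apply: le_lt_trans zy.
by rewrite ler_piMl// enorm_ge0.
Qed.

Hypothesis N0 : (0 < N)%N.
Hypothesis bD : bounded_set D.

(** With an empty boundary every segment issued from [y] would stay in [D], so [D] would be the
    whole space, which is unbounded in positive dimension. *)
Lemma bdry_neq0 y : D y -> bdry D !=set0.
Proof.
move=> Dy; apply: contrapT => /set0P/negP; rewrite negbK => /eqP b0.
have [M [_ hM]] := bD.
pose z : V := (`|M| + 2) *: evec R (Ordinal N0).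
have Dz : D z by apply: (segment_avoiding_bdry Dy) => t _; rewrite b0.
have := hM (`|M| + 1) _ z Dz; rewrite /=.
have h1 : M < `|M| + 1 by rewrite (le_lt_trans (ler_norm M))// ltrDl.
move=> /(_ h1); apply/negP; rewrite -ltNge.
apply: (@lt_le_trans _ _ `|z ord0 (Ordinal N0)|); last exact: coord_le_norm.
by rewrite /z !mxE !eqxx mulr1 [ltRHS]ger0_norm ?addr_ge0// ltrD2l ltr1n.
Qed.

Lemma dist_bdry_gt0 y : D y -> 0 < dist_bdry D y.
Proof.
move=> Dy; have /nbhs_eball[r r0 hr] : nbhs y D by exact: open_nbhs_nbhs.
apply: (lt_le_trans r0); apply: dist_bdry_ge; first exact: bdry_neq0 Dy.
move=> z [_ nz]; rewrite leNgt; apply/negP; rewrite enormB => zr.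
by apply: nz; apply: open_nbhs_nbhs; split => //; exact: hr.
Qed.

Lemma compact_bdry : compact (bdry D).
Proof.
have [M [_ hM]] := bD.
apply: (subclosed_compact closed_bdry (@compact_eball R N 0 (N%:R * (`|M| + 1)))).
move=> y [cy _]; have : closure [set z : V | enorm (z - 0) <= N%:R * (`|M| + 1)] y.
  apply: closureS cy => z Dz /=; rewrite subr0 (le_trans (enorm_le_norm _))// ler_wpM2l//.
  by apply: hM Dz; rewrite (le_lt_trans (ler_norm M))// ltrDl.
by have /closure_id <- := @closed_eball R N 0 (N%:R * (`|M| + 1)).
Qed.

End Boundary.

(** Cauchy's criterion with countable quantifiers only, which makes the set of convergent walks
    measurable. *)
Lemma cvgn_enormP {R : realType} {N : nat} (u : nat -> 'rV[R]_N) :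
  cvgn u <-> forall k, exists m, forall n, (m <= n)%N ->
    enorm (u n - u m) < k.+1%:R^-1.
Proof.
split=> [/cvg_ex[l ul] k|h].
  have k0 : 0 < k.+1%:R^-1 / 2 :> R by rewrite divr_gt0// invr_gt0.
  have : nbhs l [set y | enorm (y - l) < k.+1%:R^-1 / 2].
    by apply/nbhs_eball; exists (k.+1%:R^-1 / 2).
  move=> /ul[m _ hm]; exists m => n mn.
  apply: le_lt_trans (enorm_triangle _ _ l) _.
  have := hm _ mn; have := hm _ (leqnn m); rewrite /= (enormB l).
  by move: (k.+1%:R^-1) (enorm _) (enorm _) => a p q; lra.
apply/cauchy_cvgP; apply: cauchy_exP => e e0.
have [m hm] := h (Num.truncn e^-1); exists (u m).
exists m => // n /= mn; rewrite -ball_normE /ball_ /= -normrN opprB.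
apply: le_lt_trans (norm_le_enorm _) _; apply: (lt_trans (hm n mn)).
by rewrite -[ltRHS]invrK ltf_pV2 ?posrE ?invr_gt0// truncnS_gt.
Qed.

(** * The walk as a measurable function of its start and its increments *)

Section Walk.
Context {R : realType} {N : nat}.
Local Notation V := 'rV[R]_N.
Local Notation bV := (borelV R N).
Local Notation S := (@seqV R N).
Variables (D : set V) (eps : R).

Definition walk (x : V) (n : nat) (s : S) : V :=
  ball_walk D (fun n (s : S) => s n) eps x n s.

Definition walk_lim (x : V) (s : S) : V :=
  ball_walk_lim D (fun n (s : S) => s n) eps x s.

Definition step (y : V) : R := Order.min eps (dist_bdry D y).

Lemma walkS x n s : walk x n.+1 s = walk x n s + step (walk x n s) *: s n.
Proof. by []. Qed.

Lemma walk_scons x n v s : walk x n.+1 (scons v s) = walk (x + step x *: v) n s.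
Proof. by elim: n => [//|n IH]; rewrite walkS IH. Qed.

Lemma walk_lim_scons x v s : walk_lim x (scons v s) = walk_lim (x + step x *: v) s.
Proof.
rewrite /walk_lim /ball_walk_lim.
have -> : (fun n => ball_walk D (fun n (s : S) => s n) eps (x + step x *: v) n s) =
    (fun n => walk x n.+1 (scons v s)).
  by apply/funext => n; rewrite walk_scons.
(* The limit is a choice among all limits. Identifying the two predicates under the choice covers
   divergent walks as well, whose default values then agree. *)
rewrite /lim /lim_in; congr (xget _ _); apply/funext => l.
exact/esym/(cvg_shiftS (fun n => walk x n (scons v s))).
Qed.

Lemma measurable_step : measurable_fun setT (step : bV -> R).
Proof.
apply: (@measurable_minr _ bV R setT (fun=> eps) (dist_bdry D)).
  exact: measurable_cst.
exact: continuous_measurableV (@continuous_dist_bdry R N D).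
Qed.

Lemma measurable_walk n :
  measurable_fun setT ((fun p => walk p.1 n p.2) : bV * S -> bV).
Proof.
elim: n => [|n IH]; first exact: measurable_fst.
apply: (measurable_addV IH).
apply: (@measurable_scaleV _ _ _ _ (fun p : bV * S => step (walk p.1 n p.2))
  (fun p => p.2 n)).
  exact: (measurableT_comp measurable_step IH).
exact: (measurableT_comp (measurable_eval n) measurable_snd).
Qed.

Lemma measurable_walk_cvg :
  measurable ([set p | cvgn (fun n => walk p.1 n p.2)] : set (bV * S)).
Proof.
rewrite (_ : mkset _ = \bigcap_k \bigcup_m \bigcap_(n in [set n | (m <= n)%N])
    [set p : bV * S | enorm (walk p.1 n p.2 - walk p.1 m p.2) < k.+1%:R^-1]).
  apply: bigcapT_measurable => k; apply: bigcupT_measurable => m.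
  apply: bigcap_measurableType => n _.
  have mf : measurable_fun setT
      (fun p : bV * S => enorm (walk p.1 n p.2 - walk p.1 m p.2)).
    have md : measurable_fun setT
        ((fun p => walk p.1 n p.2 - walk p.1 m p.2) : bV * S -> bV).
      apply: measurable_addV; first exact: measurable_walk.
      rewrite (_ : (fun _ => _) = (fun p : bV * S => (-1 : R) *: walk p.1 m p.2)); last first.
        by apply/funext => p; rewrite scaleN1r.
      by apply: measurable_scaleV; [exact: measurable_cst|exact: measurable_walk].
    exact: (measurableT_comp (continuous_measurableV (@continuous_enorm R N)) md).
  rewrite (_ : mkset _ = setT `&` (fun p : bV * S =>
      enorm (walk p.1 n p.2 - walk p.1 m p.2)) @^-1` `]-oo, k.+1%:R^-1[%classic).
    by apply: mf => //; exact: measurable_itv.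
  by rewrite setTI; apply/seteqP; split=> p /=; rewrite in_itv.
apply/seteqP; split=> [p /cvgn_enormP h k _|p h].
  by have [m hm] := h k; exists m.
by apply/cvgn_enormP => k; have [m _ hm] := h k Logic.I; exists m => n mn; exact: hm.
Qed.

(** On the measurable set of convergence the coordinates are limits of measurable functions; off it
    the limit is the constant [point]. *)
Lemma measurable_walk_lim :
  measurable_fun setT ((fun p => walk_lim p.1 p.2) : bV * S -> bV).
Proof.
apply: measurable_rV => i.
pose C : set (bV * S) := [set p | cvgn (fun n => walk p.1 n p.2)].
have mC : measurable C by exact: measurable_walk_cvg.
pose pt : V := point.
pose h (n : nat) (p : bV * S) : R := if p \in C then walk p.1 n p.2 ord0 i else pt ord0 i.
apply: (@measurable_fun_cvg _ _ R setT h).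
  move=> n; apply: measurable_fun_ifT.
  - apply: (measurable_fun_bool true); rewrite setTI.
    rewrite (_ : _ @^-1` _ = C)//; apply/seteqP; split=> p /=; first by move/set_mem.
    by move/mem_set.
  - exact: measurable_coordX (measurable_walk n).
  - exact: measurable_cst.
move=> p _; rewrite /h; have [cp|ncp] := pselect (C p).
  rewrite mem_set//.
  have cl : (fun n => walk p.1 n p.2) @ \oo --> walk_lim p.1 p.2 by exact: cp.
  exact: (cvg_comp _ _ cl (@continuous_coord R N i _)).
rewrite memNset//; have -> : walk_lim p.1 p.2 = pt by exact: dvgP.
exact: cvg_cst.
Qed.

End Walk.

(** * The expected payoff and its mean value property *)

Section Potential.
Context {R : realType} {N : nat}.
Local Notation V := 'rV[R]_N.
Local Notation bV := (borelV R N).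
Local Notation S := (@seqV R N).

(** Preimages of open intervals under [f] are traces on [A] of open sets; the extension by 0 adds
    the complement of [A] exactly when the interval contains 0. *)
Lemma bmeas_patch (A : set V) (f : V -> R) : compact A ->
  {within A, continuous f} -> bmeas (f \_ A : bV -> R).
Proof.
move=> cA cf.
have clA : closed A by apply: compact_closed => //; exact: norm_hausdorff.
have mA : measurable (A : set bV) by exact: closed_measurableV.
split; last first.
  have [M [_ hM]] := compact_bounded (continuous_compact cf cA).
  exists (`|M| + 1) => x; rewrite patchE; case: ifPn => [|_]; last first.
    by rewrite normr0 addr_ge0.
  rewrite inE => Ax; apply: hM; last by exists x.
  by rewrite (le_lt_trans (ler_norm _))// ltrDl.
apply: (@measurability _ _ bV R setT _ _ (RGenOpens.measurableE R)).
move=> _ [_ [a [b ->]] <-]; set I : set R := `]a, b[%classic.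
have /open_subspaceP[W oW WA] : open (f @^-1` I : set (subspace A)).
  by move/continuousP : cf; apply; exact: interval_open.
rewrite setTI (_ : _ @^-1` _ = (W `&` A) `|` (if 0 \in I then ~` A else set0)).
  apply: measurableU; first by apply: measurableI => //; exact: open_measurableV.
  by case: ifP => _; [exact: measurableC|exact: measurable0].
apply/seteqP; split=> [x|x].
  rewrite /preimage /= patchE; have [Ax|nAx] := pselect (A x).
    rewrite mem_set// => Ix; left; by have : (f @^-1` I `&` A) x by []; rewrite -WA.
  by rewrite memNset// => I0; right; rewrite mem_set.
move=> [|].
  move=> WAx; have [Ix Ax] : (f @^-1` I `&` A) x by rewrite -WA.
  by rewrite /preimage /= patchE mem_set.
case: ifPn => // /set_mem I0 nAx.
by rewrite /preimage /= patchE memNset.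
Qed.

Variables (D : set V) (F : V -> R).

(* A walk that diverges has limit [point] by convention, so [F] is kept at that value. *)
Definition bdata : V -> R := F \_ (bdry D `|` [set point]).

Lemma bmeas_bdata : bounded_set D -> {within bdry D, continuous F} ->
  bmeas (bdata : bV -> R).
Proof.
move=> bD cF; apply: bmeas_patch.
  by apply: compactU; [exact: compact_bdry|exact: compact_set1].
apply: withinU_continuous => //.
- exact: closed_bdry.
- by apply: compact_closed; [exact: norm_hausdorff|exact: compact_set1].
- exact: continuous_subspace1.
Qed.

Context (mu : probability bV R) (m : probability S R).
Hypothesis mu_unif : unif_law mu.
Hypothesis m_cyl : forall n (A : nat -> set V), (forall i, open (A i)) ->
  m (cylinder n A) = (\prod_(i < n) mu (A i))%E.
Hypothesis bdata_meas : bmeas (bdata : bV -> R).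
Variable eps : R.

Definition payoff (p : bV * S) : R := bdata (walk_lim D eps p.1 p.2).

Definition potential (x : V) : R := Ex m (fun s : S => payoff (x : bV, s)).

Lemma bmeas_payoff : bmeas payoff.
Proof. exact: (bmeas_comp bdata_meas (measurable_walk_lim D eps)). Qed.

Lemma bmeas_potential : bmeas (potential : bV -> R).
Proof. exact: (@bmeas_Ex1 _ _ bV S R mu m payoff bmeas_payoff). Qed.

(** The identity holds at every [x], in [D] or not, because the recursion of the walk and the
    default value of its limit are the same everywhere. *)
Lemma potential_step x :
  potential x = Ex mu (fun v : bV => potential (x + step D eps x *: clip v)).
Proof.
transitivity (Ex mu (fun v : bV => potential (x + step D eps x *: (v : V)))).
  rewrite {1}/potential (Ex_scons m_cyl); last exact: bmeas_pair1 bmeas_payoff _.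
  apply: eq_Ex => v; apply: eq_Ex => s.
  by rewrite /payoff /= walk_lim_scons.
have mh : measurable_fun setT ((fun v => x + step D eps x *: (v : V)) : bV -> bV).
  apply: measurable_addV; first exact: (@measurable_cst _ _ bV bV setT x).
  apply: measurable_scaleV; first exact: measurable_cst.
  exact: (@measurable_id _ bV setT).
apply/esym.
exact: (@Ex_clip _ _ mu mu_unif (fun v : V => potential (x + step D eps x *: v))).
Qed.

(** The distance to the boundary is 1-Lipschitz, so at [y] it still exceeds half of its value at
    [x0], hence [eps], and the step is exactly [eps]. *)
Lemma potential_mean_value x0 y : 0 < eps <= dist_bdry D x0 / 2 ->
  enorm (y - x0) < dist_bdry D x0 / 2 ->
  potential y = Ex mu (fun v : bV => potential (y + eps *: clip v)).
Proof.
move=> /andP[e0 eL] yL; rewrite potential_step (_ : step D eps y = eps)//.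
apply/min_idPl; have := dist_bdry_lipschitz D y x0; rewrite ler_norml => /andP[+ _].
by move: eL yL; move: (enorm _) (dist_bdry D x0) (dist_bdry D y) => a b c; lra.
Qed.

End Potential.

Section WalkLimit.
Context {R : realType} {N : nat}.
Local Notation V := 'rV[R]_N.
Variables (D : set V) (eps : R).
Hypotheses (oD : open D) (N0 : (0 < N)%N) (bD : bounded_set D) (eps0 : 0 < eps).

Lemma step_gt0 y : D y -> 0 < step D eps y.
Proof. by move=> Dy; rewrite /step lt_min eps0 /= dist_bdry_gt0. Qed.

Lemma walk_in x (s : nat -> V) n : D x -> (forall n, unit_ball (s n)) ->
  D (walk D eps x n s).
Proof.
move=> Dx s1; elim: n => [//|n IH]; rewrite walkS.
apply: (ball_dist_bdry_sub oD IH).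
rewrite addrAC subrr add0r enormZ gtr0_norm ?step_gt0//.
apply: (@lt_le_trans _ _ (step D eps (walk D eps x n s))).
  by rewrite gtr_pMr ?step_gt0//; exact: s1.
by rewrite /step ge_min lexx orbT.
Qed.

Lemma cvg_walk_bdry x (s : nat -> V) : D x -> ~ bad_paths s ->
  cvgn (fun n => walk D eps x n s) -> bdry D (walk_lim D eps x s).
Proof.
move=> Dx ns cw.
have s1 n : unit_ball (s n) by apply: contrapT => h; apply: ns; left; exists n.
set l := walk_lim D eps x s.
have wl : (fun n => walk D eps x n s) @ \oo --> l by exact: cw.
have Dw n : D (walk D eps x n s) by exact: walk_in.
split.
  move=> B /wl[n _ hn]; exists (walk D eps x n s); split => //; exact: (hn n (leqnn n)).
move=> /interior_subset Dl; apply: ns; right.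
have c0 : 0 < step D eps l by exact: step_gt0.
have cs : continuous (step D eps).
  move=> y; apply: (@continuous_min _ _ (fun=> eps) (dist_bdry D)).
    exact: cst_continuous.
  exact: continuous_dist_bdry.
(* Near an interior limit [l], consecutive points are closer than [step D eps l / 16] while the step
   exceeds [step D eps l / 2], so the increments have norm below 1/8, less than the 1/4 of the small
   ball. *)
have e16 : 0 < step D eps l / 32 by rewrite divr_gt0.
have /wl[n1 _ h1] : nbhs l [set y | enorm (y - l) < step D eps l / 32].
  by apply/nbhs_eball; exists (step D eps l / 32).
have /wl[n2 _ h2] : nbhs l [set y | step D eps l / 2 < step D eps y].
  apply: (cs l [set r | step D eps l / 2 < r]).
  apply: (@open_nbhs_nbhs R); split; first exact: open_gt.
  by rewrite /= ltr_pdivrMr// ltr_pMr// ltr1n.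
exists (maxn n1 n2) => // n; rewrite geq_max => /andP[n1n n2n] /=.
have := h1 _ n1n; have := h1 _ (leqW n1n); have /= := h2 _ n2n.
rewrite walkS; set y := walk D eps x n s; have sy : 0 < step D eps y := step_gt0 (Dw n).
move=> hs /= ha hb.
have := enormB l y.
have := enorm_triangle (y + step D eps y *: s n) y l.
rewrite [X in enorm X <= _]addrAC subrr add0r enormZ (gtr0_norm sy) => hc hd.
have en := enorm_ge0 (s n).
have {}hc : step D eps y * enorm (s n) < step D eps l / 16.
  by apply: (le_lt_trans hc); rewrite hd; move: ha hb; move: (enorm _) (enorm _) (step D eps l) => p q r; lra.
rewrite ltNge; apply/negP => h4.
have : step D eps y * (1 / 4) <= step D eps y * enorm (s n).
  by rewrite ler_pM2l.
move: hs hc; move: (step D eps y * enorm (s n)) (step D eps y) (step D eps l) c0 => p q r; lra.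
Qed.

End WalkLimit.

Section WalkExpectation.
Context {R : realType} {N : nat} {d : measure_display} {T : measurableType d}.
Context (P : probability T R) (w : nat -> T -> 'rV[R]_N).
Local Notation V := 'rV[R]_N.
Local Notation bV := (borelV R N).
Local Notation S := (@seqV R N).
Variables (D : set V) (F : V -> R) (mu : probability bV R) (m : probability S R).
Hypotheses (mu_unif : unif_law mu)
  (m_cyl : forall n (A : nat -> set V), (forall i, open (A i)) ->
    m (cylinder n A) = (\prod_(i < n) mu (A i))%E)
  (mP : forall C : set S, measurable C -> m C = P (path w @^-1` C))
  (mp : measurable_fun setT (path w : T -> S)).
Hypotheses (oD : open D) (N0 : (0 < N)%N) (bD : bounded_set D)
  (cF : {within bdry D, continuous F}).
Variables (eps : R) (x : V).
Hypotheses (eps0 : 0 < eps) (Dx : D x).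

Lemma bdata_walk_lim (s : S) : ~ bad_paths s ->
  bdata D F (walk_lim D eps x s) = F (walk_lim D eps x s).
Proof.
move=> ns; rewrite /bdata patchE mem_set//.
have [cw|ncw] := pselect (cvgn (fun n => walk D eps x n s)).
  by left; exact: cvg_walk_bdry.
by right; exact: dvgP.
Qed.

Lemma ball_walk_lim_path om :
  ball_walk_lim D w eps x om = walk_lim D eps x (path w om).
Proof.
rewrite /walk_lim /ball_walk_lim.
suff -> : (fun n => ball_walk D w eps x n om) =
  (fun n => ball_walk D (fun n (s : S) => s n) eps x n (path w om)) by [].
by apply/funext; elim => [//|n IH] /=; rewrite IH.
Qed.

(** The integrand of [u_eps] agrees with the measurable [payoff] along [path w] outside the null set
    of bad paths, and changing an arbitrary integrand on a null set does not affect its integral. *)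
Lemma u_eps_potential : u_eps P D F w eps x = potential D F m eps x.
Proof.
pose f (s : S) : R := payoff D F eps (x : bV, s).
have bf : bmeas f.
  exact: bmeas_pair1 (bmeas_payoff (bmeas_bdata bD cF) eps) _.
have mf : measurable_fun setT (EFin \o f) by apply/measurable_EFinP; case: bf.
rewrite /u_eps /potential /Ex /Rintegral; congr fine.
transitivity (\int[P]_om (f (path w om))%:E)%E.
  apply: (@eq_integral_off_null _ T R P (path w @^-1` bad_paths)).
  - by rewrite -[X in measurable X]setTI; apply: mp => //; exact: measurable_bad_paths.
  - exact: etrans (esym (mP measurable_bad_paths)) (bad_paths0 mu_unif N0 m_cyl).
  - by move=> om ng; rewrite ball_walk_lim_path /f /payoff bdata_walk_lim.
have intf : P.-integrable setT ((EFin \o f) \o path w).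
  exact: (bmeas_integrable P (bmeas_comp bf mp)).
transitivity (\int[pushforward P (path w : T -> S)]_s (f s)%:E)%E.
  by rewrite integral_pushforward.
by apply: eq_measure_integral => C mC _; exact: esym (mP mC).
Qed.

End WalkExpectation.

Theorem theorem2p9 (R : realType) (N : nat) (D : set 'rV[R]_N)
  (d : measure_display) (T : measurableType d) (P : probability T R)
  (w : nat -> T -> 'rV[R]_N) (F : 'rV[R]_N -> R)
  (J : nat -> R) (u : 'rV[R]_N -> R) :
  open D -> bounded_set D -> connected D ->
  {within bdry D, continuous F} ->
  iid_uniform_ball P w ->
  (forall k, 0 < J k < 1) ->
  (forall k, J k.+1 < J k) ->
  J @ \oo --> 0 ->
  (forall x, D x -> {for x, continuous u}) ->
  (forall K : set 'rV[R]_N, compact K -> K `<=` D ->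
     forall e : R, 0 < e -> \forall k \near \oo, forall x, K x ->
       `| u_eps P D F w (J k) x - u x | < e) ->
  harmonic_in D u.
Proof.
move=> oD bD _ cF iid J01 _ J0 cu hu x0 Dx0.
(* In dimension 0 there is no direction to differentiate in and the Laplacian is an empty sum; only
   continuity remains. *)
have [N_eq0|N0] := posnP N.
  subst N; split=> [|[]//|[]//|[]//|]; first exact: cu.
  by rewrite big_ord0.
have [mu [m [mu_unif m_cyl mP mp]]] := iid_laws iid.
have d0 : 0 < dist_bdry D x0 by exact: dist_bdry_gt0.
(* Half the distance keeps the closed ball inside [D] and leaves every point of the open ball
   farther than [L] from the boundary. *)
pose L := dist_bdry D x0 / 2.
have L0 : 0 < L by rewrite divr_gt0.
pose K := [set y : 'rV[R]_N | enorm (y - x0) <= L].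
have KD : K `<=` D.
  move=> y Ky; apply: (ball_dist_bdry_sub oD Dx0); apply: (le_lt_trans Ky).
  by rewrite /L ltr_pdivrMr// ltr_pMr// ltr1n.
have cK : compact K by exact: compact_eball.
have mvl : mean_value_limit mu x0 L u.
  split.
    have cuK : {within K, continuous u}.
      by apply: continuous_in_subspaceT => y /set_mem/KD; exact: cu.
    have := bmeas_comp (bmeas_patch cK cuK) (measurable_ball_pt x0 L).
    congr bmeas; apply/funext => v /=; rewrite patchE mem_set//.
    exact: (ltW (ball_pt_lt x0 L0 v)).
  (* [J k < t] is what [mean_value_limit] asks of the step, [J k < L] is what the mean value
     property of the potential asks. *)
  move=> t t0; have tL : 0 < Num.min t L by rewrite lt_min t0 L0.
  have [k [Jk uk]] : exists k, J k < Num.min t L /\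
      forall x, K x -> `|u_eps P D F w (J k) x - u x| < t.
    have [k1 _ h1] := cvgr_lt (0 : R) J0 _ tL.
    have [k2 _ h2] := hu K cK KD t t0.
    exists (maxn k1 k2); split; first by apply: h1; rewrite /= leq_maxl.
    by apply: h2; rewrite /= leq_maxr.
  move: Jk; rewrite lt_min => /andP[Jt JL].
  have /andP[Jk0 _] := J01 k.
  exists (potential D F m (J k)), (J k); split.
  - exact: (bmeas_potential mu m (bmeas_bdata bD cF)).
  - by rewrite Jk0.
  - move=> y yL; apply: (potential_mean_value mu_unif m_cyl (bmeas_bdata bD cF) _ yL).
    by rewrite Jk0 (ltW JL).
  - move=> y yL; have Ky : K y := ltW yL.
    rewrite -(u_eps_potential mu_unif m_cyl mP mp oD N0 bD cF Jk0 (KD _ Ky)).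
    exact: uk.
have [] := mean_value_limit_harmonic mu_unif N0 L0 mvl.
  move=> z zL; apply: cu; apply: KD; apply: ltW; apply: (lt_trans zL).
  by rewrite ltr_pdivrMr// ltr_pMr// ltr1n.
by move=> h1 h2 h3 h4; split => //; exact: cu.
Qed.
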